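(* Let $\Gamma$ be a finite, connected, labelled simplicial graph on at least three vertices. If $T$ is a $VC$-tree for $A_\Gamma$, then every vertex group of $J(\Gamma)$ acts elliptically on $T$. As a consequence, (the Bass–Serre tree of) $J(\Gamma)$ is a JSJ tree for $A_\Gamma$ over virtually cyclic subgroups.
   Context: Labels $m_{ab}\in\mathbb{Z}_{\ge2}$ on edges; $A_\Gamma=\langle V(\Gamma)\mid \mathrm{prod}(a,b,m_{ab})=\mathrm{prod}(b,a,m_{ab})\ \forall\{a,b\}\in E(\Gamma)\rangle$ ($\mathrm{prod}(u,v,n)$ = prefix of length $n$ of $uvuv\cdots$). For a full subgraph $\Lambda$, $A_\Lambda=\langle V(\Lambda)\rangle\le A_\Gamma$. For an edge $\{a,b\}$ with $m=m_{ab}\ge3$, $z_{ab}$ is $\mathrm{prod}(a,b,m)$ if $m$ is even and $\mathrm{prod}(a,b,m)^2$ if $m$ is odd (it generates the centre of $\langle a,b\rangle$). A $G$-tree is a simplicial tree with a minimal action of $G$ by simplicial isometries without edge inversions; it is a $VC$-tree ($VC$-splitting) if all edge stabilisers are virtually cyclic. A subgroup acts elliptically if it fixes a point. A $VC$-tree $T$ is a JSJ tree over virtually cyclic subgroups if (i) it is universally elliptic: every edge stabiliser of $T$ acts elliptically on every $VC$-tree of $G$; and (ii) every vertex stabiliser of $T$ acts elliptically on every universally elliptic $VC$-tree of $G$. A big chunk of $\Gamma$ is a connected induced subgraph without separating vertices, maximal under inclusion. A leaf is an edge $\{a,b\}$ where $b$ (the tip) has valence one; it is even if $m_{ab}$ is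 even, toral if $m_{ab}=2$, braided even if $m_{ab}=2m\ge4$. $J(\Gamma)$ is the following graph of groups with fundamental group $A_\Gamma$ (vertex groups viewed as subgroups of $A_\Gamma$). There is a white vertex for each separating vertex $v$ of $\Gamma$, with group $\langle v\rangle$, and a black vertex for each big chunk $\Lambda$; a white $v$ and black $\Lambda$ are joined by an edge iff $v\in\Lambda$, with edge group $\langle v\rangle$ included in the obvious way. If $\Lambda$ is not an even leaf, its black vertex group is $A_\Lambda$. If $\Lambda=\{a,b\}$ is a toral leaf with tip $b$, its black vertex group is $\langle a\rangle$ and there is additionally a loop at this vertex with edge group $\langle a\rangle$ (both inclusions the identity) and stable letter $b$. If $\Lambda=\{a,b\}$ is a braided even leaf with label $2m$ and tip $b$, its black vertex group is $\langle a,z_{ab}\rangle\cong\mathbb{Z}^2$, and there is an extra red vertex with group $\langle ab\rangle$ joined only to $\Lambda$ by an edge with group $\langle z_{ab}\rangle$, identifying $(ab)^m$ with $z_{ab}$. The Bass–Serre tree of $J(\Gamma)$ is also denoted $J(\Gamma)$. *)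

(* Defs.v *)
From Stdlib Require Import FunctionalExtensionality PropExtensionality ZArith List.
From mathcomp Require Import all_boot.
Set Implicit Arguments. Unset Strict Implicit. Unset Printing Implicit Defensive.

Record Grp := {
  gcar :> Type;
  gmul : gcar -> gcar -> gcar;
  ginv : gcar -> gcar;
  gone : gcar;
  gmulA : forall x y z, gmul x (gmul y z) = gmul (gmul x y) z;
  gmul1 : forall x, gmul gone x = x;
  gmulV : forall x, gmul (ginv x) x = gone }.
Arguments gone {g} : rename.

Record GTree (G : Grp) := { tv : Type; tadj : tv -> tv -> Prop; tact : G -> tv -> tv }.
Arguments tv {G} T : rename.
Arguments tadj {G} T _ _ : rename.
Arguments tact {G} T _ _ : rename.

Section GroupDefs.
Variable G : Grp.
Local Notation GTree := (GTree G).

Fixpoint gpow (x : G) (n : nat) : G :=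
  match n with 0 => gone | S k => gmul x (gpow x k) end.

Definition gzpow (x : G) (k : Z) : G :=
  match k with
  | Z0 => gone
  | Zpos p => gpow x (Pos.to_nat p)
  | Zneg p => ginv (gpow x (Pos.to_nat p))
  end.

Fixpoint alt (u v : G) (n : nat) : G :=
  match n with 0 => gone | S k => gmul u (alt v u k) end.

Inductive gsub (S : G -> Prop) : G -> Prop :=
  | gs_in x : S x -> gsub S x
  | gs_one : gsub S gone
  | gs_mul x y : gsub S x -> gsub S y -> gsub S (gmul x y)
  | gs_inv x : gsub S x -> gsub S (ginv x).

Definition group_hom (H : Grp) (phi : G -> H) : Prop :=
  forall x y, phi (gmul x y) = gmul (phi x) (phi y).

Definition virtually_cyclic (H : G -> Prop) : Prop :=
  exists c, H c /\ exists l : list G, (forall h, In h l -> H h) /\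
    forall h, H h -> exists h0 k, In h0 l /\ h = gmul h0 (gzpow c k).

Section Walks.
Variables (X : Type) (e : X -> X -> Prop).
Fixpoint walk (x : X) (p : list X) (y : X) : Prop :=
  match p with nil => x = y | z :: q => e x z /\ walk z q y end.
Fixpoint nobacktrack (x : X) (p : list X) : Prop :=
  match p with
  | z :: ((w :: _) as q) => w <> x /\ nobacktrack z q
  | _ => True
  end.
Definition reduced_walk x p y := walk x p y /\ nobacktrack x p.
Definition is_tree : Prop :=
  forall x y, exists p, reduced_walk x p y /\ forall q, reduced_walk x q y -> q = p.
End Walks.

Definition stab (T : GTree) (x : tv T) : G -> Prop := fun g => tact T g x = x.
Definition edge_stab (T : GTree) (x y : tv T) : G -> Prop :=
  fun g => tact T g x = x /\ tact T g y = y.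
Arguments stab T x _ : clear implicits.
Arguments edge_stab T x y _ : clear implicits.

Definition is_Gtree (T : GTree) : Prop :=
  inhabited (tv T) /\
  (forall x y, tadj T x y -> tadj T y x) /\
  (forall x, ~ tadj T x x) /\
  is_tree (tadj T) /\
  (forall x, tact T gone x = x) /\
  (forall g h x, tact T g (tact T h x) = tact T (gmul g h) x) /\
  (forall g x y, tadj T x y <-> tadj T (tact T g x) (tact T g y)) /\
  (forall g x y, tadj T x y -> ~ (tact T g x = y /\ tact T g y = x)) /\
  (forall S : tv T -> Prop, (exists x, S x) ->
     (forall x y, S x -> S y -> exists p, walk (tadj T) x p y /\ forall z, In z p -> S z) ->
     (forall g x, S x -> S (tact T g x)) -> forall x, S x).

Definition VC_tree (T : GTree) : Prop :=
  is_Gtree T /\ forall x y, tadj T x y -> virtually_cyclic (edge_stab T x y).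

(* H acts elliptically (fixes a point; no inversions, so a vertex) *)
Definition elliptic (H : G -> Prop) (T : GTree) : Prop :=
  exists x, forall g, H g -> tact T g x = x.

Definition universally_elliptic (T : GTree) : Prop :=
  forall x y, tadj T x y ->
  forall T' : GTree, VC_tree T' -> elliptic (edge_stab T x y) T'.

Definition JSJ_tree (T : GTree) : Prop :=
  VC_tree T /\ universally_elliptic T /\
  forall x (T' : GTree), VC_tree T' -> universally_elliptic T' -> elliptic (stab T x) T'.

Definition coset (g : G) (H : G -> Prop) : G -> Prop :=
  fun x => exists h, H h /\ x = gmul g h.
Definition gleft (g : G) (C : G -> Prop) : G -> Prop :=
  fun x => exists c, C c /\ x = gmul g c.

Lemma gleft_coset g g0 H : gleft g (coset g0 H) = coset (gmul g g0) H.
Proof.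
apply: functional_extensionality => x; apply: propositional_extensionality; split.
- move=> [c [[h [Hh ->]] ->]]; exists h; split => //; by rewrite gmulA.
- move=> [h [Hh ->]]; exists (gmul g0 h); split; last by rewrite gmulA.
  by exists h.
Qed.

End GroupDefs.

Section Gamma.
Variables (V : finType) (adj : rel V) (m : V -> V -> nat).

Definition connected_in (S : {set V}) : Prop :=
  forall x y, x \in S -> y \in S ->
    connect [rel u w | [&& adj u w, u \in S & w \in S]] x y.

Definition separating_in (S : {set V}) (v : V) : Prop :=
  v \in S /\ ~ connected_in (S :\ v).
Definition separating (v : V) : Prop := separating_in [set: V] v.

Definition chunk_like (S : {set V}) : Prop :=
  S != set0 /\ connected_in S /\ forall v, ~ separating_in S v.
Definition big_chunk (S : {set V}) : Prop :=
  chunk_like S /\ forall S' : {set V}, S \subset S' -> chunk_like S' -> S' = S.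

Definition leaf_of (L : {set V}) (a b : V) : Prop :=
  L = [set a; b] /\ adj a b /\ #|[set x | adj b x]| = 1.
Definition even_leaf (L : {set V}) : Prop :=
  exists a b, leaf_of L a b /\ ~~ odd (m a b).
Definition toral_leaf (L : {set V}) a b : Prop := leaf_of L a b /\ m a b = 2.
Definition braided_leaf (L : {set V}) a b : Prop :=
  leaf_of L a b /\ ~~ odd (m a b) /\ 4 <= m a b.

Variables (G : Grp) (gen : V -> G).

Definition artin_relations (H : Grp) (f : V -> H) : Prop :=
  forall a b, adj a b -> alt (f a) (f b) (m a b) = alt (f b) (f a) (m a b).
Definition artin_presentation : Prop :=
  artin_relations gen /\
  (forall x : G, gsub (fun y => exists v, y = gen v) x) /\
  (forall (H : Grp) (f : V -> H), artin_relations f ->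
     exists phi : G -> H, group_hom phi /\ forall v, phi (gen v) = f v).

Definition zelt (a b : V) : G :=
  let w := alt (gen a) (gen b) (m a b) in if odd (m a b) then gmul w w else w.

Inductive JV := JWhite of V | JBlack of {set V} | JRed of V & V.

Definition Jvalid (u : JV) : Prop :=
  match u with
  | JWhite v => separating v
  | JBlack L => big_chunk L
  | JRed a b => big_chunk [set a; b] /\ braided_leaf [set a; b] a b
  end.

Definition Jvgroup (u : JV) : G -> Prop :=
  match u with
  | JWhite v => gsub (fun x => x = gen v)
  | JBlack L => fun g =>
      (exists a b, toral_leaf L a b /\ gsub (fun x => x = gen a) g) \/
      (exists a b, braided_leaf L a b /\ gsub (fun x => x = gen a \/ x = zelt a b) g) \/
      (~ even_leaf L /\ gsub (fun x => exists v, v \in L /\ x = gen v) g)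
  | JRed a b => gsub (fun x => x = gmul (gen a) (gen b))
  end.

Inductive JE := EWB of V & {set V} | ELoop of V & V | ERed of V & V.

Definition Evalid (e : JE) : Prop :=
  match e with
  | EWB v L => separating v /\ big_chunk L /\ v \in L
  | ELoop a b => big_chunk [set a; b] /\ toral_leaf [set a; b] a b
  | ERed a b => Jvalid (JRed a b)
  end.
Definition Eorig (e : JE) : JV :=
  match e with EWB v _ => JWhite v | ELoop a b => JBlack [set a; b] | ERed a b => JBlack [set a; b] end.
Definition Eterm (e : JE) : JV :=
  match e with EWB _ L => JBlack L | ELoop a b => JBlack [set a; b] | ERed a b => JRed a b end.
Definition Estable (e : JE) : G :=
  match e with ELoop _ b => gen b | _ => gone end.
(* edge groups (the edges of the Bass-Serre tree are indexed by their cosets) *)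
Definition Egroup (e : JE) : G -> Prop :=
  match e with
  | EWB v _ => gsub (fun x => x = gen v)
  | ELoop a _ => gsub (fun x => x = gen a)
  | ERed a b => gsub (fun x => x = zelt a b)
  end.

Definition BSv : Type :=
  { p : JV * (G -> Prop) | Jvalid p.1 /\ exists g, p.2 = coset g (Jvgroup p.1) }.

Definition BSadj (p q : BSv) : Prop :=
  exists e g, Evalid e /\
   ((sval p = (Eorig e, coset g (Jvgroup (Eorig e))) /\
     sval q = (Eterm e, coset (gmul g (Estable e)) (Jvgroup (Eterm e)))) \/
    (sval q = (Eorig e, coset g (Jvgroup (Eorig e))) /\
     sval p = (Eterm e, coset (gmul g (Estable e)) (Jvgroup (Eterm e))))).

Lemma BSact_ok (g : G) (p : BSv) :
  Jvalid (sval p).1 /\ exists g', gleft g (sval p).2 = coset g' (Jvgroup (sval p).1).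
Proof.
case: p => [[u C] [Hu [g0 HC]]] /=; split => //.
exists (gmul g g0); rewrite /= in HC; rewrite HC; exact: gleft_coset.
Qed.

Definition BSact (g : G) (p : BSv) : BSv :=
  exist _ ((sval p).1, gleft g (sval p).2) (BSact_ok g p).

Definition BS_tree : GTree G := {| tv := BSv; tadj := BSadj; tact := BSact |}.

End Gamma.

(* Main.v *)
(* By a deformed reflection representation of A_Gamma, with real
   entries, distinct standard generators have no common nontrivial powers, and for two
   neighbours w, w' of v the central elements c = (vw)^m, c' = (vw')^m' are independent
   modulo <v>.  In a VC-tree T this makes every vertex v with two neighbours elliptic: if v
   were hyperbolic, its axis would be fixed by some v^i c^j and v^i' c'^j' with j, j' <> 0,
   which lie in a virtually cyclic edge stabiliser and hence have a common power.  Two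
   elliptic generators joined by an edge have a common fixed point because a power of
   their product is central, and a chunk with no cut vertex then fixes a point because at
   most one of its generators fixes a given edge of T.

   That the coset graph of J(Gamma) is a tree is shown edge by edge: each edge is a bridge.
   The characteristic function of a half-space is obtained by prescribing its increments
   along the generators, i.e. from a homomorphism of A_Gamma to the semidirect product
   of A_Gamma with the Boolean functions on A_Gamma.  This uses only the universal property
   of the presentation, and in particular no injectivity of A_Lambda in A_Gamma. *)
From Stdlib Require Import FunctionalExtensionality PropExtensionality ProofIrrelevance.
From Stdlib Require Import Classical ClassicalEpsilon ZArith Lia List Reals Lra.
Require Import Defs.
From mathcomp Require Import all_boot zify.
Set Implicit Arguments. Unset Strict Implicit. Unset Printing Implicit Defensive.

(** * Groups *)

Declare Scope grp_scope.
Delimit Scope grp_scope with grp.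
Notation "x ** y" := (gmul x y) (at level 40, left associativity) : grp_scope.
Notation "x ^-1" := (ginv x) : grp_scope.
Local Open Scope grp_scope.

(** The representation is deformed because at [q = 1] a generator acts as an involution and its
    powers are lost. For [q > 1] the generator of [v] multiplies the [v]-coordinate by [-q], so a
    nontrivial power shows as a factor of modulus other than 1; [q = 4] makes [sqrt q = 2]. The tip
    of an even leaf has a single neighbour and may act hyperbolically (a toral tip is a stable
    letter), so the black groups of even leaves omit it; the tip of an odd leaf is conjugate to its
    base. For a braided leaf, [z_ab] needs an argument of its own, in which [a] and [b a b^-1] are
    the two commensurable elements. Ellipticity of vertex groups in every VC-tree gives both JSJ
    conditions at once, since edge stabilisers lie in vertex stabilisers. It remains to see that the
    coset graph is a VC-tree. Besides the tree property this includes minimality: a black group that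
    is not toral is too large for the cyclic stabiliser of a neighbour, and a toral black vertex is
    adjacent to a translate of itself. *)

Lemma nat_least (P : nat -> Prop) : (exists n, P n) ->
  exists2 n, P n & forall k, P k -> n <= k.
Proof.
move=> [n]; elim/ltn_ind: n => n IH Pn.
case: (classic (exists2 k, k < n & P k)) => [[k kn Pk]|no]; first exact: IH Pk.
exists n => // k Pk; rewrite leqNgt; apply/negP => kn; apply: no; by exists k.
Qed.

Lemma pigeonhole (f : nat -> nat) n : (forall i, f i < n) ->
  exists i j, i < j /\ f i = f j.
Proof.
move=> fn; pose F (i : 'I_n.+1) := Ordinal (fn i).
have ninj : ~ injective F by move=> /leq_card; rewrite !card_ord ltnn.
apply: NNPP => no; apply: ninj => a b /(congr1 val) /= fab.
apply: val_inj; apply: NNPP => /= ab; apply: no.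
have [h|h] : a < b \/ b < a by lia.
- by exists a, b.
- by exists b, a.
Qed.

Section Groups.
Variable G : Grp.
Implicit Types x y z g h : G.

Lemma gmulVV x : x ** x^-1 = gone.
Proof.
rewrite -(gmul1 (x ** x^-1)) -{1}(gmulV x^-1) -gmulA (gmulA x^-1 x) gmulV gmul1.
exact: gmulV.
Qed.

Lemma gmulg1 x : x ** gone = x.
Proof. by rewrite -(gmulV x) gmulA gmulVV gmul1. Qed.

Lemma gmulK x y : x^-1 ** (x ** y) = y.
Proof. by rewrite gmulA gmulV gmul1. Qed.

Lemma gmulVK x y : x ** (x^-1 ** y) = y.
Proof. by rewrite gmulA gmulVV gmul1. Qed.

Lemma gmulI x y z : x ** y = x ** z -> y = z.
Proof. by move=> e; rewrite -(gmulK x y) e gmulK. Qed.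

Lemma gmulIr x y z : y ** x = z ** x -> y = z.
Proof. by move=> e; rewrite -(gmulg1 y) -(gmulVV x) gmulA e -gmulA gmulVV gmulg1. Qed.

Lemma ginv_eq x y : x ** y = gone -> y = x^-1.
Proof. by move=> e; apply: (@gmulI x); rewrite e gmulVV. Qed.

Lemma ginvK x : x^-1^-1 = x.
Proof. by rewrite -(ginv_eq (gmulV x)). Qed.

Lemma ginvM x y : (x ** y)^-1 = y^-1 ** x^-1.
Proof. by apply/esym/ginv_eq; rewrite -gmulA gmulVK gmulVV. Qed.

Lemma ginv1 : gone^-1 = gone :> G.
Proof. by apply/esym/ginv_eq; rewrite gmul1. Qed.

End Groups.

Ltac grp := rewrite ?(ginvM, ginvK, ginv1) -?gmulA
  ?(gmulK, gmulVK, gmulV, gmulVV, gmul1, gmulg1).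

Definition gcomm (G : Grp) (x y : G) := x ** y = y ** x.

Section Powers.
Variable G : Grp.
Implicit Types x y z g h : G.

Lemma gcommV x y : gcomm x y -> gcomm x y^-1.
Proof.
move=> c; apply: (@gmulI _ y); rewrite gmulA -c -gmulA gmulVV gmulg1.
by rewrite gmulVK.
Qed.

Lemma gcomm_sym x y : gcomm x y -> gcomm y x.
Proof. by []. Qed.

Lemma gcommM x y z : gcomm x y -> gcomm x z -> gcomm x (y ** z).
Proof. by rewrite /gcomm => c d; rewrite gmulA c -gmulA d gmulA. Qed.

Lemma gcomm1 x : gcomm x gone.
Proof. by rewrite /gcomm gmul1 gmulg1. Qed.

Lemma gcommX x y n : gcomm x y -> gcomm x (gpow y n).
Proof. by move=> c; elim: n => [|n IH] /=; [exact: gcomm1|exact: gcommM]. Qed.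

Lemma gcommZ x y k : gcomm x y -> gcomm x (gzpow y k).
Proof.
case: k => [|p|p] c /=; [exact: gcomm1|exact: gcommX|].
exact/gcommV/gcommX.
Qed.

Lemma gpowSr x n : gpow x n.+1 = gpow x n ** x.
Proof. by rewrite /=; apply: gcommX. Qed.

Lemma gpowMn x y n : gcomm x y -> gpow (x ** y) n = gpow x n ** gpow y n.
Proof.
move=> c; elim: n => [|n IH] /=; first by rewrite gmul1.
rewrite IH -!gmulA; congr (_ ** _); rewrite !gmulA; congr (_ ** _).
exact/gcommX/gcomm_sym.
Qed.

Lemma gpow_conj x y n : gpow (y ** x ** y^-1) n = y ** gpow x n ** y^-1.
Proof. by elim: n => [|n IH] /=; [grp | rewrite IH; grp]. Qed.

Lemma gzpow_nat x (n : nat) : gzpow x (Z.of_nat n) = gpow x n.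
Proof. by case: n => // n; rewrite /gzpow /= SuccNat2Pos.id_succ. Qed.

Lemma gzpow_opp x k : gzpow x (- k) = (gzpow x k)^-1.
Proof. by case: k => [|p|p] /=; rewrite ?ginv1 ?ginvK. Qed.

Lemma gzpow_case x k :
  exists n : nat, (k = Z.of_nat n /\ gzpow x k = gpow x n) \/
                  (k = (- Z.of_nat n)%Z /\ gzpow x k = (gpow x n)^-1).
Proof.
exists (Z.abs_nat k).
have [h|h] : k = Z.of_nat (Z.abs_nat k) \/ k = (- Z.of_nat (Z.abs_nat k))%Z by lia.
- by left; split => //; rewrite {1}h gzpow_nat.
- by right; split => //; rewrite {1}h gzpow_opp gzpow_nat.
Qed.

Lemma gzpow_succ x k : gzpow x (k + 1) = x ** gzpow x k.
Proof.
have [n [[-> _]|[-> _]]] := gzpow_case x k.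
- have -> : (Z.of_nat n + 1 = Z.of_nat n.+1)%Z by lia.
  by rewrite !gzpow_nat.
- case: n => [|n]; first by rewrite /= gmulg1.
  have -> : (- Z.of_nat n.+1 + 1 = - Z.of_nat n)%Z by lia.
  by rewrite !gzpow_opp !gzpow_nat gpowSr ginvM gmulVK.
Qed.

Lemma gzpow_pred x k : gzpow x (k - 1) = x^-1 ** gzpow x k.
Proof.
have {2}-> : (k = (k - 1) + 1)%Z by lia.
by rewrite gzpow_succ gmulK.
Qed.

Lemma gzpowD x i j : gzpow x (i + j) = gzpow x i ** gzpow x j.
Proof.
elim/Z.peano_ind: i => [|i IH|i IH].
- by rewrite gmul1.
- have -> : (Z.succ i + j = (i + j) + 1)%Z by lia.
  by rewrite gzpow_succ IH -Z.add_1_r gzpow_succ gmulA.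
- have -> : (Z.pred i + j = (i + j) - 1)%Z by lia.
  by rewrite gzpow_pred IH -Z.sub_1_r gzpow_pred gmulA.
Qed.

Lemma gzpowM x i j : gzpow x (i * j) = gzpow (gzpow x i) j.
Proof.
elim/Z.peano_ind: j => [|j IH|j IH].
- by rewrite Z.mul_0_r.
- have -> : (i * Z.succ j = i + i * j)%Z by lia.
  by rewrite gzpowD IH -Z.add_1_r gzpow_succ.
- have -> : (i * Z.pred j = - i + i * j)%Z by lia.
  by rewrite gzpowD IH -Z.sub_1_r gzpow_pred gzpow_opp.
Qed.

Lemma gzpow_one x : gzpow x 1 = x.
Proof. by rewrite /= /Pos.to_nat /= gmulg1. Qed.

Lemma gzpowMn x y k : gcomm x y -> gzpow (x ** y) k = gzpow x k ** gzpow y k.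
Proof.
move=> c; case: k => [|p|p] /=; rewrite ?gmul1 //.
- exact: gpowMn.
- rewrite gpowMn // ginvM; apply/gcommV/gcomm_sym/gcommV.
  exact/gcommX/gcomm_sym/gcommX.
Qed.

Lemma gcommZZ x y i j : gcomm x y -> gcomm (gzpow x i) (gzpow y j).
Proof. by move=> c; apply/gcommZ/gcomm_sym/gcommZ. Qed.

Lemma gzpow_conj x y k : gzpow (y ** x ** y^-1) k = y ** gzpow x k ** y^-1.
Proof.
by case: k => [|p|p] /=; rewrite ?gpow_conj; grp.
Qed.

End Powers.

(** * Generated subgroups, cyclic and virtually cyclic subgroups *)

Section Subgroups.
Variable G : Grp.
Implicit Types (x y g h : G) (P Q S H : G -> Prop).

Definition is_subgroup H :=
  H gone /\ (forall x y, H x -> H y -> H (x ** y)) /\ (forall x, H x -> H x^-1).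

Lemma gsub_subgroup S : is_subgroup (gsub S).
Proof. by split; [exact: gs_one|split=> *; [exact: gs_mul|exact: gs_inv]]. Qed.

Lemma gsub_min S H : is_subgroup H -> (forall x, S x -> H x) ->
  forall x, gsub S x -> H x.
Proof.
move=> [H1 [HM HV]] SH x; elim=> {x} [x /SH //|//|x y _ Hx _ Hy|x _ Hx].
- exact: HM.
- exact: HV.
Qed.

Lemma subgroup_pow H x n : is_subgroup H -> H x -> H (gpow x n).
Proof. by move=> [H1 [HM HV]] Hx; elim: n => //= n IH; apply: HM. Qed.

Lemma subgroup_zpow H x k : is_subgroup H -> H x -> H (gzpow x k).
Proof.
move=> sH Hx; case: k => [|p|p] /=; first by case: sH.
- exact: subgroup_pow.
- by case: (sH) => _ [_ HV]; apply: HV; apply: subgroup_pow.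
Qed.

Lemma gsub_cycle x y : gsub (fun z => z = x) y <-> exists k, y = gzpow x k.
Proof.
split=> [|[k ->]].
- move: y; apply: gsub_min => [|y ->]; last by exists 1%Z; rewrite gzpow_one.
  split; [|split].
  + by exists 0%Z.
  + by move=> a b [i ->] [j ->]; exists (i + j)%Z; rewrite gzpowD.
  + by move=> a [i ->]; exists (- i)%Z; rewrite gzpow_opp.
- apply: subgroup_zpow; first exact: gsub_subgroup.
  exact: gs_in.
Qed.

Lemma gsub_cent S y : (forall x, S x -> gcomm y x) -> forall x, gsub S x -> gcomm y x.
Proof.
move=> h; apply: gsub_min => //; split; [|split].
- exact: gcomm1.
- by move=> *; apply: gcommM.
- by move=> *; apply: gcommV.
Qed.

Definition infinite_order x := forall k, gzpow x k = gone -> k = 0%Z.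

(* Pigeonhole on the finitely many coset representatives of the cyclic subgroup. *)
Lemma virtually_cyclic_power H c l x :
  (forall h, H h -> exists h0 k, In h0 l /\ h = h0 ** gzpow c k) ->
  (forall n, H (gpow x n)) ->
  exists n k, n <> 0%Z /\ gzpow x n = gzpow c k.
Proof.
move=> Hl Hx.
have [f Hf] : exists f : nat -> nat, forall i, (f i < size l) /\
    exists k, gpow x i = List.nth (f i) l gone ** gzpow c k.
  apply: (choice (fun i j => j < size l /\
    exists k, gpow x i = List.nth j l gone ** gzpow c k)) => i.
  have [h0 [k [hin e]]] := Hl _ (Hx i).
  have [j [jl ej]] := In_nth l h0 gone hin.
  by exists j; split; [exact/ltP|exists k; rewrite ej].
have [i [j [ij fij]]] := pigeonhole (fun i => proj1 (Hf i)).
have [_ [k1 e1]] := Hf i; have [_ [k2 e2]] := Hf j.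
exists (Z.of_nat j - Z.of_nat i)%Z, (k2 - k1)%Z; split; first lia.
have -> : (Z.of_nat j - Z.of_nat i = - Z.of_nat i + Z.of_nat j)%Z by lia.
have -> : (k2 - k1 = - k1 + k2)%Z by lia.
by rewrite !gzpowD !gzpow_opp !gzpow_nat e1 e2 fij; grp.
Qed.

(** Both elements have a nontrivial power in [<c>]. Infinite order keeps the two exponents of [c]
    nonzero, and cross-multiplying by them gives a common power. *)
Lemma virtually_cyclic_commensurable H x y : virtually_cyclic H ->
  (forall n, H (gpow x n)) -> (forall n, H (gpow y n)) ->
  infinite_order x -> infinite_order y ->
  exists s t, s <> 0%Z /\ t <> 0%Z /\ gzpow x s = gzpow y t.
Proof.
move=> [c [_ [l [_ Hl]]]] Hx Hy ix iy.
have [n [k [n0 e]]] := virtually_cyclic_power Hl Hx.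
have [n' [k' [n0' e']]] := virtually_cyclic_power Hl Hy.
have k0 : k <> 0%Z by move=> k0; apply/n0/ix; rewrite e k0.
have k0' : k' <> 0%Z by move=> k0'; apply/n0'/iy; rewrite e' k0'.
exists (n * k')%Z, (n' * k)%Z; split; [nia|split; [nia|]].
by rewrite !gzpowM e e' -!gzpowM Z.mul_comm.
Qed.

Lemma subgroup_of_cyclic_virtually_cyclic H x : is_subgroup H ->
  (forall h, H h -> exists k, h = gzpow x k) -> virtually_cyclic H.
Proof.
move=> sH Hx.
have [H1 [HM HV]] := sH.
case: (classic (exists n, 0 < n /\ H (gpow x n))) => [ex|nex]; last first.
  exists gone; split=> //; exists (gone :: nil); split=> [h [<-|[]] //|h Hh].
  exists h, 0%Z; rewrite gmulg1; split=> //; left.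
  have [k e] := Hx _ Hh.
  have [n [[ek en]|[ek en]]] := gzpow_case x k.
  - case: n ek en => [|n] ek en; first by rewrite e en.
    by case: nex; exists n.+1; split=> //; rewrite -en -e.
  - case: n ek en => [|n] ek en; first by rewrite e en ginv1.
    by case: nex; exists n.+1; split=> //; rewrite -(ginvK (gpow _ _)) -en -e; apply: HV.
have [n [n0 Hn] nmin] : exists2 n, 0 < n /\ H (gpow x n) &
    forall k, 0 < k -> H (gpow x k) -> n <= k.
  have [n [n0 Hn] nmin] := nat_least ex.
  by exists n => // k k0 Hk; apply: nmin.
exists (gpow x n); split=> //; exists (gone :: nil); split=> [h [<-|[]] //|h Hh].
exists gone; have [k e] := Hx _ Hh.
exists (k / Z.of_nat n)%Z; split; first by left.
rewrite gmul1 -gzpow_nat -gzpowM e; congr gzpow.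
have dm := Z_div_mod_eq_full k (Z.of_nat n).
have mb : (0 <= k mod Z.of_nat n < Z.of_nat n)%Z by apply: Z.mod_pos_bound; lia.
suff : (k mod Z.of_nat n = 0)%Z by lia.
set r := (k mod _)%Z in dm mb *.
have Hr : H (gpow x (Z.to_nat r)).
  rewrite -gzpow_nat.
  have -> : (Z.of_nat (Z.to_nat r) = - (Z.of_nat n * (k / Z.of_nat n)) + k)%Z by lia.
  rewrite gzpowD gzpow_opp -e gzpowM gzpow_nat; apply: HM => //.
  by apply: HV; apply: subgroup_zpow.
apply: NNPP => r0; have := nmin (Z.to_nat r) ltac:(lia) Hr; lia.
Qed.

Lemma hom_one (H : Grp) (phi : G -> H) : group_hom phi -> phi gone = gone.
Proof.
by move=> h; apply: (@gmulI _ (phi gone)); rewrite -h gmul1 gmulg1.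
Qed.

Lemma hom_inv (H : Grp) (phi : G -> H) x : group_hom phi -> phi x^-1 = (phi x)^-1.
Proof. by move=> h; apply: ginv_eq; rewrite -h gmulVV (hom_one h). Qed.

Lemma hom_pow (H : Grp) (phi : G -> H) x n : group_hom phi ->
  phi (gpow x n) = gpow (phi x) n.
Proof. by move=> h; elim: n => [|n IH] /=; [exact: hom_one|rewrite h IH]. Qed.

Lemma hom_alt (H : Grp) (phi : G -> H) x y n : group_hom phi ->
  phi (alt x y n) = alt (phi x) (phi y) n.
Proof. by move=> h; elim: n x y => [|n IH] x y /=; [exact: hom_one|rewrite h IH]. Qed.

Lemma alt_double x y n : alt x y n.*2 = gpow (x ** y) n.
Proof. by elim: n => //= n ->; rewrite gmulA. Qed.

Lemma alt_add x y n k : alt x y (n + k) =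
  alt x y n ** (if odd n then alt y x k else alt x y k).
Proof.
elim: n x y => [|n IH] x y; first by rewrite gmul1.
by rewrite addSn /= IH; case: (odd n) => /=; rewrite gmulA.
Qed.

End Subgroups.

(** * Metric geometry of trees *)

Section Walks.
Variables (X : Type) (e : X -> X -> Prop).
Hypothesis e_sym : forall x y, e x y -> e y x.
Implicit Types (x y z u w : X) (p q r : list X).

Lemma walk_cat x p q z : walk e x (p ++ q) z <->
  exists y, walk e x p y /\ walk e y q z.
Proof.
elim: p x => [|u p IH] x /=; first by split=> [|[y [->]]] //; exists x.
split=> [[xu /IH [y [h1 h2]]]|[y [[xu h1] h2]]]; first by exists y.
by split=> //; apply/IH; exists y.
Qed.

Lemma walk_last x p y : walk e x p y -> y = last x p.
Proof. by elim: p x => [|u p IH] x //= [_ /IH]. Qed.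

(** Backtracking concerns three consecutive vertices, so an overlap [q] of at least one edge carries
    its absence across the junction. *)
Lemma nobacktrack_splice x p y q r : walk e x p y -> q <> nil ->
  nobacktrack x (p ++ q) -> nobacktrack y (q ++ r) -> nobacktrack x (p ++ q ++ r).
Proof.
elim: p x => [|z p IH] x /=; first by move=> ->.
case: p IH => [|w p] IH /=; last by move=> [_ h] q0 [wx h1] h2; split=> //; apply: IH h2.
move=> [_ ->] {IH}; case: q => [|v q] //= _ [vx h1] h2; by split.
Qed.

Lemma nobacktrack_catl x p q : nobacktrack x (p ++ q) -> nobacktrack x p.
Proof.
elim: p x => [|z [|w p] IH] x //= [wx h]; split=> //; exact: IH.
Qed.

Lemma nobacktrack_catr x p y q : walk e x p y -> nobacktrack x (p ++ q) ->
  nobacktrack y q.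
Proof.
elim: p x => [|z p IH] x /=; first by move=> ->.
move=> [_ h] nb; apply: IH h _.
by case: (p ++ q) nb => [|w s] // [].
Qed.

Fixpoint rev_walk x p : list X :=
  match p with nil => nil | z :: q => rev_walk z q ++ [:: x] end.

Lemma size_rev_walk x p : size (rev_walk x p) = size p.
Proof. by elim: p x => //= z p IH x; rewrite size_cat IH addn1. Qed.

Lemma walk_rev x p y : walk e x p y -> walk e y (rev_walk x p) x.
Proof.
elim: p x => [|z p IH] x //= [xz h]; apply/walk_cat; exists z; split; first exact: IH.
by split=> //; apply: e_sym.
Qed.

Lemma nobacktrack_rev x p y : walk e x p y -> nobacktrack x p ->
  nobacktrack y (rev_walk x p).
Proof.
elim: p x => [|z p IH] x //= [xz h] nb.
case: p IH h nb => [|w q] //= IH [zw h] [wx nb].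
rewrite -catA; apply: (nobacktrack_splice (walk_rev h)) => //=.
- by apply: IH.
- by split=> // xw; apply: wx.
Qed.

(** Backtracks are cancelled one at a time. The last two conclusions identify a shortest walk with
    the geodesic and put the vertices of the geodesic on every walk. *)
Lemma walk_reduce x p y : walk e x p y -> exists q,
  [/\ walk e x q y, nobacktrack x q, size q <= size p,
      size q = size p -> q = p & forall u, In u q -> In u p].
Proof.
elim: p x => [|z p IH] x; first by move=> h; exists nil; split.
move=> [xz /IH [q [wq nq sq eq iq]]].
case: q wq nq sq eq iq => [|u q] wq nq sq eq iq.
  exists [:: z]; split=> //=.
  - by case=> /eq <-.
  - by move=> u [->|[]]; left.
case: (classic (u = x)) => [ux|ux].
- subst u; exists q; split.
  + by case: wq.
  + by case: q nq {wq sq eq iq} => //= v q [].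
  + by move: sq => /=; lia.
  + by move: sq => /= h1 h2; lia.
  + by move=> v vq; right; apply: iq; right.
- exists [:: z, u & q]; split=> //.
  + by case=> /eq <-.
  + by move=> v [->|vq]; [left|right; apply: iq].
Qed.

Section Tree.
Hypothesis tree : is_tree e.

Definition geo x y : list X :=
  proj1_sig (constructive_indefinite_description _ (tree x y)).

Lemma geo_walk x y : walk e x (geo x y) y.
Proof. by rewrite /geo; case: constructive_indefinite_description => p [[]]. Qed.

Lemma geo_reduced x y : nobacktrack x (geo x y).
Proof. by rewrite /geo; case: constructive_indefinite_description => p [[]]. Qed.

Lemma geo_unique x y p : walk e x p y -> nobacktrack x p -> p = geo x y.
Proof.
rewrite /geo; case: constructive_indefinite_description => q [_ h] /= h1 h2.
exact: h.
Qed.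

Definition dist x y := size (geo x y).
Definition between x y z := dist x z = dist x y + dist y z.

Lemma dist_le x p y : walk e x p y -> dist x y <= size p.
Proof. by move=> /walk_reduce [q [/geo_unique h /h]]; rewrite /dist => ->. Qed.

Lemma dist_walk x p y : walk e x p y -> size p = dist x y -> p = geo x y.
Proof.
move=> /walk_reduce [q [/geo_unique h /h]]; rewrite /dist => -> _ eq _ sp.
by rewrite -eq.
Qed.

Lemma geo_in_walk x p y u : walk e x p y -> In u (geo x y) -> In u p.
Proof. move=> /walk_reduce [q [/geo_unique h /h -> _ _]]; exact. Qed.

Lemma dist_xx x : dist x x = 0.
Proof. by have := @dist_le x nil x erefl; rewrite leqn0 => /eqP. Qed.

Lemma dist_eq0 x y : dist x y = 0 -> x = y.
Proof. by have := geo_walk x y; rewrite /dist; case: (geo x y). Qed.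

Lemma dist_sym x y : dist x y = dist y x.
Proof.
have h u v : dist u v <= dist v u.
  by have := dist_le (walk_rev (geo_walk v u)); rewrite size_rev_walk.
by apply/eqP; rewrite eqn_leq !h.
Qed.

Lemma dist_triangle x y z : dist x z <= dist x y + dist y z.
Proof.
rewrite {2 3}/dist -size_cat; apply: dist_le; apply/walk_cat.
by exists y; split; apply: geo_walk.
Qed.

Lemma dist_adj x y : e x y -> x <> y -> dist x y = 1.
Proof.
move=> xy ne; have := @dist_le x [:: y] y (conj xy erefl).
case: (dist x y) (@dist_eq0 x y) => [/(_ erefl) //|n] _ /=; lia.
Qed.

Lemma adj_dist x y : dist x y = 1 -> e x y.
Proof.
rewrite /dist; have := geo_walk x y; case: (geo x y) => [|z [|]] //=.
by case=> h <-.
Qed.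

Lemma between_sym x y z : between x y z -> between z y x.
Proof. by rewrite /between (dist_sym z) (dist_sym y x) (dist_sym z y) addnC. Qed.

Lemma between_cat x p y q z : geo x z = p ++ q -> walk e x p y -> walk e y q z ->
  [/\ between x y z, dist x y = size p & dist y z = size q].
Proof.
move=> g h1 h2.
have := geo_reduced x z; rewrite g => nb.
have d1 : dist x y = size p.
  by rewrite /dist -(geo_unique h1) //; apply: nobacktrack_catl nb.
have d2 : dist y z = size q.
  by rewrite /dist -(geo_unique h2) //; apply: nobacktrack_catr h1 nb.
by split=> //; rewrite /between d1 d2 /dist g size_cat.
Qed.

Lemma between_geo x y z : between x y z -> geo x z = geo x y ++ geo y z.
Proof.
move=> b; apply/esym/dist_walk; last by rewrite size_cat.
by apply/walk_cat; exists y; split; apply: geo_walk.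
Qed.

Lemma between_point x z n : n <= dist x z -> exists2 y, between x y z & dist x y = n.
Proof.
move=> nd; have := geo_walk x z; rewrite -{1}(cat_take_drop n (geo x z)).
move=> /walk_cat [y [h1 h2]]; exists y.
- by have [] := between_cat (esym (cat_take_drop n (geo x z))) h1 h2.
- have [_ -> _] := between_cat (esym (cat_take_drop n (geo x z))) h1 h2.
  by rewrite size_take; move: nd; rewrite /dist; case: ltnP => //; lia.
Qed.

Lemma between_unique x y y' z : between x y z -> between x y' z ->
  dist x y = dist x y' -> y = y'.
Proof.
move=> /between_geo h /between_geo; rewrite h /dist => eq sz.
have e1 : geo x y = geo x y'.
  by move: (congr1 (take (size (geo x y))) eq); rewrite {2}sz !take_size_cat.
by rewrite (walk_last (geo_walk x y)) e1 -(walk_last (geo_walk x y')).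
Qed.

Lemma between_in_geo x y z : between x y z -> y = x \/ In y (geo x z).
Proof.
move=> /between_geo ->; have := geo_walk x y.
case: (lastP (geo x y)) => [/= ->|p u]; first by left.
move/walk_last; rewrite last_rcons => ->; right.
by apply/in_or_app; left; rewrite -cats1; apply/in_or_app; right; left.
Qed.

Lemma common_prefix p q : exists c p' q', [/\ p = c ++ p', q = c ++ q' &
  p' = nil \/ q' = nil \/ exists a b s t, [/\ a <> b, p' = a :: s & q' = b :: t]].
Proof.
elim: p q => [|a p IH] q; first by exists nil, nil, q; split=> //; left.
case: q => [|b q]; first by exists nil, (a :: p), nil; split=> //; right; left.
case: (classic (a = b)) => [->|ab].
- have [c [p' [q' [-> -> h]]]] := IH q.
  by exists (b :: c), p', q'.
- exists nil, (a :: p), (b :: q); split=> //; right; right.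
  by exists a, b, p, q.
Qed.

(** The median is the end of the longest common prefix of the geodesics from [x] to [y] and to [z].
    Beyond it they leave by different edges, so one tail reversed and followed by the other does not
    backtrack. *)
Lemma median x y z : exists m, [/\ between x m y, between x m z & between y m z].
Proof.
have [c [p' [q' [e1 e2 h]]]] := common_prefix (geo x y) (geo x z).
have := geo_walk x y; rewrite e1 => /walk_cat [m [w1 w2]].
have := geo_walk x z; rewrite e2 => /walk_cat [m' [w1' w2']].
rewrite (walk_last w1') -(walk_last w1) in w2' => {m' w1'}.
have [b1 d1 s1] := between_cat e1 w1 w2.
have [b2 d2 s2] := between_cat e2 w1 w2'.
have n1 : nobacktrack m p'.
  by have := geo_reduced x y; rewrite e1; apply: nobacktrack_catr.
have n2 : nobacktrack m q'.
  by have := geo_reduced x z; rewrite e2; apply: nobacktrack_catr.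
exists m; split=> //; case: h => [h|[h|[a [b [s [t [ab ep eq]]]]]]].
- by subst p'; move: w2 => /= ->; rewrite /between dist_xx.
- by subst q'; move: w2' => /= ->; rewrite /between dist_xx addn0.
- have W : walk e y (rev_walk m p' ++ q') z.
    by apply/walk_cat; exists m; split=> //; apply: walk_rev.
  rewrite /between (dist_sym y m) s1 s2 -{1}(size_rev_walk m p') -size_cat.
  rewrite {1}/dist; congr size; apply/esym; apply: geo_unique => //.
  have := nobacktrack_rev w2 n1; subst p' q'; rewrite /= -catA => nr.
  case: w2 => [ma w2].
  apply: (nobacktrack_splice (walk_rev w2)) => //=.
  by split=> // /esym.
Qed.

Lemma between_xx x y : between x y x -> y = x.
Proof. by rewrite /between dist_xx => h; apply: dist_eq0; lia. Qed.

Lemma between_left x y : between x x y.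
Proof. by rewrite /between dist_xx. Qed.

Lemma between_right x y : between x y y.
Proof. by rewrite /between dist_xx addn0. Qed.

Lemma between_subl x y z w : between x y z -> between x z w -> between x y w.
Proof.
rewrite /between => h1 h2; have := dist_triangle x y w; have := dist_triangle y z w; lia.
Qed.

Lemma between_subr x y z w : between x y z -> between x z w -> between y z w.
Proof.
rewrite /between => h1 h2; have := dist_triangle x y w; have := dist_triangle y z w; lia.
Qed.

Lemma between_order x y z w : between x y w -> between x z w -> dist x y <= dist x z ->
  between x y z.
Proof.
move=> h1 h2 le; have [y' b d] := between_point le.
by rewrite (between_unique h1 (between_subl b h2)).
Qed.

(** Local to global: geodesics that overlap in a nondegenerate segment concatenate. If the median of
    [z], [x], [w] were not [z], the paths from [z] to [y] and to [w] would leave by the same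
    edge. *)
Lemma between_concat x y z w : between x y z -> between y z w -> y <> z ->
  between x y w /\ between x z w.
Proof.
move=> b1 b2 ne; have [m [h1 h2 h3]] := median z x w.
have b3 : between y z m.
  apply/between_sym; exact: between_subr (between_sym h2) (between_sym b2).
have zy0 : dist z y <> 0 by move=> /dist_eq0 /esym.
have mz : m = z.
  have [le|le] := leqP (dist z m) (dist z y).
  - have := between_order h1 (between_sym b1) le; move: b3; rewrite /between.
    rewrite (dist_sym y m) (dist_sym z y) => *; apply: dist_eq0.
    have := dist_sym y z; have := dist_sym z m; lia.
  - have := between_order (between_sym b1) h1 (ltnW le); move: b3; rewrite /between.
    have := dist_sym y z; lia.
subst m; split=> //; exact: between_subl b1 h3.
Qed.

Lemma dist_collinear x y y' z : between x y z -> between x y' z ->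
  dist y y' = (dist x y - dist x y') + (dist x y' - dist x y).
Proof.
move=> h1 h2; have [le|/ltnW le] := leqP (dist x y) (dist x y').
- have := between_order h1 h2 le; rewrite /between; lia.
- have := between_order h2 h1 le; rewrite /between (dist_sym y y'); lia.
Qed.

Lemma dist_iso (f f' : X -> X) x y : (forall z, f' (f z) = z) ->
  (forall u w, e u w -> e (f u) (f w)) -> (forall u w, e u w -> e (f' u) (f' w)) ->
  dist (f x) (f y) = dist x y.
Proof.
move=> fK fe f'e.
have le (k : X -> X) u v : (forall s t, e s t -> e (k s) (k t)) -> dist (k u) (k v) <= dist u v.
  move=> ke; rewrite {2}/dist -(size_map k); apply: dist_le.
  move: (geo u v) (geo_walk u v) => p; elim: p u => [|w p IH] u /=; first by move=> ->.
  by move=> [uw /IH]; split=> //; apply: ke.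
apply/eqP; rewrite eqn_leq le //= -{1}(fK x) -{1}(fK y); exact: le.
Qed.

End Tree.
End Walks.

(** * Group actions on trees *)

Section Actions.
Variables (G : Grp) (T : GTree G).
Hypothesis hT : is_Gtree T.
Implicit Types (g h a b c : G) (x y z u w p q : tv T).
Local Notation "g %* x" := (tact T g x) (at level 38, right associativity).

Lemma tact1 x : gone %* x = x.
Proof. by case: hT => _ [_ [_ [_ [h _]]]]. Qed.

Lemma tactM g h x : g %* h %* x = (g ** h) %* x.
Proof. by case: hT => _ [_ [_ [_ [_ [k _]]]]]. Qed.

Lemma tactK g x : g^-1 %* g %* x = x.
Proof. by rewrite tactM gmulV tact1. Qed.

Lemma tactVK g x : g %* g^-1 %* x = x.
Proof. by rewrite tactM gmulVV tact1. Qed.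

Lemma tact_comm g h x : gcomm g h -> g %* h %* x = h %* g %* x.
Proof. by move=> c; rewrite !tactM c. Qed.

Lemma tact_inj g x y : g %* x = g %* y -> x = y.
Proof. by move=> h; rewrite -(tactK g x) h tactK. Qed.

Lemma tact_fixV g x : g %* x = x -> g^-1 %* x = x.
Proof. by move=> h; apply: (@tact_inj g); rewrite tactVK h. Qed.

Lemma tact_fixM g h x : g %* x = x -> h %* x = x -> (g ** h) %* x = x.
Proof. by rewrite -tactM => e ->. Qed.

Lemma stab_subgroup x : is_subgroup (fun g => g %* x = x).
Proof.
by split; [exact: tact1|split=> *; [exact: tact_fixM|exact: tact_fixV]].
Qed.

Lemma gsub_fix (S : G -> Prop) x : (forall g, S g -> g %* x = x) ->
  forall g, gsub S g -> g %* x = x.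
Proof. exact: (gsub_min (stab_subgroup x)). Qed.

Lemma tadj_sym x y : tadj T x y -> tadj T y x.
Proof. by case: hT => _ [h _]; apply: h. Qed.

Lemma Gtree_tree : is_tree (tadj T).
Proof. by case: hT => _ [_ [_ [h _]]]. Qed.

Local Notation d := (dist Gtree_tree).
Local Notation B := (between Gtree_tree).
Local Notation bsym := (between_sym tadj_sym).

Lemma tdist_eq0 x y : d x y = 0 -> x = y.
Proof. exact: dist_eq0. Qed.

Lemma tadj_act g x y : tadj T x y -> tadj T (g %* x) (g %* y).
Proof. by case: hT => _ [_ [_ [_ [_ [_ [h _]]]]]]; apply (h g). Qed.

Lemma tadj_noinv g x y : tadj T x y -> g %* x = y -> g %* y = x -> False.
Proof.
by case: hT => _ [_ [_ [_ [_ [_ [_ [h _]]]]]]] xy e1 e2; apply: (h g x y).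
Qed.

Lemma dist_act g x y : d (g %* x) (g %* y) = d x y.
Proof.
by apply: (@dist_iso _ _ Gtree_tree (tact T g) (tact T g^-1)) => [u|u w|u w];
  [exact: tactK|exact: tadj_act|exact: tadj_act].
Qed.

Lemma between_act g x y z : B x y z -> B (g %* x) (g %* y) (g %* z).
Proof. by rewrite /between !dist_act. Qed.

Lemma between_actE g x y z : B (g %* x) (g %* y) (g %* z) <-> B x y z.
Proof. by rewrite /between !dist_act. Qed.

Lemma fix_between g x y z : g %* x = x -> g %* z = z -> B x y z -> g %* y = y.
Proof.
move=> gx gz b; apply: (@between_unique _ _ Gtree_tree x _ _ z) => //.
- by rewrite -{1}gx -{1}gz; apply: between_act.
- by rewrite -{1}gx dist_act.
Qed.

(** The vertex [x] lies on the axis of a hyperbolic [g]: the translates of the segment from [x] to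
    [g x] fit together to a line. *)
Definition axial g x := g %* x <> x /\ B x (g %* x) (g %* g %* x).

Lemma axial_dist_gt0 g x : axial g x -> 0 < d x (g %* x).
Proof.
move=> [ne _]; rewrite lt0n; apply/eqP => /tdist_eq0 h; exact/ne/esym.
Qed.

(* At a vertex of minimal displacement the median of x, gx, ggx is gx: otherwise g would
   move a point less, fix a midpoint or invert an edge. *)
Lemma axial_exists g : (forall x, g %* x <> x) -> exists x, axial g x.
Proof.
move=> nofix.
have [n [x dx] xmin] : exists2 n, (exists x, d x (g %* x) = n) &
    forall k, (exists x, d x (g %* x) = k) -> n <= k.
  by apply: nat_least; case: hT => [[x0] _]; exists (d x0 (g %* x0)), x0.
have {}xmin y : d x (g %* x) <= d y (g %* y) by rewrite dx; apply: xmin; exists y.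
exists x; split; first exact: nofix.
set x1 := g %* x; set x2 := g %* x1.
have [m [b1 b2 b3]] := median tadj_sym Gtree_tree x1 x x2.
pose t := d x1 m; pose l := d x x1.
have l0 : 0 < l by rewrite lt0n; apply/eqP => /tdist_eq0 h; apply: (nofix x); apply: esym.
have d12 : d x1 x2 = l by rewrite dist_act.
have d10 : d x1 x = l by rewrite dist_sym //; apply: tadj_sym.
have tl : t <= l by move: b1; rewrite /between d10 /t; lia.
set m' := g^-1 %* m.
have b2' : B x m' x1 by apply/(between_actE g); rewrite tactVK.
have dm' : d x m' = t by rewrite -(dist_act g) tactVK.
have dm : d x m = l - t.
  move: b1; rewrite /between d10 -/t (dist_sym tadj_sym Gtree_tree m x); lia.
have dmm := dist_collinear tadj_sym b2' (bsym b1).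
(* On the segment from [x] to [g x], [m'] and [m] are at distances [t] and [l - t] from [x], so [g]
   moves [m'] by [|l - 2t|]. Minimality leaves only [t = 0] and [t = l]. *)
have := xmin m'; rewrite tactVK dmm dm dm' -/x1 -/l => le.
have [t0|t0] : t = 0 \/ t = l by lia.
- by rewrite (tdist_eq0 t0).
- exfalso.
  have mx : m = x by apply: esym; apply: (@tdist_eq0); rewrite dm; lia.
  have x2x : x2 = x.
    apply/esym; apply: (@between_unique _ _ Gtree_tree x1 _ _ x2).
    + by rewrite -mx.
    + exact: between_right.
    + by rewrite d12.
  have swap y k : B x y x1 -> d x y = k -> d x (g %* y) = l - k.
    move=> b e; have := between_act g b; rewrite /between -/x1 -/x2 x2x !dist_act.
    by rewrite (dist_sym tadj_sym Gtree_tree x1) (dist_sym tadj_sym _ _ x) e -/l; lia.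
  have swapB y : B x y x1 -> B x (g %* y) x1.
    by move=> b; have := between_act g b; rewrite -/x1 -/x2 x2x; apply: bsym.
  have [y by1 dy] := @between_point _ _ Gtree_tree x x1 l./2 ltac:(rewrite -/l; lia).
  have ey := swap _ _ by1 dy.
  case: (boolP (odd l)) => ol.
  + have [y' by2 dy'] := @between_point _ _ Gtree_tree x x1 l./2.+1
      ltac:(rewrite -/l; lia).
    apply: (@tadj_noinv g y y').
    * apply: (@adj_dist _ _ Gtree_tree); rewrite (dist_collinear tadj_sym by1 by2).
      by rewrite dy dy'; lia.
    * apply: (between_unique (swapB _ by1) by2); rewrite ey dy'; lia.
    * apply: (between_unique (swapB _ by2) by1).
      rewrite (swap _ _ by2 dy') dy; lia.
  + apply: (nofix y); apply: (between_unique (swapB _ by1) by1).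
    rewrite ey dy; lia.
Qed.

Lemma axial_pow g x n : axial g x ->
  B x (gpow g n %* x) (gpow g n.+1 %* x) /\ d x (gpow g n %* x) = n * d x (g %* x).
Proof.
move=> ax; have [ne bx] := ax.
have step k : d (gpow g k %* x) (gpow g k.+1 %* x) = d x (g %* x).
  by rewrite gpowSr -tactM dist_act.
have bstep k : B x (gpow g k %* x) (gpow g k.+1 %* x).
  elim: k => [|k IH]; first by rewrite /= tact1; apply: between_left.
  have := between_act (gpow g k) bx; rewrite !tactM -gmulA.
  have -> : gpow g k ** g = gpow g k.+1 by rewrite gpowSr.
  have -> : gpow g k ** (g ** g) = gpow g k.+2 by rewrite 2!gpowSr gmulA.
  move=> b; have [|_ //] := between_concat tadj_sym IH b.
  rewrite gpowSr -tactM => /tact_inj e; exact/ne/esym.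
split=> //; elim: n => [|n IH]; first by rewrite /= tact1 dist_xx.
by have := bstep n; rewrite /between step IH => ->; lia.
Qed.

Lemma axial_pow_between g x n : axial g x -> 0 < n -> B x (g %* x) (gpow g n %* x).
Proof.
move=> ax; case: n => // n _; elim: n => [|n IH].
  by rewrite /= gmulg1; apply: between_right.
have [b _] := axial_pow n.+1 ax; exact: between_subl IH b.
Qed.

(** Change of base point: the segment from [p] to [g p] is the end of one fundamental segment
    followed by the start of the next. *)
Lemma axial_shift g x p : axial g x -> B x p (g %* x) ->
  [/\ B p (g %* x) (g %* p), d p (g %* p) = d x (g %* x) & axial g p].
Proof.
move=> ax bp; have [ne bx] := ax.
have bgp := between_act g bp.
have b1 : B p (g %* x) (g %* g %* x) by apply: (between_subr bp).
have b2 : B p (g %* p) (g %* g %* x) by apply/bsym; apply: (between_subl (bsym bgp) (bsym b1)).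
have b3 : B p (g %* x) (g %* p) by apply/bsym; apply: (between_subr (bsym bgp) (bsym b1)).
have dp : d p (g %* p) = d x (g %* x).
  move: b3 bp; rewrite /between dist_act; lia.
have nep : g %* p <> p.
  by move=> e; have := axial_dist_gt0 ax; rewrite -dp e dist_xx.
split=> //; split=> //.
case: (classic (g %* p = g %* g %* x)) => [/tact_inj -> |ne'].
- by rewrite -/(B _ _ _); apply: between_act.
- by have [] := between_concat tadj_sym b2 (between_act g b3) ne'.
Qed.

Definition on_axis g x y := exists k p, B x p (g %* x) /\ y = gzpow g k %* p.

Lemma on_axis_zpow g x y k : on_axis g x y -> on_axis g x (gzpow g k %* y).
Proof.
by move=> [j [p [b ->]]]; exists (k + j)%Z, p; split=> //; rewrite tactM gzpowD.
Qed.

Lemma on_axis_between g x p u : axial g x -> B x p (g %* x) -> B p u (g %* p) ->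
  on_axis g x u.
Proof.
move=> ax bp bu; have [b _ _] := axial_shift ax bp.
have [le|/ltnW le] := leqP (d p u) (d p (g %* x)).
- exists 0%Z, u; rewrite tact1; split=> //; apply/bsym.
  exact: (between_subl (bsym (between_order bu b le)) (bsym bp)).
- exists 1%Z, (g^-1 %* u); rewrite gzpow_one tactVK; split=> //.
  have b1 := between_order b bu le.
  have b2 := between_subr b1 bu.
  apply: (between_subl _ bp); apply/(between_actE g); by rewrite tactVK.
Qed.

(** [p] is the axis point nearest to [y], moved by a power of [g] into the fundamental segment. As
    no axis point is nearer, the path from the translate of [y] enters the axis at [p] and continues
    geodesically in either direction. *)
Lemma axis_projection g x y : axial g x -> exists k p,
  [/\ B x p (g %* x), B (gzpow g k %* y) p (g %* p)
    & B p (g %* p) (g %* gzpow g k %* y)].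
Proof.
move=> ax.
have [n [z [[j [p [bp ea]] dn]]] nmin] :
    exists2 n, (exists z, on_axis g x z /\ d y z = n) &
    forall k, (exists z, on_axis g x z /\ d y z = k) -> n <= k.
  apply: nat_least; exists (d y x), x; split=> //.
  by exists 0%Z, x; rewrite tact1; split=> //; apply: between_left.
pose y' := gzpow g (- j) %* y.
have dy' : d y' p = n.
  by rewrite -dn ea -(dist_act (gzpow g j)) /y' gzpow_opp tactVK.
have near m : on_axis g x m -> B p m y' -> m = p.
  move=> om b; have : n <= d y' m.
    apply: nmin; exists (gzpow g j %* m); split; first exact: on_axis_zpow.
    by rewrite -(dist_act (gzpow g (- j)) y) gzpow_opp tactK -gzpow_opp.
  move: b; rewrite /between (dist_sym tadj_sym _ p y') dy' (dist_sym tadj_sym _ m y') => e le.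
  by apply/esym; apply: (@tdist_eq0); lia.
exists (- j)%Z, p; split=> //; rewrite -/y'.
- have [m [b1 b2 b3]] := median tadj_sym Gtree_tree p (g %* p) y'.
  have e : m = p by apply: near b2; apply: on_axis_between b1.
  by apply/bsym; move: b3; rewrite e.
- have [m [b1 b2 b3]] := median tadj_sym Gtree_tree p (g^-1 %* p) y'.
  have e : m = p.
    apply: near b2; rewrite -(tactK g m).
    have {1}-> : g^-1 = gzpow g (-1) by rewrite -{1}(gzpow_one g) -gzpow_opp.
    apply: on_axis_zpow; apply: (on_axis_between ax bp).
    by apply/bsym; have := between_act g b1; rewrite tactVK.
  by have := between_act g b3; rewrite tactVK e.
Qed.

(** A point at distance [r] from the axis is moved by [2r] plus the translation length, so the axis
    is the set of least displacement. *)
Lemma axis_displacement g x y : axial g x -> d y (g %* y) <= d x (g %* x) ->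
  on_axis g x y.
Proof.
move=> ax le; have [k [p [bp b1 b2]]] := axis_projection y ax.
have [_ dp axp] := axial_shift ax bp.
have [b3 _] := between_concat tadj_sym b1 b2 (fun e => proj1 axp (esym e)).
set y' := gzpow g k %* y in b1 b2 b3.
have dy' : d y' (g %* y') = d y (g %* y).
  by rewrite /y' tact_comm ?dist_act //; apply: gcommZ.
have e : y' = p.
  apply: (@tdist_eq0); move: b3 b2; rewrite /between dy'; lia.
by exists (- k)%Z, p; split=> //; rewrite -e /y' gzpow_opp tactK.
Qed.

(** Commuting with [g], [c] preserves displacements under [g] and hence the axis. Each [c^n x] is
    then a [g]-translate of one of the finitely many points between [x] and [g x]; two exponents
    [n < m] with the same point yield the element, with [j = m - n]. *)
Lemma centralizer_axis g x c : axial g x -> gcomm g c ->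
  exists i j, j <> 0%Z /\ (gzpow g i ** gzpow c j) %* x = x.
Proof.
move=> ax cgc.
have H n : on_axis g x (gpow c n %* x).
  apply: axis_displacement => //.
  by rewrite tact_comm ?dist_act //; apply: gcommX.
have [f Hf] : exists f : nat -> nat, forall n, f n < (d x (g %* x)).+1 /\
    exists k p, [/\ B x p (g %* x), d x p = f n & gpow c n %* x = gzpow g k %* p].
  apply: (choice (fun n m => m < (d x (g %* x)).+1 /\
    exists k p, [/\ B x p (g %* x), d x p = m & gpow c n %* x = gzpow g k %* p])) => n.
  have [k [p [bp e]]] := H n; exists (d x p); split; last by exists k, p.
  by move: bp; rewrite /between; lia.
have [n [m [nm fe]]] := pigeonhole (fun i => proj1 (Hf i)).
have [_ [k [p [bp dp e]]]] := Hf n; have [_ [k' [p' [bp' dp' e']]]] := Hf m.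
have pp : p = p' by apply: (between_unique bp bp'); rewrite dp dp' fe.
exists (k - k')%Z, (Z.of_nat m - Z.of_nat n)%Z; split; first lia.
have -> : (k - k' = - k' + k)%Z by lia.
have -> : (Z.of_nat m - Z.of_nat n = - Z.of_nat n + Z.of_nat m)%Z by lia.
rewrite !gzpowD !gzpow_opp !gzpow_nat.
have c1 : gcomm (gzpow g k) (gpow c n)^-1 by apply/gcommV/gcommX/gcomm_sym/gcommZ.
have c2 : gcomm (gpow c n)^-1 (gzpow g k') by apply/gcommZ/gcomm_sym/gcommV/gcommX.
have c3 : gcomm (gzpow g k) (gzpow g k') by apply/gcommZ/gcomm_sym/gcommZ.
rewrite -!tactM e' -pp (tact_comm _ c1) (tact_comm _ c3) (tact_comm _ c2) tactK.
by rewrite -e tactK.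
Qed.

(** The last hypothesis places [u] on the axis. As [a] commutes with [g], it fixes all
    [g]-translates of [y], hence the paths between them, and these cover the axis. *)
Lemma commuting_elliptic_fixes_axis g x a y u : axial g x -> gcomm a g ->
  a %* y = y -> d u (g %* u) <= d x (g %* x) -> a %* u = u.
Proof.
move=> ax ca ay le; have [k [p [bp b1 b2]]] := axis_projection y ax.
have [_ dp axp] := axial_shift ax bp.
have [b3 _] := between_concat tadj_sym b1 b2 (fun e => proj1 axp (esym e)).
have ay' : a %* gzpow g k %* y = gzpow g k %* y.
  by rewrite tact_comm ?ay //; apply: gcommZ.
have ap : a %* p = p.
  apply: fix_between b3 => //; by rewrite tact_comm ?ay'.
have [j [q [bq ->]]] : on_axis g p u by apply: axis_displacement => //; rewrite dp.
rewrite tact_comm; last exact: gcommZ.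
by congr (_ %* _); apply: fix_between bq => //; rewrite tact_comm ?ap.
Qed.

(** If [g] were hyperbolic, [g^n] would be elliptic and commute with [g], hence fix the axis, along
    which it translates by a positive length. *)
Lemma elliptic_root g n y : 0 < n -> gpow g n %* y = y -> exists x, g %* x = x.
Proof.
move=> n0 fy; apply: NNPP => no.
have [x ax] : exists x, axial g x by apply: axial_exists => x e; apply: no; exists x.
have fx : gpow g n %* x = x.
  by apply: (commuting_elliptic_fixes_axis ax _ fy) => //; apply/gcomm_sym/gcommX.
have [_] := axial_pow n ax; rewrite fx dist_xx; have := axial_dist_gt0 ax; nia.
Qed.

(* If the fixed sets are disjoint, then ba translates along the line through the shortest
   segment [p, q] between them, and a would fix that segment. *)
Lemma elliptic_pair a b n y y' : a %* y = y -> b %* y' = y' -> 0 < n ->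
  gcomm a (gpow (b ** a) n) -> exists x, a %* x = x /\ b %* x = x.
Proof.
move=> ay by' n0 com; apply: NNPP => no.
have [D [p [q [ap bq dpq]]] Dmin] :
    exists2 D, (exists p q, [/\ a %* p = p, b %* q = q & d p q = D]) &
    forall k, (exists p q, [/\ a %* p = p, b %* q = q & d p q = k]) -> D <= k.
  by apply: nat_least; exists (d y y'), y, y'.
have npq : p <> q by move=> e; apply: no; exists p; split=> //; rewrite e.
(* The median of [q], [p] and [b p] is fixed by [b], so minimality of [D] forces it to be [q]: the
   segment and its image under [b] meet only there. *)
have b1 : B p q (b %* p).
  have [m [h1 h2 h3]] := median tadj_sym Gtree_tree q p (b %* p).
  have bm : b %* m = m.
    apply: (between_unique _ h2).
    - by rewrite -{1}bq; apply: between_act.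
    - by rewrite -{1}bq dist_act.
  have : D <= d p m by apply: Dmin; exists p, m.
  have h4 := bsym h1; rewrite /between dpq in h4; move=> h5.
  have -> : q = m by apply/esym; apply: (@tdist_eq0); lia.
  exact: h3.
have b2 : B q p (a %* q).
  have [m [h1 h2 h3]] := median tadj_sym Gtree_tree p q (a %* q).
  have am : a %* m = m.
    apply: (between_unique _ h2).
    - by rewrite -{1}ap; apply: between_act.
    - by rewrite -{1}ap dist_act.
  have : D <= d m q by apply: Dmin; exists m, q.
  rewrite /between dpq in h1; move=> h5.
  have -> : p = m by apply: (@tdist_eq0); lia.
  by [].
pose g := b ** a.
have gp : g %* p = b %* p by rewrite /g -tactM ap.
have b3 : B q (g %* p) (g %* q).
  by rewrite gp -{1}bq /g -tactM; apply: between_act.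
have b4 : B p (g %* p) (g %* q).
  have nq : q <> g %* p by rewrite gp -{1}bq => /tact_inj /esym.
  have b1' : B p q (g %* p) by rewrite gp.
  by have [_] := between_concat tadj_sym b1' b3 nq.
have ax : axial g p.
  split.
  - rewrite gp => e; apply: npq; have := b1; rewrite e => b1'.
    exact: (esym (between_xx b1')).
  - have := between_act g b1; rewrite -gp => b5.
    have ng : g %* p <> g %* q by move=> /tact_inj.
    by have [] := between_concat tadj_sym b4 b5 ng.
have agp : a %* gpow g n %* p = gpow g n %* p by rewrite tact_comm ?ap.
have bq' : B p q (gpow g n %* p).
  apply: (between_subl _ (axial_pow_between ax n0)); by rewrite gp.
apply: no; exists q; split=> //; exact: fix_between bq'.
Qed.

(** The path between two fixed points on opposite sides of the edge is fixed pointwise and crosses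
    the edge. *)
Lemma separated_by_edge x y p p' g : d x y = 1 -> ~ B x y p -> B x y p' ->
  g %* p = p -> g %* p' = p' -> g %* x = x /\ g %* y = y.
Proof.
move=> xy np bp gp gp'.
have [m [b1 b2 b3]] := median tadj_sym Gtree_tree x p p'.
have mx : m = x.
  apply: NNPP => mx; apply: np; apply: (between_subl _ b1).
  apply: (between_order bp b2); rewrite xy lt0n; apply/eqP => /tdist_eq0 e.
  exact/mx/esym.
subst m; have gx : g %* x = x by apply: fix_between b3.
by split=> //; apply: fix_between bp.
Qed.

End Actions.

(** * The reflection representation *)

Section Braids.
Variable G : Grp.
Variables (a b : G) (n : nat).
Hypothesis braid : alt a b n = alt b a n.
Local Notation D := (alt a b n).

Lemma braid_shiftl : a ** D = D ** (if odd n then b else a).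
Proof.
have <- : alt a b (n + 1) = D ** (if odd n then b else a).
  by rewrite alt_add; case: (odd n) => /=; rewrite gmulg1.
by rewrite addn1 /= braid.
Qed.

Lemma braid_shiftr : b ** D = D ** (if odd n then a else b).
Proof.
have <- : alt b a (n + 1) = D ** (if odd n then a else b).
  by rewrite alt_add braid; case: (odd n) => /=; rewrite gmulg1.
by rewrite addn1.
Qed.

Lemma alt_doubleE : alt a b n.*2 = D ** D.
Proof. by rewrite -addnn alt_add; case: (odd n); rewrite -?braid. Qed.

Lemma braid_commutes : gcomm a (alt a b n.*2) /\ gcomm b (alt a b n.*2).
Proof.
rewrite alt_doubleE /gcomm; split.
- rewrite gmulA braid_shiftl -!gmulA; congr (_ ** _).
  by case: (odd n) braid_shiftl braid_shiftr.
- rewrite gmulA braid_shiftr -!gmulA; congr (_ ** _).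
  by case: (odd n) braid_shiftl braid_shiftr.
Qed.

Lemma braid_even_commutes : ~~ odd n -> gcomm a D /\ gcomm b D.
Proof. by move=> /negbTE e; have := braid_shiftl; have := braid_shiftr; rewrite e. Qed.

Lemma braid_odd_conj : odd n -> b = D^-1 ** a ** D.
Proof. by move=> e; have := braid_shiftl; rewrite e -gmulA => ->; rewrite gmulK. Qed.

End Braids.

Section Perm.
Variable X : Type.

(** The universal property of the presentation needs a group as target; here it is the group of
    bijections, with the inverse kept as data. *)
Record perm_of := PermOf {
  pfun : X -> X; pinv : X -> X;
  pfunK : forall x, pinv (pfun x) = x; pinvK : forall x, pfun (pinv x) = x }.

Lemma perm_eq_fun (s t : perm_of) : (forall x, pfun s x = pfun t x) -> s = t.
Proof.
case: s => f f' fK f'K; case: t => g g' gK g'K /= e.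
have ef : f = g by apply: functional_extensionality.
subst g; have ef' : f' = g'.
  by apply: functional_extensionality => x; rewrite -{1}(g'K x) fK.
subst g'; f_equal; exact: proof_irrelevance.
Qed.

Program Definition perm_mul (s t : perm_of) : perm_of :=
  @PermOf (fun x => pfun s (pfun t x)) (fun x => pinv t (pinv s x)) _ _.
Next Obligation. by rewrite /= !pfunK. Qed.
Next Obligation. by rewrite /= !pinvK. Qed.

Definition perm_inv (s : perm_of) : perm_of := PermOf (pinvK s) (pfunK s).

Definition perm_id : perm_of :=
  PermOf (fun x : X => erefl : id (id x) = x) (fun x : X => erefl : id (id x) = x).

Program Definition perm_group : Grp :=
  @Build_Grp perm_of perm_mul perm_inv perm_id _ _ _.
Next Obligation. exact: perm_eq_fun. Qed.
Next Obligation. exact: perm_eq_fun. Qed.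
Next Obligation. by apply: perm_eq_fun => y /=; rewrite pfunK. Qed.

End Perm.

Local Open Scope R_scope.

(** * The Chebyshev recursion at the angle pi/m *)

Section Chebyshev.

(** For [n >= 1] this is the Chebyshev polynomial of the second kind of degree [n - 1] at [c / 2]:
    it equals [sin (n t) / sin t] when [c = 2 cos t]. *)
Fixpoint cheb (c : R) (n : nat) : R :=
  match n with
  | 0%nat => 0
  | S k => match k with 0%nat => 1 | S j => c * cheb c k - cheb c j end
  end.

Lemma chebSS c n : cheb c n.+2 = c * cheb c n.+1 - cheb c n.
Proof. by []. Qed.

Lemma cheb_sin t n : sin t * cheb (2 * cos t) n = sin (INR n * t).
Proof.
suff : sin t * cheb (2 * cos t) n = sin (INR n * t) /\
       sin t * cheb (2 * cos t) n.+1 = sin (INR n.+1 * t) by case.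
elim: n => [|n [IH1 IH2]].
  by split; [rewrite /= Rmult_0_l sin_0; ring|rewrite /= Rmult_1_l; ring].
split=> //; rewrite chebSS Rmult_minus_distr_l IH1.
have -> : sin t * (2 * cos t * cheb (2 * cos t) n.+1) =
          2 * cos t * (sin t * cheb (2 * cos t) n.+1) by ring.
rewrite IH2.
have -> : INR n.+2 * t = INR n.+1 * t + t by rewrite (S_INR n.+1); ring.
have -> : INR n * t = INR n.+1 * t - t by rewrite S_INR; ring.
rewrite sin_plus sin_minus; ring.
Qed.

Definition angle (n : nat) : R := PI / INR n.
Definition coxeter_const (n : nat) : R := 2 * cos (angle n).

Lemma angle_bounds n : (2 <= n)%N -> 0 < angle n <= PI / 2.
Proof.
move=> n2; have h : 2 <= INR n by have := le_INR 2 n ltac:(lia); rewrite /=; lra.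
have := PI_RGT_0 => p0; rewrite /angle; split; first by apply: Rdiv_lt_0_compat; lra.
by apply: Rmult_le_compat_l; [lra|apply: Rinv_le_contravar; lra].
Qed.

Lemma cheb_coxeter n : (2 <= n)%N ->
  [/\ cheb (coxeter_const n) n = 0, cheb (coxeter_const n) n.+1 = -1
    & cheb (coxeter_const n) n.-1 = 1].
Proof.
move=> n2; have [t0 t1] := angle_bounds n2.
have p0 := PI_RGT_0.
have s0 : 0 < sin (angle n) by apply: sin_gt_0; lra.
have h k := cheb_sin (angle n) k; rewrite -/(coxeter_const n) in h.
have n0 : INR n <> 0 by apply: not_0_INR; lia.
have nt : INR n * angle n = PI by rewrite /angle; field.
have e1 : cheb (coxeter_const n) n = 0.
  have := h n; rewrite nt sin_PI => /Rmult_integral [|//]; lra.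
have e2 : cheb (coxeter_const n) n.+1 = -1.
  have := h n.+1; rewrite S_INR Rmult_plus_distr_r nt Rmult_1_l.
  rewrite Rplus_comm neg_sin => e; nra.
split=> //.
have := e2; have -> : n.+1 = n.-1.+2 by lia.
rewrite chebSS; have -> : n.-1.+1 = n by lia.
rewrite e1; lra.
Qed.

Lemma coxeter_const_sqr n : coxeter_const n * coxeter_const n <= 4.
Proof. have := COS_bound (angle n); rewrite /coxeter_const; nra. Qed.

Lemma coxeter_const_neq0 n : (3 <= n)%N -> coxeter_const n <> 0.
Proof.
move=> n3; have h : 3 <= INR n by have := le_INR 3 n ltac:(lia); rewrite /=; lra.
have p0 := PI_RGT_0; have t0 : 0 < angle n by apply: Rdiv_lt_0_compat; lra.
have t1 : angle n < PI / 2.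
  by apply: Rmult_lt_compat_l; [lra|apply: Rinv_lt_contravar; lra].
have := cos_gt_0 (angle n) ltac:(lra) t1; rewrite /coxeter_const; lra.
Qed.

End Chebyshev.

Section Reflections.
Variables (V : finType) (adj : rel V) (m : V -> V -> nat).
Hypothesis adj_sym : symmetric adj.
Hypothesis adj_irr : irreflexive adj.
Hypothesis m_sym : forall a b, adj a b -> m a b = m b a.
Hypothesis m_ge2 : forall a b, adj a b -> (2 <= m a b)%N.
Implicit Types (u v w : V) (x y : V -> R).

(* The reflection representation of the Hecke algebra with parameter q = 4, where
   B(v,v) = 1 + q and B(v,w) = - 2 sqrt(q) cos(pi/m_vw), acting on functions. *)
Definition hform v w : R :=
  if v == w then 5 else if adj v w then - 2 * coxeter_const (m v w) else 0.

(** Here [x] lists the values of a linear form on the simple roots, and the action is the dual one.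
    In these coordinates [v] acts through [x v] alone and fixes every [x] with [x v = 0], which
    makes the vectors [delta] good test vectors. *)
Definition hrefl v x : V -> R := fun w => x w - x v * hform v w.
Definition hrefl_inv v x : V -> R := fun w => x w - x v * hform v w / 4.

Lemma hform_diag v : hform v v = 5.
Proof. by rewrite /hform eqxx. Qed.

Lemma hform_edge u v : adj u v ->
  hform u v = - 2 * coxeter_const (m u v) /\ hform v u = - 2 * coxeter_const (m u v).
Proof.
move=> uv; have vu : adj v u by rewrite adj_sym.
rewrite /hform [v == u]eq_sym uv vu -(m_sym uv).
by case: eqP => // e; rewrite e adj_irr in uv.
Qed.

Lemma hreflK v x : hrefl_inv v (hrefl v x) = x.
Proof.
by apply: functional_extensionality => w; rewrite /hrefl_inv /hrefl hform_diag; field.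
Qed.

Lemma hrefl_invK v x : hrefl v (hrefl_inv v x) = x.
Proof.
by apply: functional_extensionality => w; rewrite /hrefl_inv /hrefl hform_diag; field.
Qed.

Definition hperm v : perm_group (V -> R) := PermOf (hreflK v) (hrefl_invK v).

Lemma hrefl_self v x : hrefl v x v = - 4 * x v.
Proof. by rewrite /hrefl hform_diag; ring. Qed.

Lemma hrefl_edge u v x : adj u v -> hrefl u x v = x v + 2 * coxeter_const (m u v) * x u.
Proof. by move=> /hform_edge [e _]; rewrite /hrefl e; ring. Qed.

Lemma hrefl_fix v x : x v = 0 -> hrefl v x = x.
Proof. by move=> e; apply: functional_extensionality => w; rewrite /hrefl e; ring. Qed.

(** [f] is the coordinate of the rightmost letter, which acts first, and [o] is the other one. With
    the factors [sqrt q = 2] taken out, each further letter performs one step of the Chebyshev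
    recursion. *)
Lemma hperm_alt u v x j : adj u v ->
  let c := coxeter_const (m u v) in
  let f := if odd j then x v else x u in
  let o := if odd j then x u else x v in
  pfun (alt (hperm u) (hperm v) j.+1) x u =
    - (2 ^ j.+2 * cheb c j.+1 * f + 2 ^ j.+1 * cheb c j * o) /\
  pfun (alt (hperm u) (hperm v) j.+1) x v =
    2 ^ j.+1 * cheb c j.+2 * f + 2 ^ j * cheb c j.+1 * o.
Proof.
elim: j u v => [|j IH] u v uv.
  by rewrite /= hrefl_self hrefl_edge //; split; ring.
have vu : adj v u by rewrite adj_sym.
have := IH _ _ vu; rewrite -(m_sym uv) => {IH}.
rewrite -[pfun (alt (hperm u) _ j.+2) x]/(hrefl u (pfun (alt (hperm v) (hperm u) j.+1) x)).
move: (pfun (alt (hperm v) (hperm u) j.+1) x) => y /= [e1 e2].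
rewrite hrefl_self hrefl_edge // e1 e2.
by case: (odd j) => /=; split; ring.
Qed.

(** At length [m] the Chebyshev values are 0, 1 and -1, so the half twist multiplies the two
    coordinates by [-2^m] and, for odd [m], exchanges them. *)
Lemma hperm_alt_edge u v x : adj u v ->
  let D := alt (hperm u) (hperm v) (m u v) in
  pfun D x u = - 2 ^ (m u v) * (if odd (m u v) then x v else x u) /\
  pfun D x v = - 2 ^ (m u v) * (if odd (m u v) then x u else x v).
Proof.
move=> uv /=; have m2 := m_ge2 uv; have [] := hperm_alt x (m u v).-1 uv.
have [c1 c2 c3] := cheb_coxeter m2.
have -> : (m u v).-1.+1 = m u v by lia.
have -> : odd (m u v).-1 = ~~ odd (m u v) by lia.
by rewrite c1 c2 c3 => -> ->; case: (odd _) => /=; split; ring.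
Qed.

(** [al] and [be] are the coefficients of the projection of the root [w] to the plane of [u] and
    [v]; the Gram determinant is [25 - 4 c^2 >= 9]. The remainder is orthogonal to both roots, hence
    invariant, so the braid relation has to be checked on the coordinates [u] and [v] only. *)
Lemma hperm_invariant u v w : adj u v -> exists al be, forall g,
  gsub (fun g => g = hperm u \/ g = hperm v) g ->
  forall x, pfun g x w - al * pfun g x u - be * pfun g x v = x w - al * x u - be * x v.
Proof.
move=> uv; have [e1 e2] := hform_edge uv.
set c := coxeter_const (m u v) in e1 e2.
have det : 25 - 4 * (c * c) <> 0 by have := coxeter_const_sqr (m u v); rewrite -/c; lra.
exists ((5 * hform u w + 2 * c * hform v w) / (25 - 4 * (c * c))).
exists ((2 * c * hform u w + 5 * hform v w) / (25 - 4 * (c * c))).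
apply: gsub_min; last first.
  move=> g [->|->] x /=; rewrite /hrefl !hform_diag ?e1 ?e2; field; lra.
split; [|split].
- by [].
- by move=> g h Hg Hh x /=; rewrite Hg Hh.
- by move=> g Hg x; rewrite -Hg /= pinvK.
Qed.

Lemma subgroup_alt (G : Grp) (H : G -> Prop) a b n : is_subgroup H -> H a -> H b ->
  H (alt a b n).
Proof.
move=> [H1 [HM _]]; elim: n a b => //= n IH a b Ha Hb; apply: HM => //; exact: IH.
Qed.

Lemma hperm_artin : artin_relations adj m hperm.
Proof.
move=> u v uv; have vu : adj v u by rewrite adj_sym.
have m2 := m_ge2 uv.
apply: perm_eq_fun => x; apply: functional_extensionality => w.
have [e1 e2] := hperm_alt_edge x uv; have [e3 e4] := hperm_alt_edge x vu.
rewrite -(m_sym uv) in e3 e4.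
have [al [be inv]] := hperm_invariant w uv.
set S := fun g => _ in inv.
have := inv _ (subgroup_alt (m u v) (gsub_subgroup S) (gs_in (or_introl erefl : S _))
  (gs_in (or_intror erefl : S _))) x.
have := inv _ (subgroup_alt (m u v) (gsub_subgroup S) (gs_in (or_intror erefl : S _))
  (gs_in (or_introl erefl : S _))) x.
rewrite e1 e2 e3 e4; lra.
Qed.

Variables (G : Grp) (gen : V -> G).
Hypothesis pres : artin_presentation adj m gen.

Lemma reflection_action : exists rho : G -> (V -> R) -> (V -> R),
  [/\ forall x, rho gone x = x, forall g h x, rho (g ** h)%grp x = rho g (rho h x)
    & forall v x, rho (gen v) x = hrefl v x].
Proof.
have [_ [_ /(_ _ _ hperm_artin) [phi [hphi ephi]]]] := pres.
exists (fun g x => pfun (phi g) x); split.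
- by move=> x; rewrite (hom_one hphi).
- by move=> g h x; rewrite hphi.
- by move=> v x; rewrite ephi.
Qed.

Lemma Rpow_eq1 (t : R) n : 1 < Rabs t -> t ^ n = 1 -> n = 0%N.
Proof.
move=> t1 e; case: n e => // n e; exfalso.
have : Rabs (t ^ n.+1) = 1 by rewrite e Rabs_R1.
by rewrite -RPow_abs => h; have := Rlt_pow_R1 _ n.+1 t1 ltac:(lia); lra.
Qed.

Section Scaling.
Variable rho : G -> (V -> R) -> (V -> R).
Hypothesis rho1 : forall x, rho gone x = x.
Hypothesis rhoM : forall g h x, rho (g ** h)%grp x = rho g (rho h x).
Hypothesis rhoV : forall v x, rho (gen v) x = hrefl v x.

Lemma rho_stab_subgroup x : is_subgroup (fun g => rho g x = x).
Proof.
split; [exact: rho1|split] => [g h eg eh|g eg]; first by rewrite rhoM eh.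
by rewrite -{1}eg -rhoM gmulV rho1.
Qed.

Lemma rho_zpow_scale (F : (V -> R) -> R) (g : G) t k x : 1 < Rabs t ->
  (forall y, F (rho g y) = t * F y) ->
  (F x = 0 -> F (rho (gzpow g k) x) = 0) /\
  (F x <> 0 -> F (rho (gzpow g k) x) = F x -> k = 0%Z).
Proof.
move=> t1 h; have hn n y : F (rho (gpow g n) y) = t ^ n * F y.
  elim: n => [|n IH] /=; first by rewrite rho1; ring.
  by rewrite rhoM h IH; ring.
have t0 : t <> 0 by move=> e; move: t1; rewrite e Rabs_R0; lra.
have [n [[-> ->]|[-> ->]]] := gzpow_case g k.
- rewrite hn; split=> [->|x0 e]; first by ring.
  by rewrite (@Rpow_eq1 t n) //; nra.
- have := hn n (rho (gpow g n)^-1%grp x); rewrite -rhoM gmulVV rho1 => e.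
  split=> [e0|x0 e1].
  + move: e; rewrite e0 => /esym /Rmult_integral [/pow_nonzero|] //; by case.
  + by rewrite (@Rpow_eq1 t n) //; rewrite e1 in e; nra.
Qed.

Definition delta u : V -> R := fun w => if w == u then 1 else 0.

Lemma delta_self u : delta u u = 1. Proof. by rewrite /delta eqxx. Qed.
Lemma delta_neq u w : w <> u -> delta u w = 0.
Proof. by rewrite /delta => /eqP /negbTE ->. Qed.

Lemma rho_gen_self v x : rho (gen v) x v = - 4 * x v.
Proof. by rewrite rhoV hrefl_self. Qed.

Lemma rho_gen_fix v x k : x v = 0 -> rho (gzpow (gen v) k) x = x.
Proof.
move=> e; apply: (subgroup_zpow k (rho_stab_subgroup x)).
by rewrite rhoV hrefl_fix.
Qed.

Lemma abs4 : 1 < Rabs (- 4). Proof. by rewrite Rabs_left; lra. Qed.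

Lemma rho_central v w x u : adj v w -> u = v \/ u = w ->
  rho (alt (gen v) (gen w) (m v w).*2) x u = 4 ^ (m v w) * x u.
Proof.
move=> vw eu.
have alt_rho a b n y : rho (alt (gen a) (gen b) n) y = pfun (alt (hperm a) (hperm b) n) y.
  elim: n a b => [|n IH] a b /=; first exact: rho1.
  by rewrite rhoM IH rhoV.
have br : alt (gen v) (gen w) (m v w) = alt (gen w) (gen v) (m v w) by case: pres => h _; apply: h.
have sq : 4 ^ m v w = 2 ^ m v w * 2 ^ m v w.
  by rewrite -Rpow_mult_distr; congr (_ ^ _); lra.
rewrite (alt_doubleE br) rhoM !alt_rho sq.
have [e1 e2] := hperm_alt_edge x vw.
have [e3 e4] := hperm_alt_edge (pfun (alt (hperm v) (hperm w) (m v w)) x) vw.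
case: eu => ->; rewrite ?e3 ?e4 ?e1 ?e2; case: (odd _); rewrite ?e1 ?e2; ring.
Qed.

Lemma abs_pow4 v w : adj v w -> 1 < Rabs (4 ^ m v w).
Proof.
move=> vw; rewrite -RPow_abs; apply: Rlt_pow_R1; first by rewrite Rabs_right; lra.
by have := m_ge2 vw; lia.
Qed.

(** Tested on [delta u]: powers of [gen v] fix it, while [gen u] multiplies its [u]-coordinate by
    -4. *)
Lemma rho_gen_zpow_neq u v s t : u <> v -> gzpow (gen u) s = gzpow (gen v) t -> s = 0%Z.
Proof.
move=> uv e.
have [_] := @rho_zpow_scale (fun x => x u) (gen u) _ s (delta u) abs4 (rho_gen_self u).
rewrite delta_self e rho_gen_fix ?delta_self; last by apply: delta_neq => /esym.
by apply; lra.
Qed.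

(** Tested on [delta w], which [gen v] and [gen w'], hence the right-hand side, fix. On the left the
    [v]-coordinate stays 0, so the power of [gen v] acts trivially and the [w]-coordinate is
    multiplied by [(4^m)^t]. *)
Lemma rho_central_neq v w w' s t s' t' : adj v w -> w' <> w ->
  (gzpow (gen v) s ** gzpow (alt (gen v) (gen w) (m v w).*2) t =
   gzpow (gen v) s' ** gzpow (alt (gen v) (gen w') (m v w').*2) t')%grp -> t = 0%Z.
Proof.
move=> vw ww' e; set c := alt _ _ _ in e; set c' := alt (gen v) (gen w') _ in e.
have vnw : v <> w by move=> h; rewrite h adj_irr in vw.
have dv : delta w v = 0 by apply: delta_neq.
have fixv : rho (gen v) (delta w) = delta w by rewrite rhoV hrefl_fix.
have fixw' : rho (gen w') (delta w) = delta w by rewrite rhoV hrefl_fix ?delta_neq.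
have fixr : rho (gzpow (gen v) s' ** gzpow c' t')%grp (delta w) = delta w.
  have sg := rho_stab_subgroup (delta w).
  rewrite rhoM (subgroup_zpow t' sg) ?(subgroup_zpow s' sg) //.
  exact: (subgroup_alt _ sg).
have [h0 _] := @rho_zpow_scale (fun x => x v) c _ t (delta w) (abs_pow4 vw)
   (fun y => rho_central y vw (or_introl erefl)).
have [_ h1] := @rho_zpow_scale (fun x => x w) c _ t (delta w) (abs_pow4 vw)
   (fun y => rho_central y vw (or_intror erefl)).
move: fixr; rewrite -e rhoM rho_gen_fix; last by apply: h0.
by move=> f; apply: h1; rewrite ?f delta_self //; lra.
Qed.

(** Both sides are applied to [delta b]. The right one gives its image under [gen b], so [a^s] fixes
    that image, whose [a]-coordinate is twice the Coxeter constant and is nonzero for [m >= 3]. *)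
Lemma rho_gen_conj a b s t : adj a b -> (3 <= m a b)%N ->
  (gzpow (gen a) s ** gen b = gen b ** gzpow (gen a) t)%grp -> s = 0%Z.
Proof.
move=> ab m3 e; have ba : a <> b by move=> h; rewrite h adj_irr in ab.
have [_] := @rho_zpow_scale (fun x => x a) (gen a) _ s (rho (gen b) (delta b)) abs4
  (rho_gen_self a).
rewrite -rhoM e rhoM rho_gen_fix ?delta_neq // rhoV hrefl_edge ?(adj_sym b a) //.
rewrite delta_self delta_neq // -(m_sym ab); apply=> //.
by have := coxeter_const_neq0 m3; lra.
Qed.

End Scaling.

Lemma gen_zpow_neq u v s t : u <> v -> gzpow (gen u) s = gzpow (gen v) t -> s = 0%Z.
Proof. have [rho [h1 h2 h3]] := reflection_action; exact: (rho_gen_zpow_neq h1 h2 h3). Qed.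

Lemma central_neq v w w' s t s' t' : adj v w -> w' <> w ->
  (gzpow (gen v) s ** gzpow (alt (gen v) (gen w) (m v w).*2) t =
   gzpow (gen v) s' ** gzpow (alt (gen v) (gen w') (m v w').*2) t')%grp -> t = 0%Z.
Proof. have [rho [h1 h2 h3]] := reflection_action; exact: (rho_central_neq h1 h2 h3). Qed.

Lemma gen_conj_neq a b s t : adj a b -> (3 <= m a b)%N ->
  (gzpow (gen a) s ** gen b = gen b ** gzpow (gen a) t)%grp -> s = 0%Z.
Proof. have [rho [h1 h2 h3]] := reflection_action; exact: (rho_gen_conj h1 h2 h3). Qed.

End Reflections.
Local Close Scope R_scope.

(** * Chunks of a graph *)

Section Graph.
Variables (V : finType) (adj : rel V).
Hypothesis adj_sym : symmetric adj.
Hypothesis adj_irr : irreflexive adj.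
Implicit Types (u v w a b : V) (A B L S : {set V}).

Definition inrel S : rel V := [rel u w | [&& adj u w, u \in S & w \in S]].
Local Notation conn S := (connect (inrel S)).

Lemma adj_neq u v : adj u v -> u <> v.
Proof. by move=> uv e; rewrite e adj_irr in uv. Qed.

Lemma inrel_sym S : symmetric (inrel S).
Proof. by move=> u w; rewrite /inrel /= adj_sym [(u \in S) && _]andbC. Qed.

Lemma conn_sym S u w : conn S u w = conn S w u.
Proof. exact: (sym_connect_sym (@inrel_sym S)). Qed.

Lemma connect_closed (e : rel V) (P : V -> Prop) x y :
  (forall u w, e u w -> P u -> P w) -> connect e x y -> P x -> P y.
Proof.
move=> h /connectP [p ep ->]; elim: p x ep => [|z p IH] x //= /andP [xz zp] Px.
by apply: IH zp _; apply: h xz Px.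
Qed.

Lemma connect_first (e : rel V) x y : connect e x y -> x <> y -> exists z, e x z.
Proof.
by move=> /connectP [[|z p] /= ep -> //] _; exists z; case/andP: ep.
Qed.

Lemma conn_sub A B u w : A \subset B -> conn A u w -> conn B u w.
Proof.
move=> /subsetP sAB; apply: connect_sub => x y /and3P [xy xA yA].
by apply: connect1; rewrite /inrel /= xy !sAB.
Qed.

Lemma path_conn A B x p : path (inrel A) x p -> {subset x :: p <= B} ->
  conn B x (last x p).
Proof.
elim: p x => [|z p IH] x /=; first by rewrite connect0.
move=> /andP [/and3P [xz _ _] zp] sB.
apply: (connect_trans (y := z)).
  by apply: connect1; rewrite /inrel /= xz !sB ?inE ?eqxx ?orbT.
by apply: IH => // u up; apply: sB; rewrite inE up orbT.
Qed.

Lemma path_inrel A x p z : path (inrel A) x p -> z \in p -> z \in A.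
Proof.
elim: p x => [|y p IH] x //= /andP [/and3P [_ _ yA] yp]; rewrite inE => /orP [/eqP -> //|].
exact: IH yp.
Qed.

Lemma connected_nbr S v w : connected_in adj S -> v \in S -> w \in S -> v <> w ->
  exists2 z, z \in S & adj v z.
Proof.
move=> cS vS wS vw; have [z /and3P [vz _ zS]] := connect_first (cS _ _ vS wS) vw.
by exists z.
Qed.

Lemma chunk_remove L v : chunk_like adj L -> v \in L -> connected_in adj (L :\ v).
Proof. by move=> [_ [_ h]] vL; apply: NNPP => nc; apply: (h v). Qed.

Lemma pair_connected_del a b v : connected_in adj ([set a; b] :\ v) \/ v <> a /\ v <> b.
Proof.
case: (eqVneq v a) => [->|va]; last case: (eqVneq v b) => [->|vb].
- left=> x y; rewrite !inE => /andP [/negbTE -> /= /eqP ->] /andP [/negbTE -> /= /eqP ->].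
  exact: connect0.
- left=> x y; rewrite !inE => /andP [/negbTE -> ]; rewrite orbF => /eqP -> /andP [/negbTE ->].
  by rewrite orbF => /eqP ->; exact: connect0.
- by right; split; apply/eqP.
Qed.

Lemma edge_chunk_like a b : adj a b -> chunk_like adj [set a; b].
Proof.
move=> ab; split; [|split].
- by apply/set0Pn; exists a; rewrite !inE eqxx.
- have cab : conn [set a; b] a b by apply: connect1; rewrite /inrel /= ab !inE !eqxx orbT.
  move=> x y; rewrite !inE => /orP [/eqP ->|/eqP ->] /orP [/eqP ->|/eqP ->] //=;
    rewrite ?connect0 //.
  by rewrite [connect _ _ _]conn_sym.
- move=> v [vS nc]; case: (pair_connected_del a b v) => [//|[va vb]].
  by move: vS; rewrite !inE => /orP [/eqP|/eqP].
Qed.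

Lemma big_chunk_above S : chunk_like adj S -> exists2 L, big_chunk adj L & S \subset L.
Proof.
move=> cS.
have [n [L [SL cL dL]] nmin] := @nat_least
  (fun n => exists L, [/\ S \subset L, chunk_like adj L & #|V| - #|L| = n])
  (ex_intro _ _ (ex_intro _ S (And3 (subxx S) cS erefl))).
exists L => //; split=> // L' LL' cL'; apply/esym/eqP; rewrite eqEcard LL' /=.
have := nmin (#|V| - #|L'|) ltac:(exists L'; split=> //; exact: subset_trans LL').
have := subset_leq_card (subsetT L); have := subset_leq_card (subsetT L').
rewrite cardsT; lia.
Qed.

Lemma edge_big_chunk a b : adj a b -> exists L, [/\ big_chunk adj L, a \in L & b \in L].
Proof.
move=> /edge_chunk_like /big_chunk_above [L bL /subsetP sL].
by exists L; rewrite !sL ?inE ?eqxx ?orbT.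
Qed.

(* Adjoining to two chunks through v a simple path that joins them off v creates no cut
   vertex, so maximality makes them equal. *)
Lemma big_chunk_unique L L' v x y : big_chunk adj L -> big_chunk adj L' ->
  v \in L -> v \in L' -> x \in L -> x <> v -> y \in L' -> y <> v ->
  conn [set~ v] x y -> L = L'.
Proof.
move=> [cL mL] [cL' mL'] vL vL' xL xv yL' yv /connectP [p0 ep0 ey].
move: ey yL' yv; case/shortenP: ep0 => p ep up _ ey yL' yv {p0}.
pose U := L :|: L' :|: [set z in x :: p].
have sLU : L \subset U by apply/subsetP => z zL; rewrite !inE zL.
have sL'U : L' \subset U by apply/subsetP => z zL; rewrite !inE zL orbT.
have pv z : z \in x :: p -> z <> v.
  rewrite inE => /orP [/eqP -> //|zp].
  by have := path_inrel ep zp; rewrite !inE => /eqP.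
have sPU z : z \in x :: p -> z \in U by move=> zp; rewrite !inE; rewrite inE in zp; rewrite zp orbT.
have delv u : u \in U :\ v -> conn (U :\ v) x u.
  have lc : conn (U :\ v) x y.
    rewrite ey; apply: path_conn ep _ => z zp; rewrite in_setD1 sPU // andbT.
    exact/eqP/pv.
  rewrite in_setD1 => /andP [uv]; rewrite in_setU => /orP [|]; first rewrite in_setU => /orP [].
  - move=> uL; apply: (conn_sub (setSD _ sLU)); apply: chunk_remove => //.
    + by rewrite in_setD1 xL andbT; apply/eqP.
    + by rewrite in_setD1 uL uv.
  - move=> uL; apply: connect_trans lc _; apply: (conn_sub (setSD _ sL'U)).
    apply: chunk_remove => //; rewrite in_setD1 ?yL' ?uL ?uv ?andbT //.
    exact/eqP.
  - rewrite inE => /splitPl up'; case: up' ep up ey sPU pv lc => p1 p2 eu.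
    rewrite cat_path => /andP [ep1 _] _ _ sPU pv _; rewrite -eu.
    apply: path_conn ep1 _ => z zp; rewrite in_setD1 sPU ?andbT; last first.
      by move: zp; rewrite !inE mem_cat => /orP [->//|->]; rewrite orbT.
    apply/eqP/pv; by move: zp; rewrite !inE mem_cat => /orP [->//|->]; rewrite orbT.
have delz z u : z <> v -> u \in U :\ z -> conn (U :\ z) v u.
  move=> /eqP zv; rewrite in_setD1 => /andP [uz].
  have inL w : w \in L :\ z -> conn (U :\ z) v w.
    move=> wL; apply: (conn_sub (setSD _ sLU)).
    case: (boolP (z \in L)) => zL.
    + by apply: chunk_remove => //; rewrite in_setD1 vL eq_sym zv.
    + have e : L :\ z = L by apply/setDidPl; rewrite disjoint_sym disjoints1.
      rewrite e in wL *; by case: cL => _ [h _]; apply: h.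
  have inL' w : w \in L' :\ z -> conn (U :\ z) v w.
    move=> wL; apply: (conn_sub (setSD _ sL'U)).
    case: (boolP (z \in L')) => zL.
    + by apply: chunk_remove => //; rewrite in_setD1 vL' eq_sym zv.
    + have e : L' :\ z = L' by apply/setDidPl; rewrite disjoint_sym disjoints1.
      rewrite e in wL *; by case: cL' => _ [h _]; apply: h.
  rewrite in_setU => /orP [|]; first rewrite in_setU => /orP [uL|uL].
  - by apply: inL; rewrite in_setD1 uz.
  - by apply: inL'; rewrite in_setD1 uz.
  - rewrite inE => /splitPl up'; case: up' ep up ey sPU {pv delv} => p1 p2 eu.
    rewrite cat_path last_cat eu => /andP [ep1 ep2] up ey sPU.
    (* A simple path passes [z] only once: if [z] comes before [u], then [u] is reached from the end
       [y] in [L'], and otherwise from the end [x] in [L]. *)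
    case: (boolP (z \in x :: p1)) => zp1.
    + have sub : {subset u :: p2 <= U :\ z}.
        move=> w; rewrite inE in_setD1 => /orP [/eqP ->|wp].
          by rewrite uz sPU // -eu -cat_cons mem_cat mem_last.
        rewrite sPU ?andbT; last by rewrite -cat_cons mem_cat wp orbT.
        apply/eqP => wz; move: up; rewrite -cat_cons cat_uniq => /and3P [_ /hasPn h _].
        by have := h w wp; rewrite /= wz zp1.
      apply: (connect_trans (inL' _ (_ : y \in _))).
        rewrite in_setD1 yL' andbT; have := sub y; rewrite in_setD1.
        by rewrite ey mem_last => /(_ isT) /andP [].
      by rewrite conn_sym ey; apply: path_conn ep2 _.
    + have sub : {subset x :: p1 <= U :\ z}.
        move=> w wp; rewrite in_setD1 sPU ?andbT; last by rewrite -cat_cons mem_cat wp.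
        by apply/eqP => wz; move: zp1; rewrite -wz wp.
      apply: (connect_trans (inL _ (_ : x \in _))).
        by rewrite in_setD1 xL andbT; have := sub x (mem_head _ _); rewrite in_setD1 => /andP [].
      by rewrite -eu; apply: path_conn ep1 _.
have cU : chunk_like adj U.
  split; [|split].
  - by apply/set0Pn; exists v; rewrite !inE vL.
  - move=> a b aU bU.
    have all c : c \in U -> conn U v c.
      move=> cU; case: (eqVneq c v) => [->|cv]; first exact: connect0.
      apply: (connect_trans (y := x)).
        by apply: (conn_sub sLU); case: cL => _ [h _]; apply: h.
      by apply: (conn_sub (subD1set U v)); apply: delv; rewrite in_setD1 cv.
    by apply: (connect_trans (y := v)); [rewrite [connect _ _ _]conn_sym|]; apply: all.
  - move=> z [zU]; apply=> a b aU bU.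
    case: (eqVneq z v) => [zv|/eqP zv].
    + subst z; apply: (connect_trans (y := x)); last exact: delv.
      by rewrite [connect _ _ _]conn_sym; apply: delv.
    + apply: (connect_trans (y := v)); last exact: delz.
      by rewrite [connect _ _ _]conn_sym; apply: delz.
by rewrite -(mL _ sLU cU) -(mL' _ sL'U cU).
Qed.

Section Connected.
Hypothesis gconn : connected_in adj [set: V].
Hypothesis card3 : 3 <= #|V|.

Definition two_nbrs v := exists w w', [/\ adj v w, adj v w' & w <> w'].

Lemma closed_all (P : V -> Prop) v w : (forall x y, adj x y -> P x -> P y) -> P v -> P w.
Proof.
move=> h; apply: connect_closed (gconn (in_setT v) (in_setT w)) => x y /and3P [xy _ _].
exact: h.
Qed.

Lemma third_vertex a b : exists c, c <> a /\ c <> b.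
Proof.
apply: NNPP => no.
have /subset_leq_card : [set: V] \subset [set a; b].
  apply/subsetP => c _; rewrite !inE; apply: contraT; rewrite negb_or => /andP [ca cb].
  by case: no; exists c; split; apply/eqP.
rewrite cardsT cards2 => h; have h2 : #|V| <= 2 by apply: leq_trans h _; case: (a != b).
by have := leq_trans card3 h2.
Qed.

Lemma has_nbr v : exists w, adj v w.
Proof.
have [c [cv _]] := third_vertex v v.
have [|z _ vz] := connected_nbr gconn (in_setT v) (in_setT c); first by move/esym.
by exists z.
Qed.

Lemma big_chunk_card L : big_chunk adj L -> 2 <= #|L|.
Proof.
move=> [cL mL]; have [/set0Pn [v vL] [kL _]] := cL.
rewrite ltnNge; apply/negP => c1.
have eL : L = [set v].
  apply/eqP; rewrite eq_sym eqEcard sub1set vL cards1 /=; lia.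
have [w vw] := has_nbr v.
have e := mL [set v; w] ltac:(by rewrite eL sub1set !inE eqxx) (edge_chunk_like vw).
by move: c1; rewrite -e cards2; case: eqP (adj_neq vw).
Qed.

Lemma big_chunk_pair L : big_chunk adj L -> ~ (3 <= #|L|) ->
  exists a b, adj a b /\ L = [set a; b].
Proof.
move=> bL n3; have c2 := big_chunk_card bL.
have /cards2P [a [b [ab eL]]] : #|L| == 2 by lia.
exists a, b; split=> //; have [[_ [kL _]] _] := bL.
have [||/eqP/eqP//|z] := @connected_nbr L a b kL; rewrite ?eL ?inE ?eqxx ?orbT //; first exact/eqP.
by case/orP=> /eqP -> //; rewrite adj_irr.
Qed.

Lemma big_chunk_nbr L v : big_chunk adj L -> v \in L -> exists2 w, w \in L & adj v w.
Proof.
move=> bL vL; have [[_ [kL _]] _] := bL.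
have [w] : exists w, w \in L :\ v.
  by apply/set0Pn; rewrite -card_gt0; have := cardsD1 v L; rewrite vL;
    have := big_chunk_card bL; lia.
rewrite in_setD1 => /andP [/eqP wv wL].
by apply: (connected_nbr kL vL wL) => /esym.
Qed.

Lemma large_chunk_nbrs L v : big_chunk adj L -> 3 <= #|L| -> v \in L -> two_nbrs v.
Proof.
move=> bL L3 vL; have [w wL vw] := big_chunk_nbr bL vL.
have [u] : exists u, u \in L :\ v :\ w.
  apply/set0Pn; rewrite -card_gt0; have := cardsD1 v L; have := cardsD1 w (L :\ v).
  rewrite vL; case: (w \in _) => /=; lia.
rewrite !in_setD1 => /and3P [uw uv uL].
have [w' w'L vw'] : exists2 z, z \in L :\ w & adj v z.
  apply: (connected_nbr (w := u) (chunk_remove (proj1 bL) wL)).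
  - by rewrite in_setD1 vL andbT; apply/eqP/adj_neq.
  - by rewrite in_setD1 uw.
  - by move=> e; move: uv; rewrite e eqxx.
exists w, w'; split=> // e; by move: w'L; rewrite e in_setD1 eqxx.
Qed.

Lemma valence1 a b : adj b a -> ~ two_nbrs b -> #|[set x | adj b x]| = 1.
Proof.
move=> ba no; apply/eqP/cards1P; exists a; apply/setP => x; rewrite !inE.
apply/idP/eqP => [bx|-> //]; apply: NNPP => xa; apply: no; by exists x, a.
Qed.

Lemma leaf_tip L a b x : leaf_of adj L a b -> adj b x -> x = a.
Proof.
move=> [_ [ab /eqP/cards1P [y ey]]] bx.
have : a \in [set x | adj b x] by rewrite inE adj_sym.
have : x \in [set x | adj b x] by rewrite inE.
by rewrite ey !inE => /eqP -> /eqP ->.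
Qed.

Lemma leaf_base L a b : leaf_of adj L a b -> two_nbrs a.
Proof.
move=> lf; have [_ [ab _]] := lf; apply: NNPP => no.
have [c [ca cb]] := third_vertex a b.
have [//|//] : c = a \/ c = b.
apply: (@closed_all (fun z => z = a \/ z = b) a) => [x y xy [ex|ex]|]; last by left.
- right; apply: NNPP => yb; apply: no; exists y, b; split=> //; by rewrite -ex.
- left; apply: leaf_tip lf _; by rewrite -ex.
Qed.

Lemma leaf_tip_nbrs L a b : leaf_of adj L a b -> ~ two_nbrs b.
Proof.
by move=> lf [w [w' [/(leaf_tip lf) -> /(leaf_tip lf) ->]]].
Qed.

(** With a third vertex present the base has two neighbours and the tip only one, so they cannot
    exchange roles. *)
Lemma leaf_unique L a b a' b' : leaf_of adj L a b -> leaf_of adj L a' b' ->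
  a = a' /\ b = b'.
Proof.
move=> lf lf'; have [eL [ab _]] := lf; have [eL' [ab' _]] := lf'.
have : a' \in L by rewrite eL' !inE eqxx.
rewrite eL !inE => /orP [/eqP e|/eqP e]; last first.
  by case: (leaf_tip_nbrs lf); rewrite -e; apply: leaf_base lf'.
split=> //.
have : b' \in L by rewrite eL' !inE eqxx orbT.
rewrite eL !inE => /orP [/eqP e'|/eqP //].
by case: (adj_neq ab'); rewrite e e'.
Qed.

Lemma leaf_big_chunk a b : leaf_of adj [set a; b] a b -> big_chunk adj [set a; b].
Proof.
move=> lf; have [_ [ab _]] := lf.
split=> [|S sS cS]; first exact: edge_chunk_like.
have [aS bS] : a \in S /\ b \in S by split; apply: (subsetP sS); rewrite !inE eqxx ?orbT.
apply/eqP; rewrite eqEsubset sS andbT; apply/subsetP => z zS; rewrite !inE.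
apply: contraT; rewrite negb_or => /andP [/eqP za /eqP zb].
have [|||w] := connected_nbr (v := b) (w := z) (chunk_remove cS aS).
- by rewrite in_setD1 bS andbT; apply/eqP => e; apply: (adj_neq ab).
- by rewrite in_setD1 zS andbT; apply/eqP.
- by move/esym.
by rewrite in_setD1 => /andP [/eqP wa _] /(leaf_tip lf).
Qed.

Lemma separated_nbr v x : x <> v -> exists2 w, adj v w & conn [set~ v] x w.
Proof.
move=> xv; apply: NNPP => no.
have h : conn [set~ v] x v.
  apply: (@closed_all (fun z => conn [set~ v] x z) x); last exact: connect0.
  move=> y z yz xy; have yv : y <> v.
    apply: (@connect_closed _ (fun z => z <> v) _ _ _ xy xv) => a b /and3P [_ _].
    by rewrite !inE => /eqP.
  case: (eqVneq z v) => [zv|zv].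
    by case: no; exists y => //; rewrite adj_sym -zv.
  apply: connect_trans xy _; apply: connect1; rewrite /inrel /= yz !inE zv andbT.
  exact/eqP.
have : v <> v; last by [].
apply: (@connect_closed _ (fun z => z <> v) _ _ _ h xv) => a b /and3P [_ _].
by rewrite !inE => /eqP.
Qed.

Lemma separating_nbrs v : separating adj v -> exists w w',
  [/\ adj v w, adj v w' & ~ conn [set~ v] w w'].
Proof.
move=> [_ nc]; apply: NNPP => no; apply: nc => x y; rewrite !in_setD1 !in_setT !andbT => xv yv.
have e : [set: V] :\ v = [set~ v] by apply/setP => z; rewrite !inE andbT.
move/eqP: xv => xv; move/eqP: yv => yv.
have [w vw xw] := separated_nbr xv; have [w' vw' yw'] := separated_nbr yv.
have ww : conn [set~ v] w w' by apply: NNPP => h; apply: no; exists w, w'.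
rewrite e; apply: connect_trans xw _; apply: connect_trans ww _.
by rewrite conn_sym.
Qed.

Lemma separating_two_nbrs v : separating adj v -> two_nbrs v.
Proof.
move=> /separating_nbrs [w [w' [vw vw' nc]]]; exists w, w'; split=> // e.
by apply: nc; rewrite e connect0.
Qed.

(** If deleting [v] left the graph connected, the two chunks would be joined off [v] and hence be
    equal. *)
Lemma two_chunks_separating L L' v : big_chunk adj L -> big_chunk adj L' ->
  v \in L -> v \in L' -> L <> L' -> separating adj v.
Proof.
move=> bL bL' vL vL' ne; split=> // cV; apply: ne.
have [x xL vx] := big_chunk_nbr bL vL; have [y yL vy] := big_chunk_nbr bL' vL'.
have xv : x <> v by move/esym; apply: adj_neq.
have yv : y <> v by move/esym; apply: adj_neq.
apply: (big_chunk_unique bL bL' vL vL' xL xv yL yv).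
have e : [set: V] :\ v = [set~ v] by apply/setP => z; rewrite !inE andbT.
by rewrite -e; apply: cV; rewrite in_setD1 in_setT andbT; apply/eqP.
Qed.

End Connected.
End Graph.

(** * Ellipticity of the vertex groups *)

Section Artin.
Variables (V : finType) (adj : rel V) (m : V -> V -> nat) (G : Grp) (gen : V -> G).
Hypothesis adj_sym : symmetric adj.
Hypothesis adj_irr : irreflexive adj.
Hypothesis m_sym : forall a b, adj a b -> m a b = m b a.
Hypothesis m_ge2 : forall a b, adj a b -> 2 <= m a b.
Hypothesis gconn : connected_in adj [set: V].
Hypothesis card3 : 3 <= #|V|.
Hypothesis pres : artin_presentation adj m gen.
Implicit Types (u v w a b : V) (L S : {set V}).

Lemma gen_braid a b : adj a b -> alt (gen a) (gen b) (m a b) = alt (gen b) (gen a) (m a b).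
Proof. by case: pres => h _; apply: h. Qed.

Lemma gens_neq u v s t : u <> v -> gzpow (gen u) s = gzpow (gen v) t -> s = 0%Z.
Proof. exact: (gen_zpow_neq adj_sym adj_irr m_sym m_ge2 pres). Qed.

Lemma gen_infinite v : infinite_order (gen v).
Proof.
move=> k e; have [c [cv _]] := third_vertex card3 v v.
by apply: (@gens_neq v c k 0) => // /esym.
Qed.

Lemma edge_central_neq v w w' s t s' t' : adj v w -> w' <> w ->
  gzpow (gen v) s ** gzpow (alt (gen v) (gen w) (m v w).*2) t =
  gzpow (gen v) s' ** gzpow (alt (gen v) (gen w') (m v w').*2) t' -> t = 0%Z.
Proof. exact: (central_neq adj_sym adj_irr m_sym m_ge2 pres). Qed.

Lemma edge_central_free v w s t : adj v w ->
  gzpow (gen v) s ** gzpow (alt (gen v) (gen w) (m v w).*2) t = gone -> t = 0%Z.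
Proof.
move=> vw e; have [c [cw _]] := third_vertex card3 w w.
by apply: (@edge_central_neq v w c s t 0 0) => //; rewrite e /= gmul1.
Qed.

Lemma gens_conj_neq a b s t : adj a b -> 3 <= m a b ->
  gzpow (gen a) s ** gen b = gen b ** gzpow (gen a) t -> s = 0%Z.
Proof. exact: (gen_conj_neq adj_sym adj_irr m_sym m_ge2 pres). Qed.

Lemma zelt_even a b : ~~ odd (m a b) ->
  zelt m gen a b = alt (gen a) (gen b) (m a b) /\
  zelt m gen a b = gpow (gen a ** gen b) (m a b)./2.
Proof.
move=> ev; rewrite /zelt (negbTE ev); split=> //.
rewrite -{1}(even_halfK ev); exact: alt_double.
Qed.

Lemma zelt_comm a b : adj a b -> ~~ odd (m a b) ->
  gcomm (gen a) (zelt m gen a b) /\ gcomm (gen b) (zelt m gen a b).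
Proof.
move=> ab ev; have [-> _] := zelt_even ev.
exact: (braid_even_commutes (gen_braid ab)).
Qed.

(** For an even label the alternating word of length [2m] is the square of [zelt]; squaring the
    relation reduces it to the excluded one. *)
Lemma zelt_free a b s t : adj a b -> ~~ odd (m a b) ->
  gzpow (gen a) s ** gzpow (zelt m gen a b) t = gone -> t = 0%Z.
Proof.
move=> ab ev e; have [ca _] := zelt_comm ab ev; have [ze _] := zelt_even ev.
apply: (@edge_central_free a b (2 * s) t ab).
rewrite (alt_doubleE (gen_braid ab)) -ze gzpowMn // (Z.mul_comm 2) gzpowM.
set x := gzpow (gen a) s in e *; set y := gzpow (zelt m gen a b) t in e *.
by rewrite -[2%Z]/(1 + 1)%Z gzpowD gzpow_one -gmulA (gmulA x y y) e gmul1.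
Qed.

(** The black group is a disjunction over all ways of reading [L] as a leaf. Base and tip being
    unique, only one clause survives; the next two lemmas treat the other cases. *)
Lemma Jblack_toral L a b g : toral_leaf adj m L a b ->
  Jvgroup adj m gen (JBlack L) g <-> gsub (fun x => x = gen a) g.
Proof.
move=> [lf e]; split=> [|h]; last by left; exists a, b.
move=> /= [[a' [b' [[lf' _]]]]|[[a' [b' [[lf' [_ e']] _]]]|[ne _]]].
- by have [-> _] := leaf_unique adj_sym adj_irr gconn card3 lf lf'.
- have [ea eb] := leaf_unique adj_sym adj_irr gconn card3 lf lf'.
  by rewrite -ea -eb e in e'.
- by case: ne; exists a, b; rewrite e.
Qed.

Lemma Jblack_braided L a b g : braided_leaf adj m L a b ->
  Jvgroup adj m gen (JBlack L) g <->
  gsub (fun x => x = gen a \/ x = zelt m gen a b) g.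
Proof.
move=> bl; have [lf [ev e]] := bl; split=> [|h]; last by right; left; exists a, b.
move=> /= [[a' [b' [[lf' e']]]]|[[a' [b' [[lf' _]]]]|[ne _]]].
- have [ea eb] := leaf_unique adj_sym adj_irr gconn card3 lf lf'.
  by rewrite ea eb e' in e.
- by have [-> ->] := leaf_unique adj_sym adj_irr gconn card3 lf lf'.
- by case: ne; exists a, b.
Qed.

Lemma Jblack_other L g : ~ even_leaf adj m L ->
  Jvgroup adj m gen (JBlack L) g <-> gsub (fun x => exists v, v \in L /\ x = gen v) g.
Proof.
move=> ne; split=> [|h]; last by right; right.
move=> /= [[a' [b' [[lf' e']]]]|[[a' [b' [[lf' [ev _]]]]]|[_ //]]].
- by case: ne; exists a', b'; rewrite e'.
- by case: ne; exists a', b'.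
Qed.

Lemma leaf_cases L : (exists a b, toral_leaf adj m L a b) \/
  (exists a b, braided_leaf adj m L a b) \/ ~ even_leaf adj m L.
Proof.
case: (classic (even_leaf adj m L)) => [[a [b [lf ev]]]|]; last by right; right.
have m2 := m_ge2 (proj1 (proj2 lf)).
have [e|e] : m a b = 2 \/ 4 <= m a b by move: m2 ev; case: (m a b) => [|[|[|[|]]]] //; auto.
- by left; exists a, b.
- by right; left; exists a, b.
Qed.

Lemma Jvgroup_subgroup (u : JV V) : is_subgroup (Jvgroup adj m gen u).
Proof.
have ext H H' : (forall g : G, H g <-> H' g) -> is_subgroup H' -> is_subgroup H.
  move=> e [h1 [h2 h3]]; split; [exact/e|split] => [x y /e hx /e hy|x /e hx]; apply/e.
  - exact: h2.
  - exact: h3.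
case: u => [v|L|a b]; try exact: gsub_subgroup.
have [[a [b h]]|[[a [b h]]|h]] := leaf_cases L.
- by apply: (ext _ _ (fun g => Jblack_toral g h)); apply: gsub_subgroup.
- by apply: (ext _ _ (fun g => Jblack_braided g h)); apply: gsub_subgroup.
- by apply: (ext _ _ (fun g => Jblack_other g h)); apply: gsub_subgroup.
Qed.

Section Elliptic.
Variable T : GTree G.
Hypothesis vcT : VC_tree T.
Let hT := proj1 vcT.
Local Notation "g %* x" := (tact T g x) (at level 38, right associativity).
Local Notation B := (between (Gtree_tree hT)).
Local Notation d := (dist (Gtree_tree hT)).

Lemma edge_commensurable x y g h : tadj T x y -> infinite_order g -> infinite_order h ->
  g %* x = x -> g %* y = y -> h %* x = x -> h %* y = y ->
  exists s t, s <> 0%Z /\ t <> 0%Z /\ gzpow g s = gzpow h t.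
Proof.
move=> xy ig ih gx gy hx hy.
apply: (virtually_cyclic_commensurable (proj2 vcT _ _ xy)) => // n; split;
  exact: (subgroup_pow _ (stab_subgroup hT _)).
Qed.

Lemma axial_edge g x : axial hT g x -> exists y,
  [/\ tadj T x y, B x y (g %* x) & forall h, h %* x = x -> gcomm h g -> h %* y = y].
Proof.
move=> ax; have l0 := axial_dist_gt0 ax.
have [y b dy] := between_point l0; exists y; split=> //; first exact: adj_dist dy.
move=> h hx c; apply: (fix_between hx _ b); by rewrite tact_comm ?hx.
Qed.

(* A hyperbolic v would make v^i c^j and v^i' c'^j' fix a common edge, where c and c' are
   the central elements attached to two neighbours of v. *)
Lemma two_nbrs_elliptic v : two_nbrs adj v -> exists x, gen v %* x = x.
Proof.
move=> [w [w' [vw vw' ww']]]; apply: NNPP => no.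
have [x ax] : exists x, axial hT (gen v) x.
  by apply: axial_exists => x e; apply: no; exists x.
have [y [xy by_ fy]] := axial_edge ax.
have H u : adj v u -> exists i j, let k := gzpow (gen v) i **
    gzpow (alt (gen v) (gen u) (m v u).*2) j in
    [/\ j <> 0%Z, infinite_order k, k %* x = x, k %* y = y &
     gcomm (gen v) (alt (gen v) (gen u) (m v u).*2)].
  move=> vu; have [c _] := braid_commutes (gen_braid vu).
  have [i [j [j0 fx]]] := centralizer_axis ax c.
  exists i, j; split=> //.
  - move=> k; rewrite gzpowMn; last exact: gcommZZ.
    by rewrite -!gzpowM => /(edge_central_free vu); nia.
  - apply: fy => //; apply: gcomm_sym; apply: gcommM; first exact: gcommZ.
    exact: gcommZ.
have [i [j [j0 ik kx ky c]]] := H _ vw; have [i' [j' [j0' ik' kx' ky' c']]] := H _ vw'.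
have [s [t [s0 [t0 e]]]] := edge_commensurable xy ik ik' kx ky kx' ky'.
move: e; rewrite !gzpowMn; try exact: gcommZZ.
rewrite -!gzpowM => /(edge_central_neq vw); move/(_ (fun h => ww' (esym h))); nia.
Qed.

Lemma edge_elliptic a b x y : adj a b -> gen a %* x = x -> gen b %* y = y ->
  exists z, gen a %* z = z /\ gen b %* z = z.
Proof.
move=> ab ax by_; apply: (@elliptic_pair _ _ hT _ _ (m a b) x y) => //.
  by have := m_ge2 ab; lia.
rewrite -alt_double; have ba : adj b a by rewrite adj_sym.
by have [_] := braid_commutes (gen_braid ba); rewrite -(m_sym ab).
Qed.

(* The generators of L fixing an edge [x, y] of T number at most one, so deleting them does
   not disconnect L; hence the fixed sets of the others all lie on one side of that edge. *)
Lemma large_chunk_elliptic L : big_chunk adj L -> 3 <= #|L| ->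
  exists x, forall v, v \in L -> gen v %* x = x.
Proof.
move=> bL L3.
have ell v : v \in L -> exists x, gen v %* x = x.
  move=> vL; apply: two_nbrs_elliptic.
  exact: (large_chunk_nbrs adj_sym adj_irr gconn card3 bL L3 vL).
have edge v w : v \in L -> w \in L -> adj v w -> exists z, gen v %* z = z /\ gen w %* z = z.
  move=> vL wL vw; have [x ex] := ell _ vL; have [y ey] := ell _ wL.
  exact: edge_elliptic vw ex ey.
have [/set0Pn [u uL] [kL _]] := proj1 bL.
(* Two generators fixing [x] are provided, so that one is left when the generator fixing the edge is
   deleted. *)
have [u' u'L uu'] := big_chunk_nbr adj_sym adj_irr gconn card3 bL uL.
have [x [xu xu']] := edge _ _ uL u'L uu'.
exists x => v vL; apply: NNPP => nvx.
have [f vf] := ell _ vL.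
have xf : 0 < d x f.
  by rewrite lt0n; apply/eqP => /tdist_eq0 e; apply: nvx; rewrite e.
have [y bf dy] := between_point xf.
have xy : tadj T x y by apply: adj_dist dy.
have E_unique w w' : gen w %* x = x -> gen w %* y = y ->
    gen w' %* x = x -> gen w' %* y = y -> w = w'.
  move=> h1 h2 h3 h4; apply: NNPP => ww'.
  have [s [t [s0 [_ e]]]] := edge_commensurable xy (@gen_infinite w) (@gen_infinite w') h1 h2 h3 h4.
  exact/s0/(gens_neq ww' e).
have main S w0 : S \subset L -> connected_in adj S -> v \in S -> w0 \in S ->
    gen w0 %* x = x -> (forall w, w \in S -> gen w %* x = x -> gen w %* y = y -> False) -> False.
  move=> /subsetP SL cS vS w0S w0x noE.
  (* The property propagated along [S] is having a fixed point on the side of [x]. If it failed to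
     pass to a neighbour, the generator left behind would fix points on both sides and so the
     edge. *)
  have [p [vp np]] : exists p, gen v %* p = p /\ ~ B x y p.
    apply: (@connect_closed _ _ (fun w => exists p, gen w %* p = p /\ ~ B x y p)
      _ _ _ (cS _ _ w0S vS)).
    - move=> a b /and3P [ab aS bS] [p [ap np]].
      have [q [aq bq]] := edge _ _ (SL _ aS) (SL _ bS) ab.
      exists q; split=> // Bq; have [h1 h2] := separated_by_edge dy np Bq ap aq.
      exact: noE aS h1 h2.
    - exists x; split=> // bx; move: dy; rewrite (between_xx bx) dist_xx; lia.
  have [h _] := separated_by_edge dy np bf vp vf; exact: nvx.
case: (classic (exists2 w, w \in L & gen w %* x = x /\ gen w %* y = y)) => [[e eL [ex ey]]|no].
- have [w0 w0S w0x] : exists2 w0, w0 \in L :\ e & gen w0 %* x = x.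
    case: (eqVneq u e) => [ue|ue]; last by exists u; rewrite ?in_setD1 ?ue.
    exists u' => //; rewrite in_setD1 u'L andbT -ue; apply/eqP => h.
    by apply: (adj_neq adj_irr uu').
  apply: (main (L :\ e) w0) => //.
  + exact: subD1set.
  + exact: chunk_remove (proj1 bL) eL.
  + by rewrite in_setD1 vL andbT; apply/eqP => ve; apply: nvx; rewrite ve.
  + move=> w; rewrite in_setD1 => /andP [/eqP we wL] wx wy; apply: we.
    exact: E_unique.
- apply: (main L u) => // w wL wx wy; apply: no; by exists w.
Qed.

(** If [z] were hyperbolic, the elliptic elements [a] and [b a b^-1], which commute with it, would
    fix its axis. Lying in one virtually cyclic edge stabiliser, they would satisfy
    [a^s = b a^t b^-1] with [s] nonzero, which the representation excludes for [m >= 3]. So [a] and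
    [z] are commuting elliptic elements. *)
Lemma braided_elliptic L a b : braided_leaf adj m L a b ->
  exists x, gen a %* x = x /\ zelt m gen a b %* x = x.
Proof.
move=> [lf [ev m4]]; have ab := proj1 (proj2 lf).
have [ca cb] := zelt_comm ab ev; set z := zelt m gen a b in ca cb *.
have [y ay] := two_nbrs_elliptic (leaf_base adj_sym gconn card3 lf).
have [y' zy'] : exists y', z %* y' = y'.
  apply: NNPP => no.
  have [x ax] : exists x, axial hT z x.
    by apply: axial_exists => x e; apply: no; exists x.
  have [w [xw bw _]] := axial_edge ax; have [_ dw _] := axial_shift ax bw.
  have fixa (u : tv T) : d u (z %* u) <= d x (z %* x) -> gen a %* u = u.
    exact: (commuting_elliptic_fixes_axis ax ca ay).
  have fixb (u : tv T) : d u (z %* u) <= d x (z %* x) -> (gen b ** gen a ** (gen b)^-1) %* u = u.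
    move=> le; rewrite -!(tactM hT).
    have cbV : gcomm z (gen b)^-1 by apply/gcommV/gcomm_sym.
    by rewrite fixa ?(tactVK hT) // (tact_comm hT _ cbV) dist_act.
  have ib : infinite_order (gen b ** gen a ** (gen b)^-1).
    move=> k; rewrite gzpow_conj => e; apply: (@gen_infinite a).
    apply: (@gmulI _ (gen b)); apply: (@gmulIr _ (gen b)^-1); rewrite e; by grp.
  have [s [t [s0 [_ e]]]] := edge_commensurable xw (@gen_infinite a) ib
    (fixa x (leqnn _)) (fixa w (eq_leq dw)) (fixb x (leqnn _)) (fixb w (eq_leq dw)).
  apply/s0/(@gens_conj_neq a b s t ab); first lia.
  by rewrite e gzpow_conj; grp.
apply: (@elliptic_pair _ _ hT _ _ 1 y y') => //=; rewrite gmulg1.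
exact: gcommM.
Qed.

Lemma Jvgroup_elliptic (u : JV V) : Jvalid adj m u -> elliptic (Jvgroup adj m gen u) T.
Proof.
case: u => [v sv|L bL|a b [_ bl]].
- have [x ex] := two_nbrs_elliptic (separating_two_nbrs adj_sym gconn sv).
  by exists x; apply: (gsub_fix hT) => g ->.
- have [[a [b tl]]|[[a [b bl]]|ne]] := leaf_cases L.
  + have [x ex] := two_nbrs_elliptic (leaf_base adj_sym gconn card3 (proj1 tl)).
    exists x => g /(Jblack_toral _ tl); apply: (gsub_fix hT) => h ->; exact: ex.
  + have [x [ax zx]] := braided_elliptic bl.
    by exists x => g /(Jblack_braided _ bl); apply: (gsub_fix hT) => h [->|->].
  + have [x fx] : exists x, forall v, v \in L -> gen v %* x = x; last first.
      exists x => g /(Jblack_other _ ne); apply: (gsub_fix hT) => h [v [vL ->]].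
      exact: fx.
    case: (boolP (3 <= #|L|)) => L3; first exact: large_chunk_elliptic.
    have [a [b [ab eL]]] := big_chunk_pair adj_sym adj_irr gconn card3 bL (elimN idP L3).
    suff [x [hx hy]] : exists x, gen a %* x = x /\ gen b %* x = x.
      by exists x => v; rewrite eL !inE => /orP [/eqP ->|/eqP ->].
    have ba : adj b a by rewrite adj_sym.
    (* If [e] is a tip, its label is odd because [L] is not an even leaf, and the half twist
       conjugates the elliptic [gen c] to [gen e]. *)
    have leaf c e : adj c e -> L = [set c; e] -> two_nbrs adj c -> exists x, gen e %* x = x.
      move=> ce eL' nc; case: (classic (two_nbrs adj e)) => [/two_nbrs_elliptic //|nb].
      have lf : leaf_of adj L c e.
        by split=> //; split=> //; apply: (valence1 (a := c)); rewrite // adj_sym.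
      have od : odd (m c e) by apply: contraT => ev; case: ne; exists c, e.
      have [y ey] := two_nbrs_elliptic nc.
      exists ((alt (gen c) (gen e) (m c e))^-1 %* y).
      by rewrite {1}(braid_odd_conj (gen_braid ce) od) -!(tactM hT) (tactVK hT) ey.
    have eL' : L = [set b; a] by rewrite eL setUC.
    case: (classic (two_nbrs adj a)) => [na|na].
      have [x ex] := two_nbrs_elliptic na; have [y ey] := leaf _ _ ab eL na.
      exact: edge_elliptic ab ex ey.
    have nb : two_nbrs adj b.
      apply: (leaf_base adj_sym gconn card3 (L := L) (b := a)).
      by split=> //; split=> //; apply: (valence1 (a := b)).
    have [x ex] := two_nbrs_elliptic nb; have [y ey] := leaf _ _ ba eL' nb.
    exact: edge_elliptic ab ey ex.
- have [x [_ zx]] := braided_elliptic bl; have [lf [ev m4]] := bl.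
  have [_ ze] := zelt_even ev; rewrite ze in zx.
  (* A power of [ab] is the elliptic [z_ab], and roots of elliptic elements are elliptic. *)
  have [y ey] : exists y, (gen a ** gen b) %* y = y.
    apply: (elliptic_root hT _ zx); lia.
  by exists y; apply: (gsub_fix hT) => g ->.
Qed.

End Elliptic.
End Artin.

(** * Bridges and cocycles *)

Section Bridges.
Variables (X : Type) (e : X -> X -> Prop).
Hypothesis e_sym : forall x y, e x y -> e y x.
Hypothesis e_conn : forall x y, exists p, walk e x p y.

(** [P] is one side of the cut; a set of vertices is the form in which the half-spaces below
    arise. *)
Definition bridge x y := exists P : X -> Prop, ~ (P x <-> P y) /\
  forall p q, e p q -> ~ (P p <-> P q) -> p = x /\ q = y \/ p = y /\ q = x.

Hypothesis e_bridge : forall x y, e x y -> bridge x y.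

Lemma walk_crossing (P : X -> Prop) x p y : walk e x p y -> ~ (P x <-> P y) ->
  exists p1 u w p2, [/\ p = p1 ++ w :: p2, walk e x p1 u, e u w & ~ (P u <-> P w)].
Proof.
elim: p x => [|z p IH] x /=; first by move=> -> [].
move=> [xz h] nP; case: (classic (P x <-> P z)) => [eP|nxz]; last by exists nil, x, z, p.
have [|p1 [u [w [p2 [-> h1 h2 h3]]]]] := IH z h; first by rewrite -eP.
by exists (z :: p1), u, w, p2.
Qed.

(** The first edge is a bridge and has to be crossed again. If in the same direction, the part
    before the second crossing is a shorter reduced cycle; if in the opposite direction, the part in
    between is one, or it is empty and the walk backtracks. *)
Lemma no_reduced_cycle p x : walk e x p x -> nobacktrack x p -> p = nil.
Proof.
elim: {p}_.+1 {-2}p x (ltnSn (size p)) => // n IH p x.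
case: p => [|z p] // sp [xz h] nb; exfalso.
have [P [nP cross]] := e_bridge xz.
have [|p1 [u [w [p2 [ep h1 uw nuw]]]]] := walk_crossing h (P := P).
  by move=> [h1 h2]; apply: nP.
have nzp : nobacktrack z p by case: p nb {sp h ep} => // v p [].
have sz : size p = size p1 + (size p2).+1 by rewrite ep size_cat.
case: (cross _ _ uw nuw) => [[eu ew]|[eu ew]]; subst u w p.
- have : z :: p1 = nil; last by [].
  apply: (IH _ x) => //=; first by move: sp sz => /=; lia.
  exact: (@nobacktrack_catl _ x (z :: p1) (z :: p2)).
- case: p1 nb h1 nzp sz sp {h} => [[]//|v p1] nb h1 nzp sz sp.
  have : v :: p1 = nil; last by [].
  apply: (IH _ z) => //=; first by move: sp sz => /=; lia.
  exact: nobacktrack_catl nzp.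
Qed.

Lemma bridge_tree : is_tree e.
Proof.
have uniq x y p q : reduced_walk e x p y -> reduced_walk e x q y -> q = p.
  move=> [wp np] [wq nq].
  have [c [p' [q' [e1 e2 h]]]] := common_prefix p q; subst p q.
  move/walk_cat: wp => [m [w1 w2]]; move/walk_cat: wq => [m' [w1' w2']].
  rewrite (walk_last w1') -(walk_last w1) in w2' => {m' w1'}.
  have n1 := nobacktrack_catr w1 np; have n2 := nobacktrack_catr w1 nq.
  congr (_ ++ _); case: h => [h|[h|[a [b [s [t [ab ep eq]]]]]]].
  - subst p'; move: w2 => /= mY; rewrite -mY in w2'; exact: no_reduced_cycle w2' n2.
  - subst q'; move: w2' => /= mY; rewrite -mY in w2; exact/esym/(no_reduced_cycle w2).
  - subst p'; have W : walk e y (rev_walk m (a :: s) ++ q') y.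
      by apply/walk_cat; exists m; split=> //; apply: walk_rev.
    suff /(no_reduced_cycle W) : nobacktrack y (rev_walk m (a :: s) ++ q').
      by subst q'; move/(congr1 size); rewrite size_cat /= addnS.
    have := nobacktrack_rev e_sym w2 n1; subst q'; rewrite /= -catA => nr.
    case: w2 => [ma w2].
    apply: (nobacktrack_splice (walk_rev e_sym w2)) => //=.
    by split=> // /esym.
move=> x y; have [p0 w0] := e_conn x y; have [p [wp np _ _ _]] := walk_reduce w0.
by exists p; split=> // q; apply: uniq.
Qed.

End Bridges.

(** * Boolean cocycles and the semidirect product *)

Section Cocycles.
Variable G : Grp.

Definition twist_mul (s t : (G -> bool) * G) : (G -> bool) * G :=
  (fun x => s.1 x (+) t.1 (x ** s.2), s.2 ** t.2).

Program Definition twist : Grp := @Build_Grp ((G -> bool) * G) twist_mul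
  (fun s => (fun x => s.1 (x ** s.2^-1), s.2^-1)) (fun=> false, gone) _ _ _.
Next Obligation.
rewrite /twist_mul /=; congr pair; last exact: gmulA.
by apply: functional_extensionality => x /=; rewrite addbA gmulA.
Qed.
Next Obligation.
rewrite /twist_mul /= gmul1; congr pair.
by apply: functional_extensionality => y /=; rewrite gmulg1.
Qed.
Next Obligation.
rewrite /twist_mul /= gmulV; congr pair.
by apply: functional_extensionality => y /=; rewrite addbb.
Qed.

(* The section g |-> (0, g) of the semidirect product, conjugated by (t, 1). *)
Definition tsec (t : G -> bool) (g : G) : twist := (fun x => t x (+) t (x ** g), g).

Lemma tsec_hom t : group_hom (tsec t).
Proof.
move=> g h; rewrite /tsec /= /twist_mul /=; congr pair.
apply: functional_extensionality => x; rewrite -gmulA.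
by case: (t x); case: (t (x ** g)); case: (t _).
Qed.

Definition zsec : G -> twist := tsec (fun=> false).

(** The gluing condition: where both sections agree, a generator may be counted with either, so
    relations can be verified inside one homomorphism at a time. *)
Lemma tsec_zsec t g : (forall x, t (x ** g) = t x) -> tsec t g = zsec g.
Proof.
by move=> h; congr pair; apply: functional_extensionality => x; rewrite h addbb.
Qed.

Definition indic (C : G -> Prop) (x : G) : bool :=
  if excluded_middle_informative (C x) then true else false.

Lemma indicP C x : indic C x <-> C x.
Proof. by rewrite /indic; case: excluded_middle_informative. Qed.

Lemma indic_one C : is_subgroup C -> indic C gone.
Proof. by move=> [h _]; apply/indicP. Qed.

Lemma indic_right C c x : is_subgroup C -> C c -> indic C (x ** c) = indic C x.
Proof.
move=> [_ [hM hV]] Cc; apply/idP/idP => /indicP h; apply/indicP; last exact: hM.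
by have := hM _ _ h (hV _ Cc); rewrite -gmulA gmulVV gmulg1.
Qed.

Lemma right_invariant_gsub (F : G -> bool) (S : G -> Prop) :
  (forall s, S s -> forall g, F (g ** s) = F g) ->
  forall h, gsub S h -> forall g, F (g ** h) = F g.
Proof.
move=> H; apply: gsub_min => //; split; [|split].
- by move=> g; rewrite gmulg1.
- by move=> x y hx hy g; rewrite gmulA hy hx.
- by move=> x hx g; rewrite -(hx (g ** x^-1)) -gmulA gmulV gmulg1.
Qed.

(* A function on G is determined by its increments along the generators, and these may be
   prescribed freely up to the defining relations: evaluate the cocycle at 1. *)
Lemma integrate_cocycle (V : finType) (adj : rel V) (m : V -> V -> nat) (gen : V -> G)
  (dl : V -> G -> bool) : artin_presentation adj m gen ->
  artin_relations adj m (fun v => (dl v, gen v) : twist) ->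
  exists F : G -> bool, forall v g, F (g ** gen v) = F g (+) dl v g.
Proof.
move=> [_ [hgen huniv]] hrel.
have [phi [hphi ephi]] := huniv _ _ hrel.
have h2 g : (phi g).2 = g.
  move: g (hgen g); apply: gsub_min => [|x [v ->]]; last by rewrite ephi.
  split; [|split].
  - by rewrite (hom_one hphi).
  - by move=> x y hx hy; rewrite hphi /= hx hy.
  - by move=> x hx; rewrite (hom_inv _ hphi) /= hx.
exists (fun g => (phi g).1 gone) => v g.
by rewrite hphi /= ephi /= h2 gmul1.
Qed.

End Cocycles.

(** * Half-spaces of the Bass-Serre graph *)

Section Cosets.
Variable G : Grp.
Implicit Types (g h : G) (H : G -> Prop).

Lemma coset_eq g g' H : is_subgroup H -> coset g H = coset g' H <-> H (g^-1 ** g').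
Proof.
move=> [h1 [hM hV]]; split=> [e|h].
- have : coset g' H g' by exists gone; rewrite gmulg1.
  by rewrite -e => -[k [Hk ->]]; rewrite gmulK.
- apply: functional_extensionality => x; apply: propositional_extensionality; split.
  + move=> [k [Hk ->]]; exists ((g^-1 ** g')^-1 ** k); split; last by grp.
    by apply: hM => //; apply: hV.
  + move=> [k [Hk ->]]; exists (g^-1 ** g' ** k); split; last by grp.
    exact: hM.
Qed.

End Cosets.

Section BassSerre.
Variables (V : finType) (adj : rel V) (m : V -> V -> nat) (G : Grp) (gen : V -> G).
Hypothesis adj_sym : symmetric adj.
Hypothesis adj_irr : irreflexive adj.
Hypothesis m_sym : forall a b, adj a b -> m a b = m b a.
Hypothesis m_ge2 : forall a b, adj a b -> 2 <= m a b.
Hypothesis gconn : connected_in adj [set: V].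
Hypothesis card3 : 3 <= #|V|.
Hypothesis pres : artin_presentation adj m gen.
Implicit Types (v w a b : V) (L : {set V}) (g h : G) (u : JV V) (e : JE V).

Local Notation X := (BSv adj m gen).
Local Notation Xadj := (@BSadj V adj m G gen).
Local Notation H := (Jvgroup adj m gen).
Local Notation valid := (Jvalid adj m).
Local Notation evalid := (Evalid adj m).
Local Notation stable := (Estable gen).
Local Notation zz := (zelt m gen).
Implicit Types (p q : X).

Lemma H_subgroup u : is_subgroup (H u).
Proof. exact: Jvgroup_subgroup. Qed.

Definition bsv u g (hu : valid u) : X :=
  exist _ (u, coset g (H u)) (conj hu (ex_intro _ g erefl)).

Lemma BSv_ext (p q : X) : sval p = sval q -> p = q.
Proof.
case: p => p hp; case: q => q hq /= e; subst q; congr exist.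
exact: proof_irrelevance.
Qed.

Lemma BSv_cases (p : X) : exists u g (hu : valid u), p = bsv g hu.
Proof.
case: p => -[u C] h; have [hu [g hC]] := h; exists u, g, hu.
by apply: BSv_ext; move: hC => /= ->.
Qed.

Lemma bsv_eq u g g' (hu hu' : valid u) : bsv g hu = bsv g' hu' <-> H u (g^-1 ** g').
Proof.
rewrite -(coset_eq _ _ (H_subgroup u)); split=> [|e].
- by move/(congr1 (fun p => (sval p).2)).
- by apply: BSv_ext; rewrite /= e.
Qed.

Lemma bsv_type u u' g g' (hu : valid u) (hu' : valid u') : bsv g hu = bsv g' hu' -> u = u'.
Proof. by move/(congr1 (fun p => (sval p).1)). Qed.

Lemma BSact_bsv g g' u (hu : valid u) : BSact g (bsv g' hu) = bsv (g ** g') hu.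
Proof. by apply: BSv_ext; rewrite /= gleft_coset. Qed.

Lemma Evalid_orig e : evalid e -> valid (Eorig e).
Proof. by case: e => [v L []|a b []|a b []]. Qed.

Lemma Evalid_term e : evalid e -> valid (Eterm e).
Proof. by case: e => [v L [_ []]|a b []|a b]. Qed.

Definition joins e g (p q : X) := exists he : evalid e,
  p = bsv g (Evalid_orig he) /\ q = bsv (g ** stable e) (Evalid_term he).

Lemma BSadjP p q : Xadj p q <-> exists e g, joins e g p q \/ joins e g q p.
Proof.
split=> [[e [g [he h]]]|[e [g h]]]; exists e, g.
- case: h => -[h1 h2]; [left|right]; exists he; split; apply: BSv_ext => //.
- case: h => -[he [-> ->]]; split=> //; [by left|by right].
Qed.

Lemma BSadj_sym p q : Xadj p q -> Xadj q p.
Proof. by move=> /BSadjP [e [g h]]; apply/BSadjP; exists e, g; case: h; auto. Qed.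

Lemma BSact1 p : BSact gone p = p.
Proof. by have [u [g [hu ->]]] := BSv_cases p; rewrite BSact_bsv gmul1. Qed.

Lemma BSactM g h p : BSact g (BSact h p) = BSact (g ** h) p.
Proof. by have [u [k [hu ->]]] := BSv_cases p; rewrite !BSact_bsv gmulA. Qed.

Lemma joins_act h e g p q : joins e g p q -> joins e (h ** g) (BSact h p) (BSact h q).
Proof. by move=> [he [-> ->]]; exists he; rewrite !BSact_bsv gmulA. Qed.

Lemma BSadj_act h p q : Xadj p q -> Xadj (BSact h p) (BSact h q).
Proof.
move=> /BSadjP [e [g j]]; apply/BSadjP; exists e, (h ** g).
by case: j => /(@joins_act h); auto.
Qed.

Section HalfSpace.
Variables (e0 : JE V) (F : JV V -> G -> bool).
Hypothesis F_inv : forall u g h, valid u -> H u h -> F u (g ** h) = F u g.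
Hypothesis F_cross : forall e g, evalid e -> F (Eorig e) g <> F (Eterm e) (g ** stable e) ->
  [/\ e = e0, H (Eorig e0) g & H (Eterm e0) ((stable e0)^-1 ** (g ** stable e0))].
Hypothesis F_base : F (Eorig e0) gone <> F (Eterm e0) (stable e0).

(** [F u g] is the side of the vertex [g H_u] with respect to the edge [e0] at the identity: [F_inv]
    makes it depend on the coset only, and [F_cross] lets it change across that edge alone. Other
    edges of type [e0] follow by translating with [g0]. *)
Lemma half_space g0 (x y : X) : joins e0 g0 x y -> bridge Xadj x y.
Proof.
move=> [he0 [ex ey]].
pose P (p : X) := exists g : G, (sval p).2 = coset g (H (sval p).1) /\ F (sval p).1 (g0^-1 ** g).
have PE u g (hu : valid u) : P (bsv g hu) <-> F u (g0^-1 ** g).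
  split=> [[g' [/= e h]]|h]; last by exists g.
  move/(coset_eq _ _ (H_subgroup u)): e => e.
  by rewrite -(F_inv _ hu e) -gmulA gmulVK.
have cross e g (p q : X) : joins e g p q -> ~ (P p <-> P q) -> p = x /\ q = y.
  move=> [he [ep eq]]; rewrite ep eq !PE gmulA => nP.
  have ne : F (Eorig e) (g0^-1 ** g) <> F (Eterm e) (g0^-1 ** g ** stable e).
    by move=> E; apply: nP; rewrite E.
  have [ee h1 h2] := F_cross he ne; subst e; rewrite ex ey.
  have [_ [_ hV]] := H_subgroup (Eorig e0); have [_ [_ hV']] := H_subgroup (Eterm e0).
  split; apply/bsv_eq.
  - by have := hV _ h1; grp.
  - by have := hV' _ h2; grp.
exists P; split.
- rewrite ex ey !PE gmulV gmulA gmulV gmul1 => h; apply: F_base.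
  by apply/idP/idP => /h.
- move=> p q /BSadjP [e [g [j|j]]] nP; first by left; apply: cross j nP.
  by right; have [|-> ->] := cross _ _ _ _ j; first by move=> h; apply: nP; rewrite h.
Qed.

End HalfSpace.

(** * Half-spaces for the three types of edges *)

Lemma tip_chunk a b L : leaf_of adj [set a; b] a b -> big_chunk adj L -> b \in L ->
  L = [set a; b].
Proof.
move=> lf bL bL'; have [_ mx] := leaf_big_chunk adj_sym adj_irr lf.
apply: mx; last by case: bL.
have [w wL bw] := big_chunk_nbr adj_sym adj_irr gconn card3 bL bL'.
have ew := leaf_tip adj_sym lf bw; subst w.
by apply/subsetP => z; rewrite !inE => /orP [/eqP ->|/eqP ->].
Qed.

Lemma tip_not_separating L a b v : leaf_of adj L a b -> separating adj v -> v <> b.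
Proof.
move=> lf sv e; apply: (leaf_tip_nbrs adj_sym lf); rewrite -e.
exact: (separating_two_nbrs adj_sym gconn sv).
Qed.

Lemma tip_not_base L L' a b a' b' : leaf_of adj L a b -> leaf_of adj L' a' b' -> a' <> b.
Proof.
move=> lf lf' e; apply: (leaf_tip_nbrs adj_sym lf); rewrite -e.
exact: (leaf_base adj_sym gconn card3 lf').
Qed.

Lemma tip_inj L L' a b a' : leaf_of adj L a b -> leaf_of adj L' a' b -> a' = a.
Proof.
move=> lf [_ [ab _]]; apply: (leaf_tip adj_sym lf); by rewrite adj_sym.
Qed.

Lemma zelt_in (S : G -> Prop) a b : gsub S (gen a) -> gsub S (gen b) -> gsub S (zz a b).
Proof.
move=> ha hb; have h := subgroup_alt (m a b) (gsub_subgroup S) ha hb.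
by rewrite /zelt; case: odd => //; apply: gs_mul.
Qed.

Lemma leaf_in L a b : leaf_of adj L a b -> a \in L /\ b \in L.
Proof. by move=> [-> _]; rewrite !inE !eqxx orbT. Qed.

Lemma Hblack_gens L h : H (JBlack L) h -> gsub (fun x => exists v, v \in L /\ x = gen v) h.
Proof.
set S := fun x => _.
have gin v : v \in L -> gsub S (gen v) by move=> vL; apply: gs_in; exists v.
move=> [[a [b [[lf _] hh]]]|[[a [b [[lf _] hh]]]|[_ //]]]; have [aL bL] := leaf_in lf.
- by move: h hh; apply: gsub_min (gsub_subgroup S) _ => x ->; apply: gin.
- move: h hh; apply: gsub_min (gsub_subgroup S) _ => x [->|->]; first exact: gin.
  by apply: zelt_in; apply: gin.
Qed.

Lemma Hred_gens a b h : H (JRed a b) h ->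
  gsub (fun x => exists v, v \in [set a; b] /\ x = gen v) h.
Proof.
set S := fun x => _; move: h; apply: gsub_min (gsub_subgroup S) _ => x ->.
by apply: gs_mul; apply: gs_in; [exists a|exists b]; rewrite !inE eqxx ?orbT.
Qed.

Lemma separating_in_black v L : separating adj v -> v \in L -> H (JBlack L) (gen v).
Proof.
move=> sv vL; have [[a [b tl]]|[[a [b bl]]|ne]] := leaf_cases m_ge2 L.
- have [lf _] := tl; apply/(Jblack_toral gen adj_sym adj_irr gconn card3 _ tl); apply: gs_in.
  move: vL; rewrite (proj1 lf) !inE => /orP [/eqP -> //|/eqP e].
  by case: (tip_not_separating lf sv e).
- have [lf _] := bl; apply/(Jblack_braided gen adj_sym adj_irr gconn card3 _ bl); apply: gs_in.
  move: vL; rewrite (proj1 lf) !inE => /orP [/eqP ->|/eqP e]; first by left.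
  by case: (tip_not_separating lf sv e).
- by apply/Jblack_other => //; apply: gs_in; exists v.
Qed.

(** [K] is the component of the graph minus [v] that contains the rest of [L], and [t] the indicator
    of [<v>]. The increments are those of [t] along [K] and 0 elsewhere. They respect the relations
    because an edge leaving [K] ends at [v], where both sections agree. *)
Lemma halfspace_white v L g0 x y : joins (EWB v L) g0 x y -> bridge Xadj x y.
Proof.
move=> j; have [[sv [bL vL]] _] := j; move: j.
have [x0 x0L vx0] := big_chunk_nbr adj_sym adj_irr gconn card3 bL vL.
have x0v : x0 <> v by move/esym; apply: (adj_neq adj_irr).
pose K := [set w | connect (inrel adj [set~ v]) x0 w].
have Kv w : w \in K -> w <> v.
  rewrite inE => h; apply: (@connect_closed _ _ (fun z => z <> v) _ _ _ h x0v).
  by move=> a b /and3P [_ _]; rewrite !inE => /eqP.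
have Kadj a b : adj a b -> a \in K -> b <> v -> b \in K.
  move=> ab aK bv; have av := Kv _ aK; move: aK; rewrite !inE => h.
  apply: connect_trans h _; apply: connect1; rewrite /inrel /= ab !inE.
  by move/eqP: av => ->; move/eqP: bv => ->.
have Kchunk L' a b : big_chunk adj L' -> a \in L' -> b \in L' -> a \in K -> b <> v -> b \in K.
  move=> bL' aL bL'' aK bv; have av := Kv _ aK.
  have c : connected_in adj (L' :\ v).
    case: (boolP (v \in L')) => vL'; first exact: chunk_remove (proj1 bL') vL'.
    have -> : L' :\ v = L' by apply/setDidPl; rewrite disjoint_sym disjoints1.
    by case: bL' => -[_ []].
  have cab : connect (inrel adj (L' :\ v)) a b.
    by apply: c; rewrite in_setD1 ?aL ?bL'' andbT; apply/eqP.
  apply: (@connect_closed _ _ (fun z => z \in K) _ _ _ cab aK).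
  by move=> s t /and3P [st _]; rewrite in_setD1 => /andP [/eqP tv _] sK; apply: Kadj st sK tv.
pose C := gsub (fun x => x = gen v).
have sC : is_subgroup C by apply: gsub_subgroup.
pose t := indic C.
have t1 : t gone by apply: indic_one.
have tv g : t (g ** gen v) = t g by apply: indic_right => //; apply: gs_in.
pose dl w : G -> bool := fun g => if w \in K then t g (+) t (g ** gen w) else false.
have vK : v \notin K by apply/negP => /Kv.
have dlK w : w \in K \/ w = v -> ((dl w, gen w) : twist G) = tsec t (gen w).
  move=> [wK|->]; first by congr pair; apply: functional_extensionality => g; rewrite /dl wK.
  rewrite tsec_zsec //; congr pair; apply: functional_extensionality => g.
  by rewrite /dl (negbTE vK).
have dlN w : w \notin K -> ((dl w, gen w) : twist G) = zsec (gen w).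
  by move=> wK; congr pair; apply: functional_extensionality => g; rewrite /dl (negbTE wK).
have [|F HF] := @integrate_cocycle _ _ adj m gen dl pres.
  move=> a b ab; have br := gen_braid pres ab.
  have homs s : alt (tsec s (gen a)) (tsec s (gen b)) (m a b) =
                alt (tsec s (gen b)) (tsec s (gen a)) (m a b).
    by rewrite -!(hom_alt _ _ _ (tsec_hom s)) br.
  case: (boolP (a \in K)) => aK; case: (boolP (b \in K)) => bK.
  - by rewrite !dlK; [exact: homs|left|left].
  - have bv : b = v by apply: NNPP => bv; move: bK; rewrite (Kadj _ _ ab aK bv).
    by rewrite !dlK; [exact: homs|right|left].
  - have ba : adj b a by rewrite adj_sym.
    have av : a = v by apply: NNPP => av; move: aK; rewrite (Kadj _ _ ba bK av).
    by rewrite !dlK; [exact: homs|left|right].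
  - by rewrite !dlN //; exact: homs.
pose meets (S : {set V}) := [exists z in S, z \in K].
pose side u := match u with
  | JWhite w => w \in K | JBlack L' => meets L' | JRed a b => meets [set a; b] end.
(* [F] is invariant under the generators outside [K], and [F + t] under those in [K] and under [v].
   The two differ only on [<v>], and the only edges between the two kinds of vertices are of type
   [EWB v L]. *)
pose Fb (b : bool) g := F g (+) (b && t g).
have Fgen (L' : {set V}) w g : big_chunk adj L' -> w \in L' ->
    Fb (meets L') (g ** gen w) = Fb (meets L') g.
  move=> bL' wL; rewrite /Fb HF /dl.
  case: (boolP (w \in K)) => wK.
    have -> /= : meets L' by apply/existsP; exists w; rewrite wL.
    by case: (F g); case: (t g); case: (t _).
  case: (boolP (meets L')) => [/existsP [z /andP [zL zK]]|_]; last by rewrite /= !addbF.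
  have -> : w = v by apply: NNPP => wv; move: wK; rewrite (Kchunk _ z w bL').
  by rewrite tv addbF.
apply: (@half_space (EWB v L) (fun u => Fb (side u))).
- move=> [w|L'|a b] g h /=.
  + move=> sw hh; move: h hh g; apply: right_invariant_gsub => s -> g.
    rewrite /Fb HF /dl; case: (w \in K) => /=; last by rewrite !addbF.
    by case: (F g); case: (t g); case: (t _).
  + move=> bL' /Hblack_gens hh; move: h hh g; apply: right_invariant_gsub => s [w [wL ->]] g.
    exact: Fgen.
  + move=> [bL' _] /Hred_gens hh; move: h hh g; apply: right_invariant_gsub => s [w [wL ->]] g.
    exact: Fgen.
- move=> [w L'|a b|a b] g /=.
  + move=> [sw [bL' wL']]; rewrite gmulg1 ginv1 gmul1.
    case: (boolP (w \in K)) => wK.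
      by have -> : meets L' by apply/existsP; exists w; rewrite wL'.
    case: (boolP (meets L')) => [/existsP [z /andP [zL zK]]|_] //.
    have wv : w = v by apply: NNPP => wv; move: wK; rewrite (Kchunk _ z w bL').
    subst w; have LL : L = L'.
      apply: (big_chunk_unique adj_sym bL bL' vL wL' x0L x0v zL (Kv _ zK)).
      by move: zK; rewrite inE.
    subst L'; rewrite /Fb /= addbF.
    case: (boolP (t g)) => [/indicP tg _|_]; last by rewrite addbF.
    split=> //; move: g tg; apply: gsub_min; first exact: (H_subgroup (JBlack L)).
    by move=> h ->; apply: separating_in_black.
  + by move=> [bab _]; rewrite Fgen // !inE eqxx orbT.
  + by rewrite gmulg1.
- rewrite /Fb /= (negbTE vK) /= addbF.
  have -> : meets L by apply/existsP; exists x0; rewrite x0L inE connect0.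
  by rewrite t1; case: (F gone).
Qed.

(** [F] changes only along [b], and only at elements of [<a>]. The one relation involving the tip
    [b] is that it commutes with [a], under which the indicator [t] of [<a>] is invariant. *)
Lemma halfspace_loop a b g0 x y : joins (ELoop a b) g0 x y -> bridge Xadj x y.
Proof.
move=> j; have [[bab tl] _] := j; move: j; have [lf m2] := tl.
have ab := proj1 (proj2 lf).
have comm : gcomm (gen a) (gen b).
  by have := gen_braid pres ab; rewrite m2 /= !gmulg1.
pose C := gsub (fun x => x = gen a).
have sC : is_subgroup C by apply: gsub_subgroup.
pose t := indic C.
have t1 : t gone by apply: indic_one.
have ta g : t (g ** gen a) = t g by apply: indic_right => //; apply: gs_in.
pose dl w : G -> bool := fun g => if w == b then t g else false.
have [|F HF] := @integrate_cocycle _ _ adj m gen dl pres.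
  have dlN w : w <> b -> ((dl w, gen w) : twist G) = zsec (gen w).
    by move=> /eqP/negbTE wb; congr pair; apply: functional_extensionality => g; rewrite /dl wb.
  have key : alt ((dl a, gen a) : twist G) (dl b, gen b) 2 =
             alt ((dl b, gen b) : twist G) (dl a, gen a) 2.
    rewrite /= /twist_mul /= !gmulg1; congr pair; last exact: comm.
    apply: functional_extensionality => g; rewrite /dl eqxx.
    have /negbTE -> : a != b by apply/eqP/(adj_neq adj_irr).
    by rewrite ta /= !addbF.
  move=> c d cd; case: (eqVneq c b) => [cb|/eqP cb]; last case: (eqVneq d b) => [db|/eqP db].
  - subst c; have da := leaf_tip adj_sym lf cd; subst d.
    by rewrite -(m_sym ab) m2 key.
  - subst d; have ca : c = a by apply: (leaf_tip adj_sym lf); rewrite adj_sym.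
    by subst c; rewrite m2 key.
  - by rewrite !dlN // -!(hom_alt _ _ _ (tsec_hom _)) (gen_braid pres cd).
have Fgen w g : w <> b -> F (g ** gen w) = F g.
  by move=> /eqP/negbTE wb; rewrite HF /dl wb addbF.
have Fset (S : {set V}) h : b \notin S -> gsub (fun x => exists v, v \in S /\ x = gen v) h ->
    forall g, F (g ** h) = F g.
  move=> bS; move: h; apply: right_invariant_gsub => s [w [wS ->]] g; apply: Fgen.
  by move=> e; move: bS; rewrite -e wS.
have tip a' b' L : leaf_of adj L a' b' -> m a' b' <> 2 -> b' <> b.
  by move=> lf' m2' e; subst b'; apply: m2'; rewrite (tip_inj lf lf').
apply: (@half_space (ELoop a b) (fun _ => F)).
- move=> [w|L'|a' b'] g h /=.
  + move=> sw hh; move: h hh g; apply: right_invariant_gsub => s -> g; apply: Fgen.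
    exact: tip_not_separating lf sw.
  + move=> bL' hh; case: (boolP (b \in L')) => bL; last exact: (Fset _ _ bL (Hblack_gens hh)).
    have eL := tip_chunk lf bL' bL; subst L'.
    move/(Jblack_toral gen adj_sym adj_irr gconn card3 _ tl): hh => hh.
    move: h hh g; apply: right_invariant_gsub => s -> g; apply: Fgen.
    exact: (adj_neq adj_irr ab).
  + move=> [_ [lf' [_ m4]]] /Hred_gens hh; apply: (Fset _ _ _ hh); rewrite !inE negb_or.
    apply/andP; split; apply/eqP => e.
    * by apply: (tip_not_base lf lf').
    * by apply: (tip _ _ _ lf') => // m2'; rewrite m2' in m4.
- move=> [w L'|a' b'|a' b'] g /=; rewrite ?gmulg1 //.
  move=> [_ [lf' m2']]; rewrite HF /dl; case: eqP => [e|_]; last by rewrite addbF.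
  subst b'; have ea := tip_inj lf lf'; subst a'.
  case: (boolP (t g)) => [/indicP tg _|_]; last by rewrite addbF.
  have hg : H (JBlack [set a; b]) g.
    exact/(Jblack_toral gen adj_sym adj_irr gconn card3 _ tl).
  split=> //; have c : gcomm (gen b) g.
    by apply: (gsub_cent _ tg) => x0 ->; apply: gcomm_sym.
  by rewrite -c gmulK.
- by rewrite /= -[gen b]gmul1 HF /dl eqxx t1; case: (F gone).
Qed.

(** Wanted is an [F] invariant under all generators except [b], with [F + t] invariant under [ab],
    where [t] is the indicator of [<z_ab>]. Then [F] serves all vertices but the red ones of this
    leaf, which take [F + t]. *)
Lemma halfspace_red a b g0 x y : joins (ERed a b) g0 x y -> bridge Xadj x y.
Proof.
move=> j; have [[bab bl] _] := j; move: j; have [lf [ev m4]] := bl.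
have ab := proj1 (proj2 lf); have nab := adj_neq adj_irr ab.
have [_ ze] := zelt_even gen ev; have [za zb] := zelt_comm pres ab ev.
pose C := gsub (fun x => x = zz a b).
have sC : is_subgroup C by apply: gsub_subgroup.
pose t := indic C.
have t1 : t gone by apply: indic_one.
have tz g : t (g ** zz a b) = t g by apply: indic_right => //; apply: gs_in.
(* The increment along [b] is forced by [b = a^-1 (ab)]: [F] does not change along [a^-1], and along
   [ab] it changes as [t] does. *)
pose dl w : G -> bool :=
  fun g => if w == b then t (g ** (gen a)^-1) (+) t (g ** gen b) else false.
have dlN w : w <> b -> ((dl w, gen w) : twist G) = zsec (gen w).
  by move=> /eqP/negbTE wb; congr pair; apply: functional_extensionality => g; rewrite /dl wb.
have [|F HF] := @integrate_cocycle _ _ adj m gen dl pres.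
  set A := ((dl a, gen a) : twist G); set B := ((dl b, gen b) : twist G).
  have AE : A = zsec (gen a) by apply: dlN.
  have AB : A ** B = tsec t (gen a ** gen b).
    rewrite AE /= /twist_mul /=; congr pair; apply: functional_extensionality => g.
    by rewrite /dl eqxx /=; grp; rewrite gmulA.
  have zE : tsec t (zz a b) = zsec (zz a b) by apply: tsec_zsec.
  have e1 : alt A B (m a b) = zsec (zz a b).
    rewrite -(even_halfK ev) alt_double AB -(hom_pow _ _ (tsec_hom t)).
    by rewrite -ze zE.
  (* [BA] is conjugate to [AB] by [A], and the common power [zsec (zz a b)] commutes with [A]. *)
  have e2 : alt B A (m a b) = zsec (zz a b).
    rewrite -(even_halfK ev) alt_double.
    have -> : B ** A = A^-1 ** (A ** B) ** A^-1^-1 by grp.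
    rewrite gpow_conj AB -(hom_pow _ _ (tsec_hom t)).
    rewrite -ze zE ginvK AE -(hom_inv _ (tsec_hom _)) -!(tsec_hom (fun=> false)).
    by rewrite -gmulA -za gmulK.
  move=> c d cd; case: (eqVneq c b) => [cb|/eqP cb]; last case: (eqVneq d b) => [db|/eqP db].
  - subst c; have da := leaf_tip adj_sym lf cd; subst d.
    by rewrite -(m_sym ab) -/A -/B e1 e2.
  - subst d; have ca : c = a by apply: (leaf_tip adj_sym lf); rewrite adj_sym.
    by subst c; rewrite -/A -/B e1 e2.
  - by rewrite !dlN // -!(hom_alt _ _ _ (tsec_hom _)) (gen_braid pres cd).
have Fgen w g : w <> b -> F (g ** gen w) = F g.
  by move=> /eqP/negbTE wb; rewrite HF /dl wb addbF.
have Fab g : F (g ** (gen a ** gen b)) (+) t (g ** (gen a ** gen b)) = F g (+) t g.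
  rewrite gmulA HF /dl eqxx Fgen // -(gmulA g (gen a) (_)^-1) gmulVV gmulg1.
  by case: (F g); case: (t g); case: (t _).
have Fz g : F (g ** zz a b) = F g.
  have inv : forall s, s = gen a ** gen b -> forall k, F (k ** s) (+) t (k ** s) = F k (+) t k.
    by move=> s -> k; apply: Fab.
  have zin : gsub (fun x => x = gen a ** gen b) (zz a b).
    rewrite ze; apply: subgroup_pow; first exact: gsub_subgroup.
    exact: gs_in.
  have := @right_invariant_gsub _ (fun g => F g (+) t g) _ inv _ zin g.
  by rewrite /= tz => /addIb.
have Fset (S : {set V}) h : b \notin S -> gsub (fun x => exists v, v \in S /\ x = gen v) h ->
    forall g, F (g ** h) = F g.
  move=> bS; move: h; apply: right_invariant_gsub => s [w [wS ->]] g; apply: Fgen.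
  by move=> e; move: bS; rewrite -e wS.
pose isred u := if u is JRed a' b' then (a' == a) && (b' == b) else false.
apply: (@half_space (ERed a b) (fun u g => F g (+) (isred u && t g))).
- move=> [w|L'|a' b'] g h /=; rewrite ?addbF.
  + move=> sw hh; move: h hh g; apply: right_invariant_gsub => s -> g; apply: Fgen.
    exact: tip_not_separating lf sw.
  + move=> bL' hh; case: (boolP (b \in L')) => bL; last exact: (Fset _ _ bL (Hblack_gens hh)).
    have eL := tip_chunk lf bL' bL; subst L'.
    move/(Jblack_braided gen adj_sym adj_irr gconn card3 _ bl): hh => hh.
    move: h hh g; apply: right_invariant_gsub => s [->|->] g; first exact: Fgen.
    exact: Fz.
  + move=> [_ [lf' _]] hh; case: (boolP ((a' == a) && (b' == b))) => [/andP [/eqP e1 /eqP e2]|ne].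
    * subst a' b'; move: h hh g.
      apply: (@right_invariant_gsub _ (fun g => F g (+) t g)) => s -> g; exact: Fab.
    * rewrite /= !addbF; apply: (Fset _ _ _ (Hred_gens hh)); rewrite !inE negb_or.
      apply/andP; split; apply/eqP => e; first exact: (tip_not_base lf lf').
      by subst b'; move: ne; rewrite (tip_inj lf lf') !eqxx.
- move=> [w L'|a' b'|a' b'] g /=; rewrite ?gmulg1 //.
  + move=> [_ [lf' m2']]; rewrite !addbF Fgen // => e; subst b'.
    by move: m4; rewrite -(tip_inj lf lf') m2'.
  + move=> _; rewrite addbF; case: (boolP ((a' == a) && (b' == b))) =>
      [/andP [/eqP e1 /eqP e2]|ne]; last by rewrite addbF.
    subst a' b'; case: (boolP (t g)) => [/indicP tg _|_]; last by rewrite addbF.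
    rewrite ginv1 gmul1; split=> //; move: g tg; apply: gsub_min;
      try first [exact: (H_subgroup (JBlack [set a; b]))|exact: gsub_subgroup].
    * move=> h ->; apply/(Jblack_braided gen adj_sym adj_irr gconn card3 _ bl).
      by apply: gs_in; right.
    * move=> h ->; rewrite ze; apply: subgroup_pow; first exact: gsub_subgroup.
      exact: gs_in.
- by rewrite /= !eqxx t1; case: (F gone).
Qed.

Lemma BS_bridge (x y : X) : Xadj x y -> bridge Xadj x y.
Proof.
have H0 e g (p q : X) : joins e g p q -> bridge Xadj p q.
  by case: e => *; [apply: halfspace_white|apply: halfspace_loop|apply: halfspace_red]; eauto.
move=> /BSadjP [e [g [/H0 //|/H0 [P [n h]]]]]; exists P; split.
  by move=> k; apply: n; rewrite k.
by move=> p q pq nP; case: (h p q pq nP); auto.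
Qed.

End BassSerre.

(** * The Bass-Serre tree *)

Section BassSerreTree.
Variables (V : finType) (adj : rel V) (m : V -> V -> nat) (G : Grp) (gen : V -> G).
Hypothesis adj_sym : symmetric adj.
Hypothesis adj_irr : irreflexive adj.
Hypothesis m_sym : forall a b, adj a b -> m a b = m b a.
Hypothesis m_ge2 : forall a b, adj a b -> 2 <= m a b.
Hypothesis gconn : connected_in adj [set: V].
Hypothesis card3 : 3 <= #|V|.
Hypothesis pres : artin_presentation adj m gen.

Local Notation X := (BSv adj m gen).
Local Notation Xadj := (@BSadj V adj m G gen).
Local Notation H := (Jvgroup adj m gen).
Local Notation valid := (Jvalid adj m).
Local Notation evalid := (Evalid adj m).
Local Notation stable := (Estable gen).
Local Notation zz := (zelt m gen).
Local Notation bsv := (@bsv V adj m G gen _).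
Implicit Types (v w a b : V) (L : {set V}) (g h : G) (u : JV V) (e : JE V) (p q : X).

Let Hsub u : is_subgroup (H u).
Proof. exact: H_subgroup. Qed.

Let bsveq u g g' (hu hu' : valid u) : bsv g hu = bsv g' hu' <-> H u (g^-1 ** g').
Proof. exact: bsv_eq. Qed.

Lemma bsv_irr u g (hu hu' : valid u) : bsv g hu = bsv g hu'.
Proof. exact: BSv_ext. Qed.

Lemma joins_valid e g (ho : valid (Eorig e)) (ht : valid (Eterm e)) : evalid e ->
  joins e g (bsv g ho) (bsv (g ** stable e) ht).
Proof. by move=> he; exists he; split; apply: bsv_irr. Qed.

Lemma joins_adj e g p q : joins e g p q -> Xadj p q.
Proof. by move=> j; apply/BSadjP; exists e, g; left. Qed.

(** * Connectedness of the coset graph *)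

Definition reach p q := exists s, walk Xadj p s q.

Lemma reach_refl p : reach p p.
Proof. by exists nil. Qed.

Lemma reach_trans q p r : reach p q -> reach q r -> reach p r.
Proof. by move=> [s h] [t k]; exists (s ++ t); apply/walk_cat; exists q. Qed.

Lemma reach_sym p q : reach p q -> reach q p.
Proof. by move=> [s h]; exists (rev_walk p s); apply: walk_rev h; apply: BSadj_sym. Qed.

Lemma reach_adj p q : Xadj p q -> reach p q.
Proof. by move=> h; exists [:: q]. Qed.

Lemma reach_act g p q : reach p q -> reach (BSact g p) (BSact g q).
Proof.
move=> [s h]; exists (map (BSact g) s).
elim: s p h => [|r s IH] p /=; first by move=> ->.
by move=> [pr /IH h]; split=> //; apply: BSadj_act.
Qed.

Lemma reach_white v L g (hv : valid (JWhite v)) (hL : valid (JBlack L)) : v \in L ->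
  reach (bsv g hv) (bsv g hL).
Proof.
move=> vL; have he : evalid (EWB v L) by [].
by have /joins_adj/reach_adj := @joins_valid (EWB v L) g hv hL he; rewrite gmulg1.
Qed.

Lemma reach_share L L' v (hL : valid (JBlack L)) (hL' : valid (JBlack L')) :
  v \in L -> v \in L' -> reach (bsv gone hL) (bsv gone hL').
Proof.
move=> vL vL'; case: (eqVneq L L') => [e|/eqP ne].
  by subst L'; rewrite (bsv_irr gone hL hL'); apply: reach_refl.
have hv : valid (JWhite v).
  exact: (two_chunks_separating adj_sym adj_irr gconn card3 hL hL' vL vL' ne).
apply: (@reach_trans (bsv gone hv)); last exact: reach_white.
by apply/reach_sym/reach_white.
Qed.

Lemma reach_black L L' (hL : valid (JBlack L)) (hL' : valid (JBlack L')) :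
  reach (bsv gone hL) (bsv gone hL').
Proof.
have [/set0Pn [v vL] _] := proj1 hL; have [/set0Pn [w wL] _] := proj1 hL'.
suff h : forall M (hM : valid (JBlack M)), w \in M -> reach (bsv gone hL) (bsv gone hM) by exact: h.
apply: (@closed_all _ _ gconn (fun z => forall M (hM : valid (JBlack M)), z \in M ->
  reach (bsv gone hL) (bsv gone hM)) v w); last by move=> M hM vM; apply: reach_share vL vM.
move=> x y xy IH M hM yM; have [N [hN xN yN]] := edge_big_chunk adj_sym xy.
apply: (@reach_trans (bsv gone (hN : valid (JBlack N)))); first exact: IH.
exact: reach_share yN yM.
Qed.

Lemma vertex_chunk v : exists2 L, valid (JBlack L) & v \in L.
Proof.
have [w vw] := has_nbr gconn card3 v.
by have [L [bL vL _]] := edge_big_chunk adj_sym vw; exists L.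
Qed.

Lemma reach_red a b g (hr : valid (JRed a b)) (hb : valid (JBlack [set a; b])) :
  reach (bsv g hb) (bsv g hr).
Proof.
by have /joins_adj/reach_adj := @joins_valid (ERed a b) g hb hr hr; rewrite gmulg1.
Qed.

Lemma reach_base u u' (hu : valid u) (hu' : valid u') : reach (bsv gone hu) (bsv gone hu').
Proof.
have B0 s (hs : valid s) : exists L (hL : valid (JBlack L)), reach (bsv gone hs) (bsv gone hL).
  case: s hs => [v|L|a b] hs.
  - by have [L bL vL] := vertex_chunk v; exists L, bL; apply: reach_white.
  - by exists L, hs; apply: reach_refl.
  - by exists [set a; b], (proj1 hs : valid (JBlack _)); apply/reach_sym/reach_red.
have [L [hL r]] := B0 _ hu; have [L' [hL' r']] := B0 _ hu'.
apply: reach_trans r _; apply: (@reach_trans (bsv gone hL')); first exact: reach_black.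
exact: reach_sym.
Qed.

Lemma bsv_right u g h (hu : valid u) : H u h -> bsv (g ** h) hu = bsv g hu.
Proof. by move=> hh; apply/bsveq; case: (Hsub u) => _ [_ hV]; have := hV _ hh; grp. Qed.

(** A generator lies in the black group of a chunk containing it unless it is the tip of an even
    leaf. A toral tip moves the black vertex along the loop edge. For a braided tip, [b = a^-1 (ab)]
    gives [b] and [a^-1] the same red vertex, while [a^-1] fixes the black one. *)
Lemma reach_gen v : exists L (hL : valid (JBlack L)),
  reach (bsv gone hL) (BSact (gen v) (bsv gone hL)).
Proof.
have [L bL vL] := vertex_chunk v; exists L, bL; rewrite BSact_bsv gmulg1.
have self : H (JBlack L) (gen v) -> reach (bsv gone bL) (bsv (gen v) bL).
  by move=> /(bsv_right gone bL); rewrite gmul1 => ->; apply: reach_refl.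
have [[a [b tl]]|[[a [b bl]]|ne]] := leaf_cases m_ge2 L.
- have [lf m2] := tl; have eL := proj1 lf.
  have /orP [/eqP va|/eqP vb] : (v == a) || (v == b) by move: vL; rewrite eL !inE.
    by apply: self; apply/(Jblack_toral gen adj_sym adj_irr gconn card3 _ tl);
      rewrite va; apply: gs_in.
  subst L v; have he : evalid (ELoop a b) by [].
  by have /joins_adj/reach_adj := @joins_valid (ELoop a b) gone bL bL he; rewrite gmul1.
- have [lf _] := bl; have eL := proj1 lf.
  have Ha : H (JBlack L) (gen a).
    by apply/(Jblack_braided gen adj_sym adj_irr gconn card3 _ bl); apply: gs_in; left.
  have /orP [/eqP va|/eqP vb] : (v == a) || (v == b) by move: vL; rewrite eL !inE.
    by apply: self; rewrite va.
  subst L v; have hr : valid (JRed a b) by [].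
  have r1 := reach_red gone hr bL; have r2 := reach_red (gen b) hr bL.
  have r3 := reach_act (gen a)^-1 r1; rewrite !BSact_bsv !gmulg1 in r3.
  have e1 : bsv (gen a)^-1 bL = bsv gone bL.
    by rewrite -(gmul1 (gen a)^-1) bsv_right //; case: (Hsub (JBlack [set a; b])) => _ [_]; apply.
  have e2 : bsv (gen b) hr = bsv (gen a)^-1 hr.
    have -> : gen b = (gen a)^-1 ** (gen a ** gen b) by rewrite gmulK.
    by apply: bsv_right; apply: gs_in.
  apply: reach_sym; apply: reach_trans r2 _; rewrite e2 -e1; exact: reach_sym.
- by apply: self; apply/Jblack_other => //; apply: gs_in; exists v.
Qed.

Lemma reach_all p q : reach p q.
Proof.
have step g u (hu : valid u) : reach (bsv gone hu) (BSact g (bsv gone hu)).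
  have [_ [hgen _]] := pres; move: g (hgen g); apply: gsub_min => [|g [v ->]].
    split; [|split].
    - by rewrite BSact1; apply: reach_refl.
    - move=> g h r1 r2; apply: reach_trans r1 _; rewrite -BSactM; exact: reach_act.
    - move=> g r; have := reach_act g^-1 r; rewrite BSactM gmulV BSact1; exact: reach_sym.
  have [L [hL r]] := reach_gen v.
  apply: (@reach_trans (bsv gone hL)); first exact: reach_base.
  by apply: reach_trans r _; apply: reach_act; apply: reach_base.
have [u [g [hu ->]]] := BSv_cases p; have [u' [g' [hu' ->]]] := BSv_cases q.
have e k s (hs : valid s) : bsv k hs = BSact k (bsv gone hs) by rewrite BSact_bsv gmulg1.
rewrite (e g _ hu) (e g' _ hu'); apply: reach_trans (reach_sym (step _ _ _)) _.
by apply: (@reach_trans (bsv gone hu')); [exact: reach_base|exact: step].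
Qed.

Lemma BS_is_tree : is_tree Xadj.
Proof.
apply: bridge_tree; [exact: BSadj_sym|exact: reach_all|].
by move=> x y; apply: BS_bridge.
Qed.

Local Notation d := (dist BS_is_tree).
Local Notation B := (between BS_is_tree).

Lemma BSdist_act g p q : d (BSact g p) (BSact g q) = d p q.
Proof.
apply: (@dist_iso _ _ BS_is_tree (BSact g) (BSact g^-1)) => [x|x y|x y]; try exact: BSadj_act.
by rewrite BSactM gmulV BSact1.
Qed.

(** * Absence of loops and inversions *)

Lemma toral_stable_free a b i n : toral_leaf adj m [set a; b] a b -> n <> 0%Z ->
  gzpow (gen b) n = gzpow (gen a) i -> False.
Proof.
move=> [lf _] n0 e; apply: n0; apply: (gens_neq adj_sym adj_irr m_sym m_ge2 pres _ e).
by move=> ba; apply: (adj_neq adj_irr (proj1 (proj2 lf))).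
Qed.

Lemma toral_cycle a b h : toral_leaf adj m [set a; b] a b ->
  H (JBlack [set a; b]) h -> exists i, h = gzpow (gen a) i.
Proof. by move=> tl /(Jblack_toral gen adj_sym adj_irr gconn card3 _ tl) /gsub_cycle. Qed.

Lemma BSadj_irr p : ~ Xadj p p.
Proof.
move=> /BSadjP [e [g j]]; have {j} [he [e1]] : joins e g p p by case: j.
rewrite e1 => e2; have := bsv_type e2.
case: e he e1 e2 => [v L|a b|a b] //= he e1 e2 _.
move: e2 => /bsveq; rewrite gmulK => /(toral_cycle (proj2 he)) [i e].
by apply: (toral_stable_free (n := 1) (proj2 he)); rewrite // gzpow_one e.
Qed.

(** Only loop edges have ends of the same type, and inverting one would put [b^2] into [<a>]. *)
Lemma BSadj_noinv g p q : Xadj p q -> ~ (BSact g p = q /\ BSact g q = p).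
Proof.
suff h e k p' q' : joins e k p' q' -> BSact g p' = q' -> BSact g q' = p' -> False.
  by move=> /BSadjP [e [k [j|j]]] [h1 h2]; apply: (h _ _ _ _ j).
move=> [he [-> ->]]; rewrite !BSact_bsv => h1 h2; have := bsv_type h1.
case: e he h1 h2 => [v L|a b|a b] //= he h1 h2 _.
have [lf m2] := proj2 he.
move: h1 h2 => /bsveq /(toral_cycle (proj2 he)) [i ei] /bsveq /(toral_cycle (proj2 he)) [j ej].
have comm : gcomm (gen a) (gen b).
  by have := gen_braid pres (proj1 (proj2 lf)); rewrite m2 /= !gmulg1.
apply: (toral_stable_free (n := 2) (i := (i - j)%Z) (proj2 he)) => //.
have -> : (i - j = i + - j)%Z by lia.
rewrite -[2%Z]/(1 + 1)%Z !gzpowD gzpow_opp !gzpow_one.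
have e1 : k^-1 ** g^-1 ** k = gen b ** gzpow (gen a) j by rewrite -ej; grp.
have c : gcomm (gen b) (gzpow (gen a) j) by apply/gcommZ/gcomm_sym.
have -> : gzpow (gen a) i = gen b ** gen b ** gzpow (gen a) j.
  rewrite -ei; have -> : (g ** k)^-1 ** (k ** gen b) = k^-1 ** g^-1 ** k ** gen b by grp.
  by rewrite e1 -!gmulA c.
by grp.
Qed.

Let Xsym : forall p q, Xadj p q -> Xadj q p.
Proof. exact: BSadj_sym. Qed.

(** * Minimality of the action *)

Section Minimality.
Variable S : X -> Prop.
Hypothesis S_conn : forall x y, S x -> S y -> exists s, walk Xadj x s y /\ forall z, In z s -> S z.
Hypothesis S_act : forall g x, S x -> S (BSact g x).

Lemma S_convex x y z : S x -> S z -> B x y z -> S y.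
Proof.
move=> Sx Sz b; have [s [ws Ss]] := S_conn Sx Sz.
by case: (between_in_geo b) => [->//|/(geo_in_walk ws)/Ss].
Qed.

(** [y] is the first vertex on the way from [x] to [S]. If [g] fixes [x], the paths to [s] and to
    [g s] agree until they reach the invariant convex set [S], so [g] fixes [y]. *)
Lemma outside_nbr x s : S s -> ~ S x -> exists y, Xadj x y /\
  forall g, BSact g x = x -> BSact g y = y.
Proof.
move=> Ss nx.
have xs : 0 < d x s.
  by rewrite lt0n; apply/eqP => e; apply: nx; rewrite (dist_eq0 e).
have [y b dy] := between_point xs; exists y; split; first exact: adj_dist dy.
move=> g gx; have [z [b1 b2 b3]] := median Xsym BS_is_tree x s (BSact g s).
have Sz : S z by apply: S_convex b3 => //; apply: S_act.
have xz : 1 <= d x z.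
  by rewrite lt0n; apply/eqP => e; apply: nx; rewrite (dist_eq0 e).
have b' : B x (BSact g y) (BSact g s) by rewrite /between -{1 2}gx !BSdist_act.
have dy' : d x (BSact g y) = 1 by rewrite -{1}gx BSdist_act.
have c1 : B x y z by apply: between_order b b1 _; rewrite dy.
have c2 : B x (BSact g y) z by apply: between_order b' b2 _; rewrite dy'.
by apply: between_unique c2 c1 _; rewrite dy dy'.
Qed.

(* A vertex and its translate have the same distance to S, but distances of adjacent
   vertices to a subtree differ by one. *)
Lemma outside_translate x s g : S s -> ~ S x -> Xadj x (BSact g x) -> False.
Proof.
move=> Ss nx xgx.
have [D [c [Sc dc]] Dmin] : exists2 D, (exists c, S c /\ d x c = D) &
    forall k, (exists c, S c /\ d x c = k) -> D <= k.
  by apply: nat_least; exists (d x s), s.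
have D0 : 0 < D.
  by rewrite lt0n -dc; apply/eqP => e; apply: nx; rewrite (dist_eq0 e).
have d1 : d x (BSact g x) = 1.
  by apply: dist_adj => // e; apply: (@BSadj_irr x); rewrite {2}e.
have gate c' : S c' -> B x c c'.
  move=> Sc'; have [z [b1 b2 b3]] := median Xsym BS_is_tree x c c'.
  have le : D <= d x z by apply: Dmin; exists z; split=> //; apply: S_convex b3.
  have -> // : c = z.
  apply/esym; apply: (dist_eq0 (tree := BS_is_tree)); move: b1; rewrite /between dc; lia.
have Sgc : S (BSact g c) by apply: S_act.
have b1 := gate _ Sgc.
have b2 : B (BSact g x) (BSact g c) c.
  have k : B (BSact g x) (BSact g c) (BSact g (BSact g^-1 c)).
    by rewrite /between !BSdist_act; apply: gate; apply: S_act.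
  by rewrite BSactM gmulVV BSact1 in k.
case: (classic (c = BSact g c)) => [e|ne].
- have [z [c1 c2 c3]] := median Xsym BS_is_tree c x (BSact g x).
  have e1 : d c (BSact g x) = D.
    by rewrite (dist_sym Xsym) {1}e BSdist_act.
  have e2 : d c x = D by rewrite (dist_sym Xsym).
  move: c1 c2 c3; rewrite /between e1 e2 d1 (dist_sym Xsym _ x z); lia.
- have [c1 _] := between_concat Xsym b1 (between_sym Xsym b2) ne.
  move: c1 (between_sym Xsym b2); rewrite /between d1 dc.
  rewrite (dist_sym Xsym _ (BSact g c) (BSact g x)) BSdist_act dc; lia.
Qed.

Lemma two_inside x y y' : S y -> S y' -> Xadj x y -> Xadj x y' -> y <> y' -> S x.
Proof.
move=> Sy Sy' xy xy' ne; apply: S_convex Sy Sy' _.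
have dist1 z : Xadj x z -> d x z = 1.
  by move=> xz; apply: dist_adj => // e; apply: (@BSadj_irr x); rewrite {2}e.
have [z [b1 b2 b3]] := median Xsym BS_is_tree x y y'.
have d1 := dist1 _ xy; have d2 := dist1 _ xy'.
suff zx : z = x by rewrite -zx.
apply/esym; apply: NNPP => xz; apply: ne.
have z0 : d x z <> 0 by move=> e; apply: xz; apply: dist_eq0 e.
have e1 : z = y by apply: (dist_eq0 (tree := BS_is_tree)); move: b1; rewrite /between d1; lia.
by rewrite -e1; apply: (dist_eq0 (tree := BS_is_tree)); move: b2; rewrite /between d2; lia.
Qed.

Lemma stab_bsv g h u (hu : valid u) : BSact h (bsv g hu) = bsv g hu <-> H u (g^-1 ** h ** g).
Proof.
have [_ [_ hV]] := Hsub u; rewrite BSact_bsv bsveq; split=> k; have := hV _ k; by grp.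
Qed.

Lemma black_nbr L g y (hL : valid (JBlack L)) : (~ exists a b, toral_leaf adj m L a b) ->
  Xadj (bsv g hL) y -> exists u k (hu : valid u) c, y = bsv k hu /\
  forall h, H u h -> exists i, h = gzpow c i.
Proof.
move=> nt /BSadjP [e [k [[he [e1 e2]]|[he [e1 e2]]]]].
- have := bsv_type e1; case: e he e1 e2 => [v M|a b|a b] //= he e1 e2 [eL].
  + by case: nt; exists a, b; rewrite eL; have [_ tl] := he.
  + exists (JRed a b), (k ** gone), he, (gen a ** gen b); split.
      by rewrite e2; apply: bsv_irr.
    by move=> h /gsub_cycle.
- have := bsv_type e2; case: e he e1 e2 => [v M|a b|a b] //= he e1 e2 [eL].
  + exists (JWhite v), k, (proj1 he), (gen v); split; first by rewrite e1; apply: bsv_irr.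
    by move=> h /gsub_cycle.
  + by case: nt; exists a, b; rewrite eL; have [_ tl] := he.
Qed.

(** Outside [S] the stabiliser of the vertex would fix a neighbour. If [L] is not toral, neighbours
    have cyclic stabilisers, while the black group contains two elements without common nontrivial
    powers: [a] and [z_ab], or two generators. A toral vertex is adjacent to a translate of
    itself. *)
Lemma black_inside L g (hL : valid (JBlack L)) s : S s -> S (bsv g hL).
Proof.
move=> Ss; apply: NNPP => nx.
case: (classic (exists a b, toral_leaf adj m L a b)) => [[a [b tl]]|nt].
  have eL := proj1 (proj1 tl); subst L; have he : evalid (ELoop a b) by [].
  apply: (outside_translate (g := g ** gen b ** g^-1) Ss nx).
  rewrite BSact_bsv; have -> : g ** gen b ** g^-1 ** g = g ** gen b by grp.
  exact: joins_adj (@joins_valid (ELoop a b) g hL hL he).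
have [y [xy fy]] := outside_nbr Ss nx.
have [u [k [hu [c [ey cyc]]]]] := black_nbr nt xy.
(* Conjugation by [k^-1 g] carries the black group into [<c>]; [i] and [j] are the exponents of the
   images of [h] and [h']. *)
have dep h h' : H (JBlack L) h -> H (JBlack L) h' -> exists i j,
    [/\ gzpow h j = gzpow h' i, i = 0%Z -> h = gone & j = 0%Z -> h' = gone].
  have conj t : H (JBlack L) t -> exists i, k^-1 ** g ** t ** (k^-1 ** g)^-1 = gzpow c i.
    move=> Ht; have : BSact (g ** t ** g^-1) (bsv g hL) = bsv g hL.
      by apply/stab_bsv; move: Ht; grp.
    move=> /fy; rewrite ey => /stab_bsv /cyc [i ei]; exists i; rewrite -ei; by grp.
  move=> /conj [i ei] /conj [j ej]; exists i, j.
  set z := k^-1 ** g in ei ej.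
  have inj t t' : z ** t ** z^-1 = z ** t' ** z^-1 -> t = t'.
    by move/gmulIr/gmulI.
  split.
  - by apply: inj; rewrite -!gzpow_conj ei ej -!gzpowM Z.mul_comm.
  - by move=> i0; apply: inj; rewrite ei i0; grp.
  - by move=> j0; apply: inj; rewrite ej j0; grp.
have ntriv v : gen v <> gone.
  move=> e; have := @gen_infinite V adj m G gen adj_sym adj_irr m_sym m_ge2 card3 pres v 1%Z.
  by rewrite gzpow_one => /(_ e).
have [[a [b tl]]|[[a [b bl]]|ne]] := leaf_cases m_ge2 L.
- by apply: nt; exists a, b.
- have inH t : gsub (fun x => x = gen a \/ x = zz a b) t -> H (JBlack L) t.
    by move=> h; apply/(Jblack_braided gen adj_sym adj_irr gconn card3 _ bl).
  have [i [j [e i0 _]]] := dep _ _ (inH _ (gs_in (or_introl erefl)))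
    (inH _ (gs_in (or_intror erefl : (fun x => x = gen a \/ x = zz a b) _))).
  have [lf [ev _]] := bl.
  apply: (ntriv a); apply: i0.
  suff : (- i = 0)%Z by lia.
  apply: (@zelt_free V adj m G gen adj_sym adj_irr m_sym m_ge2 card3 pres a b j) => //.
    by case: lf => _ [].
  by rewrite gzpow_opp e gmulVV.
- have [/set0Pn [a aL] _] := proj1 hL.
  have [b bL ab] := big_chunk_nbr adj_sym adj_irr gconn card3 hL aL.
  have inH v : v \in L -> H (JBlack L) (gen v).
    by move=> vL; apply/Jblack_other => //; apply: gs_in; exists v.
  have [i [j [e _ j0]]] := dep _ _ (inH _ aL) (inH _ bL).
  apply: (ntriv b); apply: j0.
  exact: (gens_neq adj_sym adj_irr m_sym m_ge2 pres (adj_neq adj_irr ab) e).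
Qed.

(** White and red vertices lie between two distinct black ones. For a white [v], two neighbours that
    it separates lie in different chunks. For a red vertex the black cosets of [g] and [g ab]
    differ: otherwise [ab] would lie in [<a, z_ab>] and commute with [a]. *)
Lemma all_inside s p : S s -> S p.
Proof.
move=> Ss; have [u [g [hu ->]]] := BSv_cases p; case: u hu => [v|L|a b] hu.
- have [w [w' [vw vw' nc]]] := separating_nbrs adj_sym gconn hu.
  have [L [hL vL wL]] := edge_big_chunk adj_sym vw.
  have [L' [hL' vL' wL']] := edge_big_chunk adj_sym vw'.
  have adjw M (hM : valid (JBlack M)) : v \in M -> Xadj (bsv g hu) (bsv g hM).
    move=> vM; have he : evalid (EWB v M) by [].
    by have /joins_adj := @joins_valid (EWB v M) g hu hM he; rewrite gmulg1.
  apply: (two_inside (black_inside g hL Ss) (black_inside g hL' Ss)).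
  + exact: adjw.
  + exact: adjw.
  + move=> /bsv_type [e]; subst L'; apply: nc.
    apply: (@conn_sub _ _ (L :\ v)).
      by apply/subsetP => z; rewrite !inE => /andP [].
    apply: (chunk_remove (proj1 hL) vL); rewrite in_setD1 ?wL ?wL' andbT eq_sym;
      exact/eqP/(adj_neq adj_irr).
- exact: black_inside Ss.
- have [hb bl] := hu; have [lf [ev m4]] := bl.
  have adjr k : Xadj (bsv k hu) (bsv k (hb : valid (JBlack [set a; b]))).
    by apply: BSadj_sym; have /joins_adj := @joins_valid (ERed a b) k hb hu hu; rewrite gmulg1.
  have er : bsv (g ** (gen a ** gen b)) hu = bsv g hu by apply: bsv_right; apply: gs_in.
  apply: (two_inside (black_inside g hb Ss) (black_inside (g ** (gen a ** gen b)) hb Ss)).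
  + exact: adjr.
  + by rewrite -er.
  + move=> /bsveq; rewrite gmulK => /(Jblack_braided gen adj_sym adj_irr gconn card3 _ bl) hab.
    have ab := proj1 (proj2 lf).
    have c : gcomm (gen a) (gen a ** gen b).
      apply: (gsub_cent _ hab) => x [->|->] //.
      by have [] := zelt_comm pres ab ev.
    have : 1%Z = 0%Z; last by [].
    apply: (@gens_conj_neq V adj m G gen adj_sym adj_irr m_sym m_ge2 pres a b 1 1 ab); first lia.
    by rewrite gzpow_one; apply: (@gmulI _ (gen a)); rewrite c gmulA.
Qed.

End Minimality.

Lemma BS_Gtree : is_Gtree (BS_tree adj m gen).
Proof.
split; last split; last split; last split; last split; last split; last split; last split.
- have [v _] : exists v : V, v \in predT by apply/card_gt0P; apply: leq_trans card3.
  have [L bL _] := vertex_chunk v; exact: (inhabits (bsv gone bL)).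
- exact: BSadj_sym.
- exact: BSadj_irr.
- exact: BS_is_tree.
- exact: BSact1.
- exact: BSactM.
- move=> g x y; split; first exact: BSadj_act.
  move=> h; have := BSadj_act g^-1 h; by rewrite /= !BSactM gmulV !BSact1.
- by move=> g x y xy; apply: BSadj_noinv.
- by move=> S [s Ss] S_conn S_act x; apply: (all_inside S_conn S_act x Ss).
Qed.

(** Every edge has an end with cyclic stabiliser: the white end, the red end, or either end of a
    loop edge. *)
Lemma BS_VC : VC_tree (BS_tree adj m gen).
Proof.
split=> [|x y xy]; first exact: BS_Gtree.
have cyc u g (hu : valid u) c : (forall h, H u h -> exists i, h = gzpow c i) ->
    bsv g hu = x \/ bsv g hu = y -> virtually_cyclic (@edge_stab G (BS_tree adj m gen) x y).
  move=> hc hxy.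
  apply: (@subgroup_of_cyclic_virtually_cyclic _ _ (g ** c ** g^-1)).
    have [h1 [h2 h3]] := stab_subgroup BS_Gtree x.
    have [k1 [k2 k3]] := stab_subgroup BS_Gtree y.
    split; [by []|split] => [s t [sx sy] [tx ty]|s [sx sy]].
    - by split; [apply: h2|apply: k2].
    - by split; [apply: h3|apply: k3].
  move=> h [hx hy]; have : BSact h (bsv g hu) = bsv g hu by case: hxy => ->.
  move=> /stab_bsv /hc [i ei]; exists i; rewrite gzpow_conj -ei; by grp.
have jc e g p q : joins e g p q -> (p = x /\ q = y) \/ (p = y /\ q = x) ->
    virtually_cyclic (@edge_stab G (BS_tree adj m gen) x y).
  move=> [he [-> ->]] hpq; case: e he hpq => [v L|a b|a b] /= he hpq.
  - apply: (cyc (JWhite v) g (proj1 he) (gen v)); first by move=> h /gsub_cycle.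
    by rewrite (bsv_irr _ _ (Evalid_orig (he : evalid (EWB v L)))); case: hpq => -[-> _]; auto.
  - apply: (cyc (JBlack [set a; b]) g (proj1 he) (gen a)).
      by move=> h; apply: toral_cycle (proj2 he).
    by rewrite (bsv_irr _ _ (Evalid_orig (he : evalid (ELoop a b)))); case: hpq => -[-> _]; auto.
  - apply: (cyc (JRed a b) (g ** gone) he (gen a ** gen b)); first by move=> h /gsub_cycle.
    by rewrite (bsv_irr _ _ (Evalid_term (he : evalid (ERed a b)))); case: hpq => -[_ ->]; auto.
move/BSadjP: xy => [e [g [j|j]]]; apply: (jc _ _ _ _ j); auto.
Qed.

Lemma BS_stab_elliptic x (T : GTree G) : VC_tree T ->
  elliptic (@stab G (BS_tree adj m gen) x) T.
Proof.
move=> vT; have [u [g [hu ->]]] := BSv_cases x.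
have [z hz] := Jvgroup_elliptic adj_sym adj_irr m_sym m_ge2 gconn card3 pres vT hu.
exists (tact T g z) => h /stab_bsv /hz; rewrite -!(tactM (proj1 vT)) => e.
by rewrite -{2}e (tactVK (proj1 vT)).
Qed.

End BassSerreTree.

Theorem theorem3p9 (V : finType) (adj : rel V) (m : V -> V -> nat)
  (G : Grp) (gen : V -> G)
  (adj_sym : symmetric adj) (adj_irr : irreflexive adj)
  (m_sym : forall a b, adj a b -> m a b = m b a)
  (m_ge2 : forall a b, adj a b -> 2 <= m a b)
  (conn : connected_in adj [set: V]) (card3 : 3 <= #|V|)
  (pres : artin_presentation adj m gen) :
  (forall T : GTree G, VC_tree T ->
     forall u : JV V, Jvalid adj m u -> elliptic (Jvgroup adj m gen u) T) /\
  JSJ_tree (BS_tree adj m gen).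
Proof.
split=> [T vT u hu|].
  exact: (Jvgroup_elliptic adj_sym adj_irr m_sym m_ge2 conn card3 pres vT hu).
have ell x T := @BS_stab_elliptic V adj m G gen adj_sym adj_irr m_sym m_ge2 conn card3 pres x T.
(* Vertex stabilisers are elliptic in every VC-tree, in particular in the universally elliptic ones,
   and an edge stabiliser fixes whatever the stabiliser of its end fixes. *)
split; [exact: BS_VC|split] => [x y _ T /ell h|x T /ell h _]; last exact: h.
by have [z hz] := h x; exists z => g [gx _]; apply: hz.
Qed.
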